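(* Consider running D-MASG (multistage D-ASG) with the parameters: $k_1\ge1$ an integer, $\alpha_1=\frac{\lambda_N^W}{L+\mu}$, and for $t\ge2$, $k_t=2^t\left\lceil p\sqrt{\tilde\kappa}\log 2\right\rceil$, $\alpha_t=\frac{\lambda_N^W}{2^{2t}(L+\mu)}$, with $p\ge7$. Below $\mathcal{O}(1)$ denotes a positive constant that does not depend on $k$. (i) By choosing $k_1=\left\lceil(p-2)\log(6p\tilde\kappa)\sqrt{\tilde\kappa}\right\rceil$, for any $k\ge2k_1$, $$\mathbb{E}\left[\|x^{(k)}-x^*\|^2\right]\le\mathcal{O}(1)\left(\frac{1}{k^{p-2}}\|x^{(0)}-x^*\|^2+\frac{Np\,\sigma^2}{\mu^2k}+\frac{Np^4C_1^2(1-\gamma)^{-2}}{\mu^2k^4}\right).$$ (ii) For a given number of iterations $k$, by choosing $p=7$ and $k_1=\lceil k/C\rceil$ for some constant $C\ge2$, for any $k\ge2\sqrt{\tilde\kappa}$, $$\mathbb{E}\left[\|x^{(k)}-x^*\|^2\right]\le\mathcal{O}(1)\left(\exp\left(-\frac{k}{C\sqrt{\tilde\kappa}}\right)\|x^{(0)}-x^*\|^2+\frac{N\sigma^2}{\mu^2k}+\frac{NC_1^2(1-\gamma)^{-2}}{\mu^2k^4}\right).$$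
   Context: Functions: $f_1,\dots,f_N:\mathbb{R}^d\to\mathbb{R}$ are each $\mu$-strongly convex with $L$-Lipschitz gradient ($0<\mu\le L$), $\kappa=L/\mu$. $x_*\in\mathbb{R}^d$ is the unique minimizer of $f=\frac1N\sum_{i=1}^N f_i$; $x^*=[x_*^T,\dots,x_*^T]^T\in\mathbb{R}^{Nd}$. $F(x_1,\dots,x_N)=\sum_{i=1}^N f_i(x_i)$ on $\mathbb{R}^{Nd}$. Network: $(\mathcal V,\mathcal E)$ is a connected undirected graph on $\{1,\dots,N\}$; $W$ is a symmetric doubly stochastic $N\times N$ matrix with, for $i\ne j$, $W_{ij}>0$ if $(i,j)\in\mathcal E$ and $W_{ij}=0$ otherwise, and $W_{ii}=1-\sum_{j\neq i}W_{ij}>0$. Its eigenvalues are $1=\lambda_1^W>\lambda_2^W\ge\cdots\ge\lambda_N^W$, and it is assumed that $\lambda_N^W>0$. $\gamma:=\max\{|\lambda_2^W|,|\lambda_N^W|\}$; $\mathcal{W}:=W\otimes I_d$. Scaled condition number: $\tilde\kappa:=\frac{L+\mu}{\mu\lambda_N^W}=\frac{\kappa+1}{\lambda_N^W}$. D-MASG: given deterministic $x^{(0)}\in\mathbb{R}^{Nd}$, stepsizes $\alpha_1,\alpha_2,\dots$ and stage lengths $k_1,k_2,\dots$, set $x^{(0,k_0)}=x^{(0)}$. For each stage $t=1,2,\dots$: set $x^{(t,-1)}=x^{(t,0)}=x^{(t-1,k_{t-1})}$ and $\beta_t=\frac{1-\sqrt{\mu\alpha_t}}{1+\sqrt{\mu\alpha_t}}$,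 and for $m=0,\dots,k_t-1$ set $y^{(t,m)}=(1+\beta_t)x^{(t,m)}-\beta_tx^{(t,m-1)}$, $x^{(t,m+1)}=\mathcal Wy^{(t,m)}-\alpha_t\tilde\nabla F(y^{(t,m)})$. With $L_t=\sum_{i=1}^tk_i$, $L_0=0$, the concatenated sequence is $x^{(k)}=x^{(t,k-L_{t-1})}$ for $L_{t-1}<k\le L_t$ (the number of stages is taken large enough that $x^{(k)}$ is defined). Noise: $\tilde\nabla F(y)$ stacks stochastic gradients $\tilde\nabla f_i(y_i,w_i)$, where at each iteration the noise variable $w_i$ of node $i$ is independent of all noise variables of previous iterations and of those of the other nodes at the same iteration; conditionally on the evaluation point $y_i$, $\tilde\nabla f_i(y_i,w_i)$ has mean $\nabla f_i(y_i)$ and $\mathbb{E}[\|\tilde\nabla f_i(y_i,w_i)-\nabla f_i(y_i)\|^2\,|\,y_i]\le\sigma^2$. Constant: $C_1:=\sqrt{2L\sum_{i=1}^N(f_i(0)-f_i^* )}\cdot\left(1+\frac{2(L+\mu)}{\mu}\right)$ with $f_i^*:=\min_{x\in\mathbb{R}^d}f_i(x)$. The paper's convention for $\mathcal{O}$: for functions of positive integers, $f=\mathcal{O}(g)$ means $f(n)\le C_ug(n)$ for some constant $C_u$ and all large $n$. *)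

(* Defs.v *)
From HB Require Import structures.
From mathcomp Require Import all_boot all_order all_algebra.
From mathcomp Require Import all_classical all_reals all_analysis.

Set Implicit Arguments.
Unset Strict Implicit.
Unset Printing Implicit Defensive.

Import Order.TTheory GRing.Theory Num.Theory.
Import numFieldNormedType.Exports.

Local Open Scope classical_set_scope.
Local Open Scope ring_scope.

(* A point of R^d is a row vector; a point (x_1, ..., x_N) of R^(Nd) is the
   N x d matrix whose i-th row is x_i.  With this encoding (W (x) I_d) x is the
   matrix product W *m x. *)

(* Euclidean norm: the library norm `|x| on matrices is the sup norm.  For an
   N x d matrix this is the Euclidean norm of the stacked vector. *)
Definition norm2 (R : realType) (m n : nat) (x : 'M[R]_(m, n)) : R :=
  Num.sqrt (\sum_(i < m) \sum_(j < n) x i j ^+ 2).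

Definition stack (R : realType) (N d : nat) (x : 'rV[R]_d) : 'M[R]_(N, d) :=
  \matrix_(i < N) x.

Definition grad (R : realType) (d : nat) (f : 'rV[R]_d -> R) (x : 'rV[R]_d) :
    'rV[R]_d :=
  \row_(j < d) 'D_(delta_mx 0 j) (f : 'rV[R]_d -> R^o) x.

Definition strongly_convex (R : realType) (d : nat) (mu : R)
    (f : 'rV[R]_d -> R) : Prop :=
  forall (x y : 'rV[R]_d) (s : R), 0 <= s <= 1 ->
    f (s *: x + (1 - s) *: y) <=
      s * f x + (1 - s) * f y - mu / 2 * s * (1 - s) * norm2 (x - y) ^+ 2.

Definition lipschitz_gradient (R : realType) (d : nat) (L : R)
    (f : 'rV[R]_d -> R) : Prop :=
  (forall x : 'rV[R]_d, differentiable (f : 'rV[R]_d -> R^o) x) /\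
  (forall x y : 'rV[R]_d, norm2 (grad f x - grad f y) <= L * norm2 (x - y)).

Definition average (R : realType) (N d : nat) (f : 'I_N -> 'rV[R]_d -> R)
    (x : 'rV[R]_d) : R :=
  N%:R^-1 * \sum_(i < N) f i x.

(* Under strong convexity a minimizer of the average exists and is unique, and
   inf (range (f i)) is attained, i.e. it is the minimum f_i^*. *)
Definition minimizer (R : realType) (d : nat) (h : 'rV[R]_d -> R)
    (xs : 'rV[R]_d) : Prop :=
  forall x : 'rV[R]_d, h xs <= h x.

Definition C1 (R : realType) (N d : nat) (mu L : R)
    (f : 'I_N -> 'rV[R]_d -> R) : R :=
  Num.sqrt (2 * L * \sum_(i < N) (f i 0 - inf (range (f i))))
  * (1 + 2 * (L + mu) / mu).

Definition connected_graph (N : nat) (E : rel 'I_N) : Prop :=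
  [/\ symmetric E, irreflexive E & forall i j : 'I_N, connect E i j].

Record mixing_matrix (R : realType) (N : nat) (E : rel 'I_N) (W : 'M[R]_N) :
    Prop := MixingMatrix {
  mixing_sym : W^T = W;
  mixing_row : forall i, \sum_(j < N) W i j = 1;
  mixing_col : forall j, \sum_(i < N) W i j = 1;
  mixing_edge : forall i j, i != j -> E i j -> 0 < W i j;
  mixing_nonedge : forall i j, i != j -> ~~ E i j -> W i j = 0;
  mixing_diag : forall i, 0 < W i i }.

(* The eigenvalues of W with multiplicity, in nonincreasing order.  Indices are
   shifted: the k-th eigenvalue is lam`_(k-1), and lam`_N.-1 is the last one. *)
Definition eigenvalues (R : realType) (N : nat) (W : 'M[R]_N) (lam : seq R) :
    Prop :=
  char_poly W = \prod_(a <- lam) ('X - a%:P) /\ sorted >=%R lam.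

Definition gamma (R : realType) (N : nat) (lam : seq R) : R :=
  Num.max `|lam`_1| `|lam`_N.-1|.

Definition kappa_tilde (R : realType) (mu L lamN : R) : R :=
  (L + mu) / (mu * lamN).

Section DMASG.
Variables (R : realType) (N d : nat) (W : 'M[R]_N) (mu : R).
(* Stepsizes alpha t and stage lengths len t are used for t >= 1 only. *)
Variables (alpha : nat -> R) (len : nat -> nat).
(* ngrad n : the stochastic gradient map of the n-th iteration overall, where
   iterations are numbered from 0 across stages. *)
Variables (ngrad : nat -> 'M[R]_(N, d) -> 'M[R]_(N, d)) (x0 : 'M[R]_(N, d)).

Definition total_len (t : nat) : nat := (\sum_(1 <= i < t.+1) len i)%N.

Definition beta (t : nat) : R :=
  (1 - Num.sqrt (mu * alpha t)) / (1 + Num.sqrt (mu * alpha t)).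

Definition extrapolate (t : nat) (z : 'M[R]_(N, d) * 'M[R]_(N, d)) :
    'M[R]_(N, d) :=
  (1 + beta t) *: z.1 - beta t *: z.2.

(* The pair (x^(t,m), x^(t,m-1)) when stage t starts from x. *)
Fixpoint stage_run (t : nat) (x : 'M[R]_(N, d)) (m : nat) :
    'M[R]_(N, d) * 'M[R]_(N, d) :=
  if m is m'.+1 then
    let z := stage_run t x m' in
    let y := extrapolate t z in
    (W *m y - alpha t *: ngrad (total_len t.-1 + m')%N y, z.1)
  else (x, x).

(* x^(t,k_t), where x^(0,k_0) = x^(0) *)
Fixpoint stage_end (t : nat) : 'M[R]_(N, d) :=
  if t is t'.+1 then (stage_run t (stage_end t') (len t)).1 else x0.

(* x^(t,m) and y^(t,m), for t >= 1.  The k-th term (k >= 1) of the concatenated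
   sequence is dmasg_x t (k - total_len t.-1) for the unique t such that
   total_len t.-1 < k <= total_len t. *)
Definition dmasg_x (t m : nat) : 'M[R]_(N, d) :=
  (stage_run t (stage_end t.-1) m).1.
Definition dmasg_y (t m : nat) : 'M[R]_(N, d) :=
  extrapolate t (stage_run t (stage_end t.-1) m).

End DMASG.

(* For nonnegative x this is the usual ceiling. *)
Definition natceil (R : realType) (x : R) : nat := `|Num.ceil x|%N.

Definition stepsize (R : realType) (mu L lamN : R) (t : nat) : R :=
  if t == 1%N then lamN / (L + mu) else lamN / (2 ^+ (2 * t) * (L + mu)).

Definition stage_length (R : realType) (kt p : R) (k1 : nat) (t : nat) : nat :=
  if t == 1%N then k1 else (2 ^ t * natceil (p * Num.sqrt kt * ln 2))%N.

Definition borel_rV (R : realType) (d : nat) :=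
  g_sigma_algebraType (@open 'rV[R]_d).

(* phi o Y is a version of E[Z | Y]: it has the same integral as Z over every
   event of the sigma-algebra generated by Y. *)
Definition cond_exp_eq (R : realType) (dO : measure_display)
    (Om : measurableType dO) (P : probability Om R) (d : nat)
    (Y : Om -> 'rV[R]_d) (Z : Om -> R) (phi : 'rV[R]_d -> R) : Prop :=
  P.-integrable setT (EFin \o Z) /\
  forall B : set (borel_rV R d), measurable B ->
    (\int[P]_(om in Y @^-1` B) (Z om)%:E =
     \int[P]_(om in Y @^-1` B) (phi (Y om))%:E)%E.

(* E[Z | Y] <= c almost surely, for Z >= 0. *)
Definition cond_exp_le (R : realType) (dO : measure_display)
    (Om : measurableType dO) (P : probability Om R) (d : nat)
    (Y : Om -> 'rV[R]_d) (Z : Om -> R) (c : R) : Prop :=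
  forall B : set (borel_rV R d), measurable B ->
    (\int[P]_(om in Y @^-1` B) (Z om)%:E <= c%:E * P (Y @^-1` B))%E.

Section Noise.
Variables (R : realType) (N d : nat).
Variables (dO : measure_display) (Om : measurableType dO).
Variables (P : probability Om R).
Variables (dZ : measure_display) (Z : 'I_N -> measurableType dZ).
(* g i y w is the stochastic gradient of node i; w n i is the noise variable of
   node i at the n-th iteration. *)
Variables (g : forall i : 'I_N, 'rV[R]_d -> Z i -> 'rV[R]_d).
Variables (w : nat -> forall i : 'I_N, Om -> Z i).

(* Events of a single noise variable among those of the iterations before n and
   those of the nodes other than i at iteration n. *)
Definition other_noise_events (n : nat) (i : 'I_N) : set (set Om) :=
  [set A | exists (l : nat) (j : 'I_N) (U : set (Z j)),
     [/\ (l < n)%N \/ (l = n /\ j != i), measurable U & A = w l j @^-1` U]].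

Definition noise_independent : Prop :=
  forall (n : nat) (i : 'I_N) (U : set (Z i)) (A : set Om),
    measurable U -> <<s other_noise_events n i >> A ->
    P (w n i @^-1` U `&` A) = (P (w n i @^-1` U) * P A)%E.

Definition noisy_grad (om : Om) (n : nat) (y : 'M[R]_(N, d)) :
    'M[R]_(N, d) :=
  \matrix_(i < N) g (row i y) (w n i om).

Definition measurable_noise : Prop :=
  (forall i : 'I_N, measurable_fun [set: borel_rV R d * Z i]
     (fun q => g q.1 q.2 : borel_rV R d)) /\
  (forall (n : nat) (i : 'I_N), measurable_fun setT (w n i)).

(* Conditional mean and variance at the point Y evaluated by node i at
   iteration n. *)
Definition unbiased_bounded_noise (f : 'I_N -> 'rV[R]_d -> R) (sigma : R)
    (n : nat) (i : 'I_N) (Y : Om -> 'rV[R]_d) : Prop :=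
  (forall j : 'I_d,
     cond_exp_eq P Y (fun om => g (Y om) (w n i om) 0 j)
                     (fun y => grad (f i) y 0 j)) /\
  cond_exp_le P Y
    (fun om => norm2 (g (Y om) (w n i om) - grad (f i) (Y om)) ^+ 2)
    (sigma ^+ 2).

Definition noise_assumptions (W : 'M[R]_N) (mu : R) (alpha : nat -> R)
    (len : nat -> nat) (x0 : 'M[R]_(N, d)) (f : 'I_N -> 'rV[R]_d -> R)
    (sigma : R) : Prop :=
  [/\ measurable_noise, noise_independent &
   forall (t m : nat) (i : 'I_N), (0 < t)%N -> (m < len t)%N ->
     unbiased_bounded_noise f sigma (total_len len t.-1 + m)%N i
       (fun om => row i (dmasg_y W mu alpha len (noisy_grad om) x0 t m))].

End Noise.

(* Main.v *)
Require Import Defs.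
From HB Require Import structures.
From mathcomp Require Import all_boot all_order all_algebra.
From mathcomp Require Import all_classical all_reals all_analysis.
From mathcomp Require Import ring lra zify measurable_realfun.
From mathcomp.real_closed Require complex.

Import Order.TTheory GRing.Theory Num.Theory.
Import numFieldNormedType.Exports.

Local Open Scope classical_set_scope.
Local Open Scope ring_scope.

Set Implicit Arguments.
Unset Strict Implicit.
Unset Printing Implicit Defensive.

(** Write q for the square root of mu alpha_t during stage t, so that
    alpha_t = q^2 / mu and beta_t = (1 - q) / (1 + q), and split each iterate into
    its network average and its deviation from that average.

    The average performs an inexact Nesterov step on f: its energy contracts by
    the factor 1 - q, up to O(q) times the size of the deviation and
    O(q^2 sigma^2).  The deviation obeys an inertial consensus iteration whose
    Lyapunov function contracts by a factor that does not depend on q, up to O(q^4)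
    times sigma^2 + |grad F(x^* )|^2 + energy + deviation, and
    |grad F(x^* )| <= C_1.  The terms linear in the noise have zero expectation,
    since the evaluation points are functions of the past.  So, once q is small,
    energy + O(q) deviation contracts by the factor 1 - (1 - 1/p) q, up to
    O(q^2 sigma^2 + q^5 |grad F(x^* )|^2).  A stage of length at least p ln(2) / q
    thus gains the factor 2^(1-p), of which restarting the momentum loses at most
    2, and after t stages, when k is comparable to 2^t, the error is
    O(2^(-(p-2)t) |x^(0) - x^*|^2 + 2^(-t) sigma^2 + 2^(-4t) C_1^2).

    The stages for which q is not yet small are boundedly many; there an iteration
    is an exact Nesterov step on the penalized function
    F(x) + <x, (I - W) x> / (2 alpha_t), which is mu-strongly convex and
    (1 / alpha_t)-smooth as alpha_t L <= lambda_N.  This also yields the factor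
    (1 - 1 / sqrt(kappa~))^(k_1) of the first stage. *)

(** The penalized function alone cannot carry the proof: passing from the distance to its energy and
    back costs a factor of order 1 / alpha_t per stage. It is used only below a threshold stage
    fixed by the network, d, mu, L and p, and is measured from consensus at the optimum, which is
    not its minimizer; hence a term in C_1^2 that no iteration removes.

    Beyond the threshold, energy and deviation feed each other. Weighting the deviation by a
    multiple of q closes the loop, but such a potential bounds the deviation only up to 1 / q. A
    second pass, with the energy already bounded, recovers the deviation itself.

    The condition p >= 7 makes 2^(-(p-2)) at most 1/32, strictly below the factor 1/16 by which the
    C_1 term decays from stage to stage; the surplus absorbs what each stage adds.

    Unbiasedness is given conditionally on a node's own evaluation point, whereas the directions
    tested against the noise involve all nodes. Independence from the whole past bridges this. *)

Section InnerProduct.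
Variables (R : realType) (m n : nat).
Implicit Types (x y z : 'M[R]_(m, n)) (a s : R).

Definition dot x y : R := \sum_i \sum_j x i j * y i j.

Lemma dotC x y : dot x y = dot y x.
Proof. by apply: eq_bigr => i _; apply: eq_bigr => j _; rewrite mulrC. Qed.

Lemma dotDl x y z : dot (x + y) z = dot x z + dot y z.
Proof.
rewrite -big_split; apply: eq_bigr => i _; rewrite -big_split.
by apply: eq_bigr => j _; rewrite mxE mulrDl.
Qed.

Lemma dotZl a x y : dot (a *: x) y = a * dot x y.
Proof.
rewrite mulr_sumr; apply: eq_bigr => i _; rewrite mulr_sumr.
by apply: eq_bigr => j _; rewrite mxE mulrA.
Qed.

Lemma dotNl x y : dot (- x) y = - dot x y.
Proof. by rewrite -scaleN1r dotZl mulN1r. Qed.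

Lemma dotDr x y z : dot x (y + z) = dot x y + dot x z.
Proof. by rewrite dotC dotDl !(dotC x). Qed.

Lemma dotZr a x y : dot x (a *: y) = a * dot x y.
Proof. by rewrite dotC dotZl dotC. Qed.

Lemma dotNr x y : dot x (- y) = - dot x y.
Proof. by rewrite dotC dotNl dotC. Qed.

Lemma dot0l x : dot 0 x = 0.
Proof. by rewrite -(scale0r 0) dotZl mul0r. Qed.

Definition dotE := (dotDl, dotDr, dotNl, dotNr, dotZl, dotZr).

Lemma dot_ge0 x : 0 <= dot x x.
Proof. by do 2![apply: sumr_ge0 => ? _]; rewrite -expr2 sqr_ge0. Qed.

Lemma dot_eq0 x : dot x x = 0 -> x = 0.
Proof.
move=> /eqP x0; apply/matrixP => i j; rewrite mxE; apply/eqP.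
have /allP x00 : all (fun i => \sum_j x i j * x i j == 0) (index_enum 'I_m).
  have := x0; rewrite /dot psumr_eq0//.
  by move=> k _; apply: sumr_ge0 => ? _; rewrite -expr2 sqr_ge0.
have := x00 i (mem_index_enum i); rewrite psumr_eq0; last first.
  by move=> k _; rewrite -expr2 sqr_ge0.
by move=> /allP/(_ j (mem_index_enum j)); rewrite mulf_eq0 orbb.
Qed.

Lemma norm2_sqr x : norm2 x ^+ 2 = dot x x.
Proof.
rewrite /norm2 sqr_sqrtr.
  by apply: eq_bigr => i _; apply: eq_bigr => j _; rewrite expr2.
by do 2![apply: sumr_ge0 => ? _]; rewrite sqr_ge0.
Qed.

Lemma dot_young s x y : 0 < s -> 2 * dot x y <= s * dot x x + s^-1 * dot y y.
Proof.
move=> s0; have := dot_ge0 (s *: x - y); rewrite !dotE (dotC y x) => H.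
rewrite -(ler_pM2l s0) -subr_ge0.
have -> : s * (s * dot x x + s^-1 * dot y y) = s * (s * dot x x) + dot y y.
  by field; rewrite gt_eqF.
lra.
Qed.

Lemma dot_sqD x y : dot (x + y) (x + y) <= 2 * dot x x + 2 * dot y y.
Proof. by have := dot_ge0 (x - y); rewrite !dotE (dotC y x); lra. Qed.

Lemma ler_entry_dot x i j : x i j ^+ 2 <= dot x x.
Proof.
rewrite /dot (bigD1 i)//= (bigD1 j)//= -addrA -expr2 lerDl addr_ge0//.
  by apply: sumr_ge0 => ? _; rewrite -expr2 sqr_ge0.
by do 2![apply: sumr_ge0 => ? _]; rewrite -expr2 sqr_ge0.
Qed.

End InnerProduct.

Lemma dot_rows (R : realType) (m n : nat) (x y : 'M[R]_(m, n)) :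
  dot x y = \sum_i dot (row i x) (row i y).
Proof.
apply: eq_bigr => i _; rewrite /dot big_ord1.
by apply: eq_bigr => j _; rewrite !mxE.
Qed.

(** * Smooth strongly convex functions and their sums *)

Section SmoothStronglyConvex.
Variables (R : realType) (d : nat) (f : 'rV[R]_d -> R).
Implicit Types x y v : 'rV[R]_d.

Lemma derive_grad x v : differentiable (f : 'rV[R]_d -> R^o) x ->
  'D_v (f : 'rV[R]_d -> R^o) x = dot (grad f x) v.
Proof.
move=> df; rewrite deriveE//.
rewrite {1}[v](row_sum_delta) linear_sum/= /dot big_ord1.
by apply: eq_bigr => j _; rewrite linearZ/= /grad mxE deriveE// mulrC.
Qed.

Lemma is_derive_line x v (s : R) :
  (forall z, differentiable (f : 'rV[R]_d -> R^o) z) ->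
  is_derive s 1 (fun s : R => f (x + s *: v) : R^o) (dot (grad f (x + s *: v)) v).
Proof.
move=> df; set g := fun s : R => _.
have E : (fun h : R => h^-1 *: ((g \o shift s) (h *: 1) - g s)) =
  (fun h : R => h^-1 *: ((f \o shift (x + s *: v)) (h *: v) - f (x + s *: v))).
  apply/funext => h; rewrite /g /=; congr (_ *: (f _ - _)).
  by rewrite -[h *: 1]/(h * 1) mulr1 scalerDl addrCA.
have Df : derivable (f : 'rV[R]_d -> R^o) (x + s *: v) v by exact: diff_derivable.
split; first by rewrite /derivable E.
by rewrite /derive E -derive_grad.
Qed.

(** Divide the convexity inequality on the segment from y to x by the weight s of x and let s tend
    to 0 from the right. *)
Lemma strongly_convex_grad mu x y : differentiable (f : 'rV[R]_d -> R^o) y ->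
  strongly_convex mu f ->
  f y + dot (grad f y) (x - y) + mu / 2 * dot (x - y) (x - y) <= f x.
Proof.
move=> df fcvx; set h := x - y.
have Df : derivable (f : 'rV[R]_d -> R^o) y h by exact: diff_derivable.
have key : forall s : R, 0 < s <= 1 ->
    s^-1 * (f (s *: h + y) - f y) <= f x - f y - mu / 2 * (1 - s) * dot h h.
  move=> s /andP[s0 s1]; rewrite ler_pdivrMl//.
  have := fcvx x y s; rewrite (ltW s0) s1 norm2_sqr => /(_ isT).
  have -> : s *: x + (1 - s) *: y = s *: h + y.
    by rewrite /h scalerBl scale1r scalerBr addrA addrAC.
  rewrite -/h; lra.
have cv : (fun s : R => s^-1 *: (f (s *: h + y) - f y)) @ 0^'+ -->
    dot (grad f y) h.
  rewrite -derive_grad//; apply: cvg_dnbhs_at_right.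
  exact: Df.
have cv2 : (fun s : R => f x - f y - mu / 2 * (1 - s) * dot h h) @ 0^'+ -->
    f x - f y - mu / 2 * (1 - 0) * dot h h.
  apply: cvg_at_right_filter; apply: cvgB; first exact: cvg_cst.
  apply: cvgMl; apply: cvgMr; apply: cvgB; first exact: cvg_cst.
  exact: cvg_id.
suff : dot (grad f y) h <= f x - f y - mu / 2 * (1 - 0) * dot h h by lra.
apply: (ler_cvg_to cv cv2); near=> s; apply: key; apply/andP; split; near: s.
  exact: nbhs_right_gt.
exact: nbhs_right_le.
Unshelve. all: by end_near. Qed.

(** The gap g between f and its quadratic model along the segment has a nonpositive derivative. *)
Lemma lipschitz_grad_descent L x y : 0 < L -> lipschitz_gradient L f ->
  f x <= f y + dot (grad f y) (x - y) + L / 2 * dot (x - y) (x - y).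
Proof.
move=> L0 [df lip]; set h := x - y.
have Lsq u v : dot (grad f u - grad f v) (grad f u - grad f v)
    <= L ^+ 2 * dot (u - v) (u - v).
  rewrite -!norm2_sqr -exprMn ler_sqr ?nnegrE ?lip// ?mulr_ge0 ?(ltW L0)//;
  by rewrite sqrtr_ge0.
pose g (s : R) : R^o := f (y + s *: h) - (s * dot (grad f y) h)
   - L / 2 * s ^+ 2 * dot h h.
have dg (s : R) : is_derive s 1 g
    (dot (grad f (y + s *: h)) h - dot (grad f y) h - L * s * dot h h).
  have := is_derive_line y h s df => d1.
  rewrite /g; apply: is_derive_eq.
  rewrite /GRing.scale/= -/(s *: h); set a := dot (grad f (y + _)) _.
  by set b := dot _ h; set c := dot h h; change (a - (s * 0 + b * 1) -
    (L / 2 * s ^+ 2 * 0 + c * (L / 2 * (s * 1 + s * 1))) =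
    a - b - L * s * c :> R); lra.
suff : g 1 <= g 0.
  rewrite /g scale1r scale0r addr0; have -> : y + h = x by rewrite addrC subrK.
  by set b := dot _ h; set c := dot h h; set u := f x; set v := f y; rewrite -[_ <= _]/(
    u - 1 * b - L / 2 * 1 ^+ 2 * c <= v - 0 * b - L / 2 * 0 ^+ 2 * c :> R); lra.
apply: (@ler0_derive1_nincr _ g 0 1) .
- move=> s _; exact: (@ex_derive _ _ _ _ _ _ _ (dg s)).
- move=> s; rewrite in_itv/= => /andP[s0 s1]; rewrite derive1E derive_val.
  have Ls : 0 < L * s by rewrite mulr_gt0.
  have iLs : 0 < (L * s)^-1 by rewrite invr_gt0.
  (* Young with weight 1 / (L s) stands in for Cauchy-Schwarz: both squares are then at most L s
     |h|^2. *)
  have := dot_young (grad f (y + s *: h) - grad f y) h iLs.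
  rewrite invrK dotDl dotNl.
  have := Lsq (y + s *: h) y.
  have -> : y + s *: h - y = s *: h by rewrite addrC addKr.
  rewrite dotZl dotZr => H.
  have : (L * s)^-1 * dot (grad f (y + s *: h) - grad f y)
    (grad f (y + s *: h) - grad f y) <= L * s * dot h h.
    rewrite ler_pdivrMl//; apply: le_trans H _.
    by rewrite le_eqVlt; apply/orP; left; apply/eqP; ring.
  lra.
- apply: continuous_subspaceT => s; apply: differentiable_continuous.
  by apply/derivable1_diffP; exact: (@ex_derive _ _ _ _ _ _ _ (dg s)).
- by [].
- exact: ler01.
- by [].
Qed.

End SmoothStronglyConvex.

Section SumOfFunctions.
Variables (R : realType) (N d : nat) (f : 'I_N -> 'rV[R]_d -> R) (mu L : R).
Hypotheses (mu0 : 0 < mu) (L0 : 0 < L).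
Hypothesis fcvx : forall i, strongly_convex mu (f i).
Hypothesis fsmooth : forall i, lipschitz_gradient L (f i).
Implicit Types x y : 'M[R]_(N, d).

Definition sumf x : R := \sum_i f i (row i x).
Definition gradF x : 'M[R]_(N, d) := \matrix_i grad (f i) (row i x).

Lemma sumf_strongly_convex x y :
  sumf y + dot (gradF y) (x - y) + mu / 2 * dot (x - y) (x - y) <= sumf x.
Proof.
rewrite /sumf !dot_rows mulr_sumr -!big_split/=; apply: ler_sum => i _.
rewrite rowK !linearB/=; apply: strongly_convex_grad => //.
exact: (fsmooth i).1.
Qed.

Lemma sumf_descent x y :
  sumf x <= sumf y + dot (gradF y) (x - y) + L / 2 * dot (x - y) (x - y).
Proof.
rewrite /sumf !dot_rows mulr_sumr -!big_split/=; apply: ler_sum => i _.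
by rewrite rowK !linearB/=; exact: lipschitz_grad_descent.
Qed.

Lemma gradF_lipschitz x y :
  dot (gradF x - gradF y) (gradF x - gradF y) <= L ^+ 2 * dot (x - y) (x - y).
Proof.
rewrite !dot_rows mulr_sumr; apply: ler_sum => i _.
rewrite !linearB/= !rowK -!norm2_sqr -exprMn.
by rewrite ler_sqr ?nnegrE ?(fsmooth i).2// ?mulr_ge0 ?(ltW L0)// sqrtr_ge0.
Qed.

Lemma sumf_stack (x : 'rV[R]_d) : sumf (stack N x) = \sum_i f i x.
Proof. by apply: eq_bigr => i _; rewrite rowK. Qed.

Variable xs : 'rV[R]_d.
Hypothesis xsmin : minimizer (average f) xs.
Hypothesis N0 : (0 < N)%N.

Lemma minimizer_sum (x : 'rV[R]_d) : \sum_i f i xs <= \sum_i f i x.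
Proof.
by have := xsmin x; rewrite /average ler_pM2l// invr_gt0 ltr0n.
Qed.

(** By the descent inequality, a step of length 1 / (N L) along - S lowers the sum by at least |S|^2
    / (2 N L). *)
Lemma minimizer_grad : \sum_i grad (f i) xs = 0.
Proof.
set S := \sum_i _; apply: dot_eq0; apply/eqP; rewrite eq_le dot_ge0 andbT.
set c := (N%:R * L)^-1.
have NL : 0 < N%:R * L by rewrite mulr_gt0// ltr0n.
have c0 : 0 < c by rewrite invr_gt0.
have := minimizer_sum (xs - c *: S).
rewrite -!sumf_stack => /le_trans/(_ (sumf_descent _ (stack N xs))).
have -> : stack N (xs - c *: S) - stack N xs = - c *: stack N S.
  by apply/matrixP => i j; rewrite !mxE; ring.
have -> : dot (gradF (stack N xs)) (- c *: stack N S) = - c * dot S S.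
  rewrite dotZr dot_rows; congr (_ * _); rewrite /S {2}/dot big_ord1.
  under eq_bigr => i _ do rewrite !rowK /dot big_ord1.
  rewrite exchange_big/=; apply: eq_bigr => j _.
  by rewrite summxE mulr_suml.
rewrite dotZl dotZr [dot (stack _ _) _]dot_rows.
have -> : \sum_(i < N) dot (row i (stack N S)) (row i (stack N S)) = N%:R * dot S S.
  under eq_bigr => i _ do rewrite !rowK.
  by rewrite sumr_const card_ord mulr_natl.
have -> : L / 2 * (- c * (- c * (N%:R * dot S S))) = c / 2 * dot S S.
  have := divff (lt0r_neq0 NL); rewrite -/c => E.
  transitivity ((N%:R * L * c) * c / 2 * dot S S); first by ring.
  by rewrite /c E mul1r.
move=> H; rewrite leNgt; apply/negP => S0.
have : 0 < c / 2 * dot S S by rewrite !mulr_gt0.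
lra.
Qed.

(** Compare f_i at x with its value after a gradient step of length 1 / L, which is still at least
    the infimum. *)
Lemma strongly_convex_grad_inf i (x : 'rV[R]_d) :
  dot (grad (f i) x) (grad (f i) x) <= 2 * L * (f i x - inf (range (f i))).
Proof.
(* [inf] is a lower bound only of a set that is bounded below; strong convexity at 0 provides the
   bound. *)
have lb : has_lbound (range (f i)).
  exists (f i 0 - mu^-1 / 2 * dot (grad (f i) 0) (grad (f i) 0)) => _ [z _ <-].
  have := strongly_convex_grad z ((fsmooth i).1 0) (fcvx i).
  rewrite subr0.
  have imu0 : 0 < mu^-1 by rewrite invr_gt0.
  have := dot_young (- grad (f i) 0) z imu0; rewrite invrK !dotE.
  by set A := dot _ z; set B := dot z z; set D := dot _ _; lra.
have L1 : 0 < L^-1 by rewrite invr_gt0.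
have : inf (range (f i)) <= f i (x - L^-1 *: grad (f i) x).
  by apply: ge_inf => //; exists (x - L^-1 *: grad (f i) x).
move=> /le_trans/(_ (lipschitz_grad_descent _ x L0 (fsmooth i))).
have -> : x - L^-1 *: grad (f i) x - x = - (L^-1 *: grad (f i) x).
  by rewrite addrAC subrr add0r.
rewrite !dotE; set D := dot _ _; set I := inf _.
have -> : L / 2 * - - (L^-1 * (L^-1 * D)) = L^-1 / 2 * D.
  by field; rewrite gt_eqF.
move=> H; rewrite -(ler_pM2l L1).
have -> : L^-1 * (2 * L * (f i x - I)) = 2 * (f i x - I).
  by field; rewrite gt_eqF.
lra.
Qed.

(** Each squared gradient is at most 2 L times the excess of f_i, the total excess at the minimizer
    is at most that at 0, and the last factor of [C1] is at least 1. *)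
Lemma gradF_minimizer_C1 :
  dot (gradF (stack N xs)) (gradF (stack N xs)) <= C1 mu L f ^+ 2.
Proof.
have S0 : 0 <= 2 * L * \sum_i (f i 0 - inf (range (f i))).
  rewrite mulr_sumr; apply: sumr_ge0 => i _.
  exact: le_trans (dot_ge0 _) (strongly_convex_grad_inf i 0).
rewrite /C1 exprMn sqr_sqrtr//.
apply: (@le_trans _ _ (2 * L * \sum_i (f i 0 - inf (range (f i))))).
  rewrite dot_rows; apply: (@le_trans _ _ (2 * L * \sum_i (f i xs - inf (range (f i))))).
    rewrite mulr_sumr; apply: ler_sum => i _; rewrite !rowK.
    exact: strongly_convex_grad_inf.
  rewrite ler_pM2l ?mulr_gt0// !big_split/= lerD2r; exact: minimizer_sum.
rewrite ler_peMr// expr_ge1// ?lerDl ?ler_wpDr//.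
- by rewrite divr_ge0 ?mulr_ge0 ?addr_ge0 ?ltW.
- by rewrite divr_ge0 ?mulr_ge0 ?addr_ge0 ?ltW.
Qed.

End SumOfFunctions.

(** An accelerated step for curvature mu and smoothness 1 / alpha, where alpha = q^2 / mu. It speaks
    only of values and model inequalities, so it serves both the averaged and the penalized
    dynamics; s may be any reference point. The error eta enters through its square and through its
    product with a, and a does not contain eta, so the product can be centered. *)
Lemma nesterov_step (R : realType) (m n : nat) (mu q : R)
    (x z s G eta : 'M[R]_(m, n)) (Fx Fy Fs Fx' : R) :
  0 < mu -> 0 < q < 1 ->
  let y := (1 + q)^-1 *: (x + q *: z) in
  let x' := y - (q ^+ 2 / mu) *: (G + eta) in
  let z' := x + q^-1 *: (x' - x) in
  let a := (q ^+ 2 / mu) *: G - q *: ((1 - q) *: (z - s) + q *: (y - s)) in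
  Fy + dot G (x - y) <= Fx ->
  Fy + dot G (s - y) + mu / 2 * dot (s - y) (s - y) <= Fs ->
  Fx' <= Fy + dot G (x' - y) + mu / (2 * q ^+ 2) * dot (x' - y) (x' - y) ->
  Fx' - Fs + mu / 2 * dot (z' - s) (z' - s) <=
    (1 - q) * (Fx - Fs + mu / 2 * dot (z - s) (z - s))
    + q ^+ 2 / mu * dot eta eta + dot eta a.
Proof.
move=> mu0 /andP[q0 q1] y x' z' a hx hs hx'.
have q1' : 1 + q != 0 by lra.
have qn : q != 0 by lra.
have mun : mu != 0 by lra.
(* With e = z - y and u = y - s one has x = y - q e, and everything becomes polynomial in the inner
   products of e, u, G and eta. *)
pose e := z - y; pose g := G + eta.
have Ex : x = y - q *: e.
  apply/matrixP => i j; rewrite !mxE; field; done.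
have Ez' : z' - s = (1 - q) *: e + (y - s) - (q / mu) *: g.
  by rewrite /z' /x'; apply/matrixP => i j; rewrite !mxE; field; do ?[apply/andP; split].
have Ez : z - s = e + (y - s) by rewrite /e addrA subrK.
have Ea : a = (q ^+ 2 / mu) *: G - q *: ((1 - q) *: e + (y - s)).
  by rewrite /a Ez; apply/matrixP => i j; rewrite !mxE; ring.
have Ex' : x' - y = - (q ^+ 2 / mu) *: g by rewrite /x' addrC addKr scaleNr.
have Exy : x - y = - (q *: e) by rewrite {1}Ex addrC addKr.
have Esy : s - y = - (y - s) by rewrite opprB.
move: hx hs hx'; rewrite Ez' Ez Ea Ex' Exy Esy /g.
set u := y - s.
clear Ex Ez' Ez Ea Ex' Exy Esy; clearbody e u; clear g a z' x' y.
move: (dot_ge0 e); rewrite !dotE (dotC u e) (dotC e eta) (dotC e G).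
rewrite (dotC u G) (dotC u eta) (dotC G eta).
set ee := dot e e; set eu := dot e u; set uu := dot u u; set Ge := dot G e.
set Gu := dot G u; set GG := dot G G; set ne := dot eta e; set nu := dot eta u.
set nn := dot eta eta; set nG := dot eta G => ee0 hx hs hx'.
(* Model at x with weight 1 - q, model at s with weight q, descent with weight 1, and a multiple of
   |e|^2 as slack: their sum is exactly the claim. *)
have H1 : 0 <= (1 - q) * (Fx - (Fy - q * Ge)) by rewrite mulr_ge0 ?subr_ge0 // ltW.
have H2 : 0 <= q * (Fs - (Fy - Gu + mu / 2 * uu)).
  by apply: mulr_ge0; [exact: ltW|rewrite subr_ge0; move: hs; rewrite opprK].
have H4 : 0 <= mu / 2 * q * (1 - q) * ee.
  by rewrite !mulr_ge0 ?subr_ge0 // ?ltW // divr_gt0.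
move: hx'; rewrite -subr_ge0 => H3; rewrite -subr_ge0.
have := addr_ge0 (addr_ge0 H1 H2) (addr_ge0 H3 H4).
move=> H; apply: le_trans H _; rewrite le_eqVlt; apply/orP; left; apply/eqP.
by field; rewrite qn mun.
Qed.

(** * Averages, deviations and the spectrum of W *)

Section Averaging.
Variables (R : realType) (N : nat) (W : 'M[R]_N).
Hypotheses (N0 : (0 < N)%N) (Wsym : W^T = W).
Hypothesis Wrow : forall i, \sum_(j < N) W i j = 1.

Lemma dot_mulmx (m n p : nat) (A : 'M[R]_(m, n)) (x : 'M[R]_(n, p)) (y : 'M[R]_(m, p)) :
  dot (A *m x) y = dot x (A^T *m y).
Proof.
have H (a b : 'M[R]_(m, p)) : dot a b = \tr (a *m b^T).
  by apply: eq_bigr => i _; rewrite mxE; apply: eq_bigr => j _; rewrite mxE.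
have H' (a b : 'M[R]_(n, p)) : dot a b = \tr (a *m b^T).
  by apply: eq_bigr => i _; rewrite mxE; apply: eq_bigr => j _; rewrite mxE.
by rewrite H H' trmx_mul trmxK mulmxA -mulmxA mxtrace_mulC -!mulmxA.
Qed.

Lemma dot_sym d (x y : 'M[R]_(N, d)) : dot (W *m x) y = dot x (W *m y).
Proof. by rewrite dot_mulmx Wsym. Qed.

Definition avg : 'M[R]_N := const_mx N%:R^-1.

Let Nn : N%:R != 0 :> R. Proof. by rewrite pnatr_eq0 -lt0n. Qed.

Lemma tr_avg : avg^T = avg.
Proof. by rewrite /avg trmx_const. Qed.

Lemma dot_avg d (x y : 'M[R]_(N, d)) : dot (avg *m x) y = dot x (avg *m y).
Proof. by rewrite dot_mulmx tr_avg. Qed.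

Lemma avg_stack d (x : 'rV[R]_d) : avg *m stack N x = stack N x.
Proof.
apply/matrixP => i j; rewrite !mxE.
under eq_bigr => k _ do rewrite !mxE.
by rewrite sumr_const card_ord -[LHS]mulr_natl mulrA divff// mul1r.
Qed.

Lemma avg_mulmxE d (x : 'M[R]_(N, d)) :
  avg *m x = stack N (\row_j (N%:R^-1 * \sum_i x i j)).
Proof.
apply/matrixP => i j; rewrite !mxE mulr_sumr.
by apply: eq_bigr => k _; rewrite !mxE.
Qed.

Lemma avg_idem : avg *m avg = avg.
Proof.
apply/matrixP => i j; rewrite !mxE.
under eq_bigr => k _ do rewrite !mxE.
by rewrite sumr_const card_ord -[LHS]mulr_natl mulrA divff// mul1r.
Qed.

Lemma mix_avg : W *m avg = avg.
Proof.
apply/matrixP => i j; rewrite !mxE.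
under eq_bigr => k _ do rewrite !mxE.
by rewrite -mulr_suml Wrow mul1r.
Qed.

Lemma avg_mix : avg *m W = avg.
Proof. by apply: trmx_inj; rewrite trmx_mul Wsym tr_avg mix_avg. Qed.

Lemma mix_stack d (x : 'rV[R]_d) : W *m stack N x = stack N x.
Proof. by rewrite -avg_stack mulmxA mix_avg. Qed.

Definition dev d (x : 'M[R]_(N, d)) := x - avg *m x.

Lemma dotT_dev d (x : 'M[R]_(N, d)) :
  dot x x = dot (avg *m x) (avg *m x) + dot (dev x) (dev x).
Proof.
have E : dot x (avg *m x) = dot (avg *m x) (avg *m x).
  by rewrite [RHS]dot_avg mulmxA avg_idem.
rewrite /dev !dotE (dotC (avg *m x) x) E; ring.
Qed.

Lemma avg_dev d (x : 'M[R]_(N, d)) : avg *m dev x = 0.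
Proof. by rewrite /dev mulmxBr mulmxA avg_idem subrr. Qed.

Lemma dev_mix d (x : 'M[R]_(N, d)) : dev (W *m x) = W *m dev x.
Proof. by rewrite /dev mulmxBr !mulmxA mix_avg avg_mix. Qed.

Lemma devD d (x y : 'M[R]_(N, d)) : dev (x + y) = dev x + dev y.
Proof. by rewrite /dev mulmxDr opprD addrACA. Qed.

Lemma devZ d a (x : 'M[R]_(N, d)) : dev (a *: x) = a *: dev x.
Proof. by rewrite /dev -scalemxAr scalerBr. Qed.

Lemma dev_le d (x : 'M[R]_(N, d)) : dot (dev x) (dev x) <= dot x x.
Proof. by rewrite (dotT_dev x) lerDr dot_ge0. Qed.

Lemma avg_le d (x : 'M[R]_(N, d)) : dot (avg *m x) (avg *m x) <= dot x x.
Proof. by rewrite (dotT_dev x) lerDl dot_ge0. Qed.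

(** The Dirichlet form of the weighted graph, that is, the quadratic form of the Laplacian I - W. *)
Definition dirichlet d (x : 'M[R]_(N, d)) := dot x x - dot x (W *m x).

Lemma dirichletE d (x : 'M[R]_(N, d)) :
  2 * dirichlet x = \sum_i \sum_j W i j * \sum_k (x i k - x j k) ^+ 2.
Proof.
have Wcol j : \sum_i W i j = 1.
  by rewrite -(Wrow j); apply: eq_bigr => i _; rewrite -[in RHS]Wsym mxE.
have E1 : \sum_i \sum_j W i j * \sum_k x i k ^+ 2 = dot x x.
  rewrite /dot; apply: eq_bigr => i _; rewrite -mulr_suml Wrow mul1r.
  by apply: eq_bigr => k _; rewrite expr2.
have E2 : \sum_i \sum_j W i j * \sum_k x j k ^+ 2 = dot x x.
  rewrite exchange_big /dot; apply: eq_bigr => j _/=.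
  rewrite -mulr_suml Wcol mul1r.
  by apply: eq_bigr => k _; rewrite expr2.
have E3 : \sum_i \sum_j W i j * \sum_k x i k * x j k = dot x (W *m x).
  rewrite /dot; apply: eq_bigr => i _.
  under eq_bigr => j _ do rewrite mulr_sumr.
  rewrite exchange_big/=; apply: eq_bigr => k _.
  by rewrite mxE mulr_sumr; apply: eq_bigr => j _; ring.
rewrite /dirichlet -E3 mulrBr mulr_natl mulr2n -{1}E1 -E2.
rewrite mulr_sumr -big_split/= -sumrB; apply: eq_bigr => i _.
rewrite mulr_sumr -big_split/= -sumrB; apply: eq_bigr => j _.
rewrite !mulr_sumr -big_split/= -sumrB; apply: eq_bigr => k _; ring.
Qed.

(** Centered columns kill the cross terms. Together with [dirichletE] this reduces the spectral gap
    to comparing arbitrary pairs with edges. *)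
Lemma dot_pairs d (x : 'M[R]_(N, d)) : avg *m x = 0 ->
  \sum_i \sum_j \sum_k (x i k - x j k) ^+ 2 = 2 * N%:R * dot x x.
Proof.
move=> x0.
have S0 k : \sum_i x i k = 0.
  have i0 : 'I_N by exact: Ordinal N0.
  have := congr1 (fun M : 'M[R]_(N, d) => M i0 k) x0.
  rewrite avg_mulmxE !mxE => /eqP; rewrite mulf_eq0 invr_eq0 (negPf Nn)/=.
  by move=> /eqP.
have E (i : 'I_N) : \sum_j \sum_k (x i k - x j k) ^+ 2 =
    N%:R * (\sum_k x i k ^+ 2) + dot x x.
  transitivity (\sum_(j < N) (\sum_k x i k ^+ 2) + dot x x
     - 2 * \sum_k x i k * \sum_j x j k); last first.
    under [X in _ - 2 * X]eq_bigr => k _ do rewrite S0 mulr0.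
    by rewrite [X in _ - 2 * X]big1// mulr0 subr0 sumr_const card_ord mulr_natl.
  have -> : \sum_k x i k * \sum_j x j k = \sum_j \sum_k x i k * x j k.
    by rewrite exchange_big/=; apply: eq_bigr => k _; rewrite mulr_sumr.
  rewrite /dot mulr_sumr -big_split/= -sumrB; apply: eq_bigr => j _.
  rewrite mulr_sumr -big_split/= -sumrB; apply: eq_bigr => k _; ring.
under eq_bigr => i _ do rewrite E.
rewrite big_split/= -mulr_sumr sumr_const card_ord -mulr_natl.
have -> : \sum_i \sum_k x i k ^+ 2 = dot x x.
  by apply: eq_bigr => i _; apply: eq_bigr => k _; rewrite expr2.
ring.
Qed.

End Averaging.

(** * Spectral gap of a connected network *)

Section SpectralGap.
Variables (R : realType) (N : nat) (E : rel 'I_N) (W : 'M[R]_N) (d : nat).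
Hypotheses (N0 : (0 < N)%N) (hE : connected_graph E) (hW : mixing_matrix E W).
Let Wsym := mixing_sym hW.
Let Wrow := mixing_row hW.

Lemma mixing_ge0 i j : 0 <= W i j.
Proof.
have [<-|ij] := eqVneq i j; first exact/ltW/(mixing_diag hW).
case Eij: (E i j); first exact/ltW/(mixing_edge hW).
by rewrite (mixing_nonedge hW)// Eij.
Qed.

Lemma dirichlet_ge0 (x : 'M[R]_(N, d)) : 0 <= dirichlet W x.
Proof.
rewrite -(@pmulr_rge0 _ 2)// dirichletE//; do 2![apply: sumr_ge0 => ? _].
by rewrite mulr_ge0 ?mixing_ge0// sumr_ge0// => k _; rewrite sqr_ge0.
Qed.

(** Induction along a walk from i to j: an edge bounds its squared difference by 2 / W_ij times the
    form, and (a + b)^2 <= 2 a^2 + 2 b^2 joins it to the rest of the walk. *)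
Lemma dirichlet_connect i j : exists2 c, 0 <= c &
  forall x : 'M[R]_(N, d), \sum_k (x i k - x j k) ^+ 2 <= c * dirichlet W x.
Proof.
have [_ _ /(_ i j)/connectP[p + ->]] := hE.
elim: p i {j} => [|j p IH] i /=.
  move=> _; exists 0 => // x; rewrite mul0r big1// => k _.
  by rewrite subrr expr0n.
move=> /andP[Eij /IH[c c0 hc]]; exists (2 * (2 / W i j) + 2 * c).
  by rewrite addr_ge0 ?mulr_ge0 ?invr_ge0 ?mixing_ge0.
move=> x; apply: (@le_trans _ _ (2 * \sum_k (x i k - x j k) ^+ 2 +
    2 * \sum_k (x j k - x (last j p) k) ^+ 2)).
  rewrite !mulr_sumr -big_split/=; apply: ler_sum => k _.
  have := sqr_ge0 ((x i k - x j k) - (x j k - x (last j p) k)); lra.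
rewrite [leRHS]mulrDl; apply: lerD; last by rewrite -mulrA ler_pM2l//; exact: hc.
rewrite -mulrA ler_pM2l//.
have ij : i != j.
  by apply/negP => /eqP ij; have [_ /(_ i)] := hE; rewrite {2}ij Eij.
have Wij := mixing_edge hW ij Eij.
rewrite mulrAC ler_pdivlMr// dirichletE// mulrC.
rewrite (bigD1 i)//= (bigD1 j)//= -addrA lerDl addr_ge0//.
  by apply: sumr_ge0 => ? _; rewrite mulr_ge0 ?mixing_ge0// sumr_ge0// => k _; rewrite sqr_ge0.
by do 2![apply: sumr_ge0 => ? _]; rewrite mulr_ge0 ?mixing_ge0// sumr_ge0// => k _; rewrite sqr_ge0.
Qed.

(** A Poincare inequality: adding the walk bounds over all pairs gives |x|^2 <= C times the
    Dirichlet form for centered x. The resulting [th] takes the place of the second eigenvalue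
    without any eigenvector. *)
Lemma spectral_gap : exists2 th, 0 <= th < 1 &
  forall x : 'M[R]_(N, d), avg R N *m x = 0 -> dot x (W *m x) <= th * dot x x.
Proof.
have /fin_all_exists[c hc] : forall p : 'I_N * 'I_N, exists c, 0 <= c /\
  forall x : 'M[R]_(N, d), \sum_k (x p.1 k - x p.2 k) ^+ 2 <= c * dirichlet W x.
  by move=> [i j]; have [c ? ?] := dirichlet_connect i j; exists c.
(* The summand 1 makes 1 - 1 / C nonnegative. *)
pose C := 1 + \sum_i \sum_j c (i, j).
have C1 : 1 <= C by rewrite lerDl; do 2![apply: sumr_ge0 => ? _]; exact: (hc _).1.
have C0 : 0 < C by rewrite (lt_le_trans _ C1).
exists (1 - C^-1); first by rewrite subr_ge0 invf_le1// C1 ltrBlDr ltrDl invr_gt0.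
move=> x x0.
suff : dot x x <= C * dirichlet W x.
  rewrite -ler_pdivrMl// /dirichlet mulrBl mul1r; lra.
have N1 : 1 <= N%:R :> R by rewrite ler1n.
apply: (@le_trans _ _ (2 * N%:R * dot x x)).
  by rewrite ler_peMl ?dot_ge0//; lra.
rewrite -dot_pairs//; apply: (@le_trans _ _ ((\sum_i \sum_j c (i, j)) * dirichlet W x)).
  rewrite mulr_suml; apply: ler_sum => i _; rewrite mulr_suml.
  by apply: ler_sum => j _; exact: (hc (i, j)).2.
by rewrite ler_wpM2r ?dirichlet_ge0// lerDr.
Qed.

End SpectralGap.

(** * Eigenvalues of W by unitary diagonalization over the complex numbers *)

Section Spectrum.
Import complex.
Variables (R : realType) (N : nat) (W : 'M[R]_N) (lam : seq R).
Hypothesis Wsym : W^T = W.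
Hypothesis hlam : eigenvalues W lam.

Let C : numClosedFieldType := R[i]%C.
Let phi : {rmorphism R -> C} := real_complex R.
Let A : 'M[C]_N := map_mx phi W.
Let P : 'M[C]_N := spectralmx A.
Let D : 'rV[C]_N := spectral_diag A.

Let A_herm : A \is hermsymmx.
Proof.
apply: realsym_hermsym.
  by rewrite is_hermitianmxE expr0 scale1r map_mx_id// /A map_trmx Wsym.
by apply/mxOverP => i j; rewrite mxE complex_real.
Qed.

Let PA : P *m A = diag_mx D *m P.
Proof.
rewrite {1}(orthomx_spectralP (hermitian_normalmx A_herm)).
by rewrite !mulmxA mulmxV ?mul1mx// spectral_unit.
Qed.

Let Punitary : P \is unitarymx. Proof. exact: spectral_unitarymx. Qed.

(** W and its diagonal form are similar, so they share the characteristic polynomial, whose linear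
    factors are unique up to order. *)
Let spectrum : perm_eq [seq D 0 i | i <- enum 'I_N] [seq phi a | a <- lam].
Proof.
apply: prod_XsubC_eq; rewrite (big_map (D 0)) (big_map phi).
transitivity (char_poly A); last first.
  rewrite -map_char_poly hlam.1 rmorph_prod/=.
  by apply: eq_bigr => a _; rewrite rmorphB/= map_polyX map_polyC.
transitivity (char_poly (diag_mx D)).
  rewrite char_poly_trig ?diag_mx_is_trig// big_enum/=.
  by apply: eq_bigr => i _; rewrite mxE eqxx.
have detP : \det (map_mx polyC P) != 0.
  rewrite det_map_mx polyC_eq0 -unitfE -unitmxE; exact: spectral_unit.
apply: (mulfI detP); rewrite /char_poly mulrC -!det_mulmx; congr (\det _).
rewrite /char_poly_mx mulmxBl mulmxBr -!map_mxM PA.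
by rewrite scalar_mxC.
Qed.

Lemma size_eigenvalues : size lam = N.
Proof. by rewrite -(size_map phi) -(perm_size spectrum) size_map size_enum_ord. Qed.

Lemma eigenvalues_nonincreasing i j : (i <= j < N)%N -> lam`_j <= lam`_i.
Proof.
move=> /andP[ij jN]; have := @sorted_leq_nth _ >=%R _ _ 0 lam hlam.2 i j.
apply=> //; rewrite ?inE ?size_eigenvalues//; last exact: leq_ltn_trans jN.
by move=> x y z /= xy yz; exact: le_trans xy.
by move=> x; exact: lexx.
Qed.

Lemma last_eigenvalue_le a : a \in lam -> lam`_N.-1 <= a.
Proof.
move=> alam; have := alam; rewrite -index_mem size_eigenvalues => iN.
rewrite -[leRHS](nth_index 0 alam); apply: eigenvalues_nonincreasing.
by case: N iN => // n; rewrite ltnS => ->/=.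
Qed.

(** In the coordinates Y = P x the form is the sum of D_i |Y_ik|^2, and every D_i is one of the
    listed eigenvalues. *)
Lemma dot_mix_ge d (x : 'M[R]_(N, d)) :
  lam`_N.-1 * dot x x <= dot x (W *m x).
Proof.
pose X : 'M[C]_(N, d) := map_mx phi x; pose Y := P *m X.
have PP : (P ^t* *m P = 1%:M)%sesqui.
  by rewrite -invmx_unitary// mulVmx// spectral_unit.
have E (B : 'M[R]_N) (F : 'rV[C]_N) : P *m map_mx phi B = diag_mx F *m P ->
    phi (dot x (B *m x)) = \sum_i \sum_k F 0 i * `|Y i k| ^+ 2.
  move=> PB; transitivity (\tr (Y ^t* *m (diag_mx F *m Y))%sesqui).
    have -> : (Y ^t* = X^T *m P ^t*)%sesqui.
      rewrite /Y trmx_mul map_mxM; congr (_ *m _).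
      apply/matrixP => i j; rewrite !mxE; exact: conjc_real.
    rewrite mulmxA /Y mulmxA -(mulmxA _ (diag_mx F)) -PB -!mulmxA.
    rewrite (mulmxA _ P) PP mul1mx mxtrace_mulC /mxtrace rmorph_sum/=.
    apply: eq_bigr => i _; rewrite !mxE rmorph_sum/=; apply: eq_bigr => k _.
    by rewrite mulrC rmorphM/= -map_mxM !mxE.
  rewrite /mxtrace; under eq_bigr => k _ do rewrite mxE.
  rewrite exchange_big/=; apply: eq_bigr => i _; apply: eq_bigr => k _.
  by rewrite mul_diag_mx !mxE mulrCA normCKC.
have -> : dot x x = dot x (1%:M *m x) by rewrite mul1mx.
rewrite -lecR rmorphM/= (E _ D PA) (E _ (const_mx 1)); last first.
  by rewrite diag_const_mx map_mx1 mulmx1 mul1mx.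
rewrite mulr_sumr; apply: ler_sum => i _; rewrite mulr_sumr; apply: ler_sum => k _.
rewrite mxE mul1r ler_wpM2r ?exprn_ge0//.
have : D 0 i \in [seq phi a | a <- lam].
  by rewrite -(perm_mem spectrum) map_f// mem_enum.
by move=> /mapP[a alam ->]; rewrite lecR last_eigenvalue_le.
Qed.

Variables (E : rel 'I_N).
Hypotheses (hE : connected_graph E) (hW : mixing_matrix E W) (N1 : (1 < N)%N).

(** The Dirichlet form of an eigenvector v is (1 - a) |v|^2, and it is nonnegative. *)
Lemma eigenvalue_le1 a : a \in lam -> a <= 1.
Proof.
move=> alam; have /eigenvalueP[v /(congr1 trmx)] : eigenvalue W a.
  by rewrite eigenvalue_root_char hlam.1 root_prod_XsubC.
rewrite trmx_mul Wsym linearZ/= => va v0.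
have : 0 < dot v^T v^T.
  rewrite lt_neqAle dot_ge0 andbT eq_sym; apply: contraNneq v0 => /dot_eq0/eqP.
  by rewrite trmx_eq0.
have := dirichlet_ge0 hW v^T; rewrite /dirichlet va dotZr => H v1.
rewrite -subr_ge0 -(pmulr_lge0 _ v1) mulrBl; lra.
Qed.

(** A fixed vector has Dirichlet form 0, so [dirichlet_connect] makes all its entries equal. *)
Lemma mix_fixed_const (v : 'rV[R]_N) : v *m W = v -> (v <= (const_mx 1 : 'rV_N))%MS.
Proof.
move=> vW; pose i0 := Ordinal (ltnW N1).
suff -> : v = v 0 i0 *: const_mx 1 by rewrite scalemx_sub.
have Wv : W *m v^T = v^T by rewrite -{1}Wsym -trmx_mul vW.
apply/rowP => i; rewrite !mxE mulr1; apply/eqP; rewrite -subr_eq0.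
have [c _ /(_ v^T)] := dirichlet_connect 1 hE hW i i0.
rewrite /dirichlet Wv subrr mulr0 big_ord1 !mxE => H.
by rewrite -sqrf_eq0 eq_le H sqr_ge0.
Qed.

(** Inverses of 0 are 0, so with gamma = 1 the factor (1 - gamma)^(-2) would erase the C_1 term of
    the claim. If the second eigenvalue were 1, two rows of the invertible matrix P would be
    multiples of the constant vector. *)
Lemma gamma_neq1 : 0 < lam`_N.-1 -> gamma N lam != 1.
Proof.
move=> lamN; have N0 := ltnW N1.
have lt_nth i : (i < N)%N -> lam`_i \in lam.
  by move=> ?; rewrite mem_nth// size_eigenvalues.
have l10 : lam`_1 <= lam`_0 by rewrite eigenvalues_nonincreasing.
have lN1 : lam`_N.-1 <= lam`_1.
  by rewrite eigenvalues_nonincreasing//; case: N N1 => [|[|n]]//= _; rewrite ltnSn.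
rewrite /gamma !ger0_norm ?(ltW lamN)//; last exact: le_trans (ltW lamN) _.
rewrite max_l//; apply/negP => /eqP l1.
have l0 : lam`_0 = 1.
  by apply/eqP; rewrite eq_le eigenvalue_le1 ?lt_nth//= -l1.
have /card_gt1P[i [j [Di Dj ij]]] : (1 < #|[pred i | D 0%R i == 1%R]|)%N.
  have -> : #|[pred i | D 0 i == 1]| = count_mem (phi 1) [seq D 0 i | i <- enum 'I_N].
    rewrite -sum1_card -sum1_count (big_map (D 0)) big_enum_cond/=.
    by apply: eq_bigl => k; rewrite inE rmorph1.
  rewrite (permP spectrum) count_map.
  have := N1; rewrite -size_eigenvalues.
  by case: (lam) l0 l1 => [|a [|b s]]//= -> -> _; rewrite rmorph1 !eqxx.
have fixed k : D 0 k == 1 -> exists c, row k P = c *: const_mx 1.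
  move=> /eqP Dk; apply/sub_rVP.
  have : row k P *m A = row k P.
    by rewrite -row_mul PA row_mul row_diag_mx -scalemxAl -rowE Dk scale1r.
  move=> /eqP; rewrite -{2}[row k P]mulmx1 -subr_eq0 -mulmxBr => /eqP/sub_kermxP.
  have -> : A - 1%:M = map_mx phi (W - 1%:M) by rewrite map_mxB map_mx1.
  (* W is real, so its complex fixed space is spanned by the real one. *)
  rewrite -map_kermx => /submx_trans; apply.
  have -> : const_mx 1 = map_mx phi (const_mx 1 : 'rV[R]_N).
    by rewrite map_const_mx rmorph1.
  rewrite map_submx; apply/row_subP => l; apply: mix_fixed_const.
  have /eqP : row l (kermx (W - 1%:M)) *m (W - 1%:M) = 0.
    by rewrite -row_mul mulmx_ker row0.
  by rewrite mulmxBr mulmx1 subr_eq0 => /eqP.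
have [c ic] := fixed _ Di; have [e je] := fixed _ Dj.
have inj (v : 'rV[C]_N) : v *m P = 0 -> v = 0.
  by move=> vP; rewrite -[v](mulmxK (spectral_unit A)) vP mul0mx.
(* Rows i and j of P are c and e times the same vector, so this combination is sent to 0 by P. *)
have H : e *: delta_mx 0 i - c *: delta_mx 0 j = 0 :> 'rV[C]_N.
  by apply: inj; rewrite mulmxBl -!scalemxAl -!rowE ic je !scalerA mulrC subrr.
have := congr1 (fun v : 'rV[C]_N => v 0 i) H.
rewrite !mxE !eqxx (negPf ij) mulr0 subr0 mulr1 => e0.
have K : delta_mx 0 j = 0 :> 'rV[C]_N.
  by apply: inj; rewrite -rowE je e0 scale0r.
have /eqP := congr1 (fun v : 'rV[C]_N => v 0 j) K.
by rewrite !mxE !eqxx oner_eq0.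
Qed.

End Spectrum.

(** * Lyapunov functions of one iteration *)

Section ConsensusError.
Variables (R : realType) (N d : nat) (W : 'M[R]_N).
Hypotheses (N0 : (0 < N)%N) (Wsym : W^T = W).
Hypothesis Wrow : forall i, \sum_(j < N) W i j = 1.
Hypothesis Wpsd : forall x : 'M[R]_(N, d), 0 <= dot x (W *m x).
Hypothesis Wdir : forall x : 'M[R]_(N, d), 0 <= dirichlet W x.
Variables (th : R).
Hypothesis th01 : 0 <= th < 1.
Hypothesis Wgap : forall x : 'M[R]_(N, d),
  avg R N *m x = 0 -> dot x (W *m x) <= th * dot x x.
Implicit Types (u v w c r : 'M[R]_(N, d)).

Lemma dirichletD u v :
  dirichlet W (u + v) = dirichlet W u + dirichlet W v + 2 * (dot u v - dot u (W *m v)).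
Proof.
rewrite /dirichlet mulmxDr !dotE (dotC v u) (dotC v (W *m u)) dot_sym//; ring.
Qed.

Lemma dirichletZ a u : dirichlet W (a *: u) = a ^+ 2 * dirichlet W u.
Proof. rewrite /dirichlet -scalemxAr !dotE; ring. Qed.

Lemma dirichlet_young s u v : 0 < s ->
  dirichlet W (u + v) <= (1 + s) * dirichlet W u + (1 + s^-1) * dirichlet W v.
Proof.
move=> s0; have := Wdir (s *: u + (-1) *: v).
rewrite (dirichletD (s *: u)) (dirichletZ s) dirichletZ -!scalemxAr !dotE => H.
have : 0 <= s^-1 * (s ^+ 2 * dirichlet W u + dirichlet W v
   - 2 * s * (dot u v - dot u (W *m v))).
  by apply: mulr_ge0; [rewrite invr_ge0 ltW|lra].
have -> : s^-1 * (s ^+ 2 * dirichlet W u + dirichlet W v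
   - 2 * s * (dot u v - dot u (W *m v))) =
  s * dirichlet W u + s^-1 * dirichlet W v - 2 * (dot u v - dot u (W *m v)).
  by field; rewrite gt_eqF.
rewrite dirichletD; lra.
Qed.

Lemma dot_young_sq s u v : 0 < s ->
  dot (u + v) (u + v) <= (1 + s) * dot u u + (1 + s^-1) * dot v v.
Proof. by move=> s0; have := dot_young u v s0; rewrite !dotE (dotC v u); lra. Qed.

(* [W *m w] is a gradient step of unit length from w on the quadratic
   [dirichlet W / 2]. *)
Lemma dirichlet_prox w c : avg R N *m w = 0 -> avg R N *m c = 0 ->
  dirichlet W (W *m w) + dot (c - W *m w) (c - W *m w) <=
  dirichlet W c + th * dot (c - w) (c - w).
Proof.
move=> w0 c0; have [g Eg] : exists g, g = w - W *m w by eexists.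
have [e Ee] : exists e, e = c - w by eexists.
have -> : W *m w = w + - g by rewrite Eg opprB addrCA subrr addr0.
have -> : c - (w + - g) = e + g by rewrite Ee opprD opprK addrA.
have -> : dirichlet W c = dirichlet W (e + w) by rewrite Ee subrK.
have e0 : avg R N *m e = 0 by rewrite Ee mulmxBr w0 c0 subrr.
rewrite -Ee -(scaleN1r g) !dirichletD dirichletZ -scalemxAr !dotE (dotC g e).
have : dot w g - dot w (W *m g) = dot g g.
  by rewrite -dot_sym// -dotNl -dotDl -Eg.
have : dot e w - dot e (W *m w) = dot e g by rewrite -dotNr -dotDr Eg.
have := Wpsd g; have := Wgap e0; rewrite /dirichlet; lra.
Qed.

(** Quadratic in k = 1 - th: completing the square in [consensus_step] costs 3 / k, and gap times 3
    / k is 3 k / 8, which the damping of order k can pay. *)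
Definition gap : R := (1 - th) ^+ 2 / 8.

Lemma gap_bounds : 0 < gap <= 8^-1.
Proof.
have [h0 h1] := andP th01; rewrite /gap divr_gt0 ?exprn_gt0 ?subr_gt0//=.
rewrite ler_pdivrMr//; have : (1 - th) ^+ 2 <= 1 by nra.
lra.
Qed.

(** Energy of a heavy ball with potential [dirichlet] and velocity u - v. The weights gap and 1 -
    gap are those of the comparison points 0 and u in [consensus_step]. *)
Definition consensus u v : R :=
  dirichlet W u / 2 + gap / 2 * dot u u + (1 - gap) / 2 * dot (u - v) (u - v).

(** Average [dirichlet_prox] over c = 0 and c = u with weights gap and 1 - gap: the left-hand sides
    add up to twice the new value, and the comparison with 0, where the form vanishes, removes the
    fraction gap of the potential. Only beta <= 1 is used, so the factor is uniform in the
    momentum. *)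
Lemma consensus_step beta u v : 0 <= beta <= 1 ->
  avg R N *m u = 0 -> avg R N *m v = 0 ->
  consensus (W *m (u + beta *: (u - v))) u <= (1 - gap) * consensus u v.
Proof.
move=> /andP[b0 b1] u0 v0; have [e Ee] : exists e, e = u - v by eexists.
have [w Ew'] : exists w, w = u + beta *: e by eexists.
rewrite -Ee -Ew'.
have w0 : avg R N *m w = 0.
  by rewrite Ew' Ee mulmxDr -scalemxAr mulmxBr u0 v0 subrr scaler0 addr0.
have H1 := dirichlet_prox w0 u0.
have := dirichlet_prox w0 (mulmx0 _ _).
have -> : dirichlet W (0 : 'M[R]_(N, d)) = 0 by rewrite /dirichlet dot0l mulmx0 dot0l subrr.
rewrite !sub0r !dotNl !dotNr !opprK add0r => H2; move: H1.
have -> : u - w = - (beta *: e) by rewrite Ew' opprD addNKr.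
have -> : dot (u - W *m w) (u - W *m w) = dot (W *m w - u) (W *m w - u).
  by rewrite -opprB dotNl dotNr opprK.
rewrite dotNl dotNr opprK dotZl dotZr.
have Ew : dot w w = dot u u + 2 * beta * dot u e + beta ^+ 2 * dot e e.
  by rewrite Ew' !dotE (dotC e u); ring.
have [h0 h1] := andP th01; have [g0 g1] := andP gap_bounds.
pose k := 1 - th; have k0 : 0 < k by rewrite subr_gt0.
have gE : gap = k ^+ 2 / 8 by [].
rewrite /consensus -Ee; move: H2; rewrite Ew.
set A := dirichlet W (W *m w); set Dt := dirichlet W u.
set B := dot (W *m w) (W *m w); set Cc := dot (W *m w - u) (W *m w - u).
have uu0 := dot_ge0 u; have ee0 := dot_ge0 e.
(* Half of the damping k of |u|^2 is spent on the cross term, which leaves the factor 1 - k / 2. *)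
have := @dot_young _ _ _ (k / 2) u ((beta * th) *: e).
rewrite !dotE divr_gt0// invf_div => /(_ isT) Y.
have D0 : 0 <= Dt := Wdir u.
move: uu0 ee0 Y; set uu := dot u u; set ee := dot e e; set ue := dot u e.
move=> uu0 ee0 Y H2 H1.
have bb1 : beta ^+ 2 <= 1 by nra.
have k1 : k <= 1 by rewrite /k; lra.
have bt1 : (beta * th) ^+ 2 <= 1 by nra.
have thk : th = 1 - k by rewrite /k; lra.
have kik : k * k^-1 = 1 by rewrite divff// gt_eqF.
have ik1 : 1 <= k^-1 by rewrite invf_ge1.
have {}H2 : A + B <= (1 - k / 2) * uu + 3 * k^-1 * ee.
  apply: (le_trans H2).
  have : 2 * k^-1 * ((beta * th) ^+ 2 * ee) <= 2 * k^-1 * ee.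
    by rewrite ler_wpM2l ?ler_piMl// mulr_ge0// invr_ge0 ltW.
  have : th * beta ^+ 2 * ee <= k^-1 * ee.
    by rewrite ler_wpM2r// (le_trans _ ik1)//; nra.
  move: Y; rewrite thk; lra.
have {}H1 : A + Cc <= Dt + th * ee.
  apply: (le_trans H1); rewrite lerD2l ler_wpM2l//; nra.
have K1 : gap * (A + B) <= gap * ((1 - k / 2) * uu) + 3 / 8 * k * ee.
  have : gap * (A + B) <= gap * ((1 - k / 2) * uu + 3 * k^-1 * ee).
    by rewrite ler_wpM2l// ltW.
  have -> : gap * ((1 - k / 2) * uu + 3 * k^-1 * ee) =
     gap * ((1 - k / 2) * uu) + 3 / 8 * k * (k * k^-1) * ee by rewrite gE; ring.
  by rewrite kik mulr1.
have K2 : (1 - gap) * (A + Cc) <= (1 - gap) * (Dt + th * ee).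
  by rewrite ler_wpM2l//; lra.
have gk : gap <= k / 8 by rewrite gE ler_pM2r//; nra.
have K3 : 0 <= gap * (k / 2 - gap) * uu.
  by rewrite !mulr_ge0 ?(ltW g0)//; lra.
have K4 : 0 <= ((1 - gap) * (k - gap) - 3 / 8 * k) * ee by rewrite mulr_ge0//; nra.
move: K1 K2 K3 K4; rewrite thk; lra.
Qed.

Lemma consensus_ge0 u v : 0 <= consensus u v.
Proof.
have /andP[g0 g1] := gap_bounds; rewrite /consensus.
have g2 : 0 <= (1 - gap) / 2 by lra.
have g3 : 0 <= gap / 2 by lra.
apply: addr_ge0; last by rewrite mulr_ge0 ?dot_ge0.
by apply: addr_ge0; [rewrite divr_ge0 ?Wdir|rewrite mulr_ge0 ?dot_ge0].
Qed.

Lemma consensus_ge u v : gap / 2 * (dot u u + dot (u - v) (u - v)) <= consensus u v.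
Proof.
have /andP[g0 g1] := gap_bounds; rewrite /consensus.
have D0 := Wdir u; have e0 := dot_ge0 (u - v).
have : gap * dot (u - v) (u - v) <= (1 - gap) * dot (u - v) (u - v).
  by rewrite ler_wpM2r//; lra.
lra.
Qed.

Lemma consensus_le u : consensus u u <= dot u u.
Proof.
have /andP[g0 g1] := gap_bounds; rewrite /consensus subrr dot0l mulr0 addr0.
have := Wpsd u; have := dot_ge0 u => u0; rewrite /dirichlet.
have : gap * dot u u <= 8^-1 * dot u u by rewrite ler_wpM2r.
lra.
Qed.

Lemma consensus_restart u v : consensus u u <= consensus u v.
Proof.
have /andP[g0 g1] := gap_bounds; rewrite /consensus subrr dot0l mulr0 addr0.
by rewrite lerDl mulr_ge0 ?dot_ge0//; lra.
Qed.

(** Young with parameter gap / 2 in each square: half of the contraction will survive, and r is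
    charged a factor of order 1 / gap. *)
Lemma consensus_perturb u v r :
  consensus (u + r) v <= (1 + gap / 2) * consensus u v + 3 * gap^-1 * dot r r.
Proof.
have /andP[g0 g1] := gap_bounds.
have s0 : 0 < gap / 2 by rewrite divr_gt0.
have := dirichlet_young u r s0; have := dot_young_sq u r s0.
have := dot_young_sq (u - v) r s0; rewrite addrAC invf_div.
have := Wpsd r; have r0 := dot_ge0 r; rewrite /consensus.
have -> : dirichlet W r = dot r r - dot r (W *m r) by [].
set a1 := dot (u + r - v) _; set a2 := dot (u + r) _; set a3 := dirichlet W _.
set rr := dot r r; set b1 := dot (u - v) _; set b2 := dot u _; set b3 := dirichlet W _.
set wr := dot r (W *m r).
have {}r0 : 0 <= rr := r0.
have ig0 : 8 <= gap^-1 by rewrite -[8]invrK lef_pV2 ?posrE// invr_gt0.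
move=> h0 h1 h2 h3.
have G1 : gap / 2 * a2 <= gap / 2 * ((1 + gap / 2) * b2 + (1 + 2 / gap) * rr).
  by rewrite ler_pM2l.
have G2 : (1 - gap) / 2 * a1 <= (1 - gap) / 2 * ((1 + gap / 2) * b1 + (1 + 2 / gap) * rr).
  by rewrite ler_pM2l//; lra.
have : (1 + 2 / gap) * (rr - wr) <= (1 + 2 / gap) * rr.
  by rewrite ler_wpM2l ?gerBl//; lra.
have : 8 * rr <= gap^-1 * rr by rewrite ler_wpM2r.
lra.
Qed.

Lemma consensus_noisy_step beta u v r : 0 <= beta <= 1 ->
  avg R N *m u = 0 -> avg R N *m v = 0 ->
  consensus (W *m (u + beta *: (u - v)) + r) u <=
  (1 - gap / 2) * consensus u v + 3 * gap^-1 * dot r r.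
Proof.
move=> b01 u0 v0; have /andP[g0 g1] := gap_bounds.
apply: (le_trans (consensus_perturb _ _ _)); rewrite lerD2r.
have s0 : 0 < 1 + gap / 2 by lra.
have := consensus_step b01 u0 v0; rewrite -(ler_pM2l s0) => /le_trans; apply.
rewrite mulrA ler_wpM2r ?consensus_ge0//; nra.
Qed.

End ConsensusError.

(** * Refined step: average and deviation treated separately *)

Section RefinedStep.
Variables (R : realType) (N d : nat) (W : 'M[R]_N).
Hypotheses (N0 : (0 < N)%N) (Wsym : W^T = W).
Hypothesis Wrow : forall i, \sum_(j < N) W i j = 1.
Hypothesis Wpsd : forall x : 'M[R]_(N, d), 0 <= dot x (W *m x).
Hypothesis Wdir : forall x : 'M[R]_(N, d), 0 <= dirichlet W x.
Variables (th : R).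
Hypothesis th01 : 0 <= th < 1.
Hypothesis Wgap : forall x : 'M[R]_(N, d),
  avg R N *m x = 0 -> dot x (W *m x) <= th * dot x x.
Variables (f : 'I_N -> 'rV[R]_d -> R) (mu L : R) (xs : 'rV[R]_d).
Hypotheses (mu0 : 0 < mu) (L0 : 0 < L).
Hypothesis fcvx : forall i, strongly_convex mu (f i).
Hypothesis fsmooth : forall i, lipschitz_gradient L (f i).
Hypothesis xsmin : minimizer (average f) xs.
(* q is the square root of mu alpha; x and v are two consecutive iterates. *)
Variable q : R.
Hypothesis q01 : 0 < q < 1.
Implicit Types (x y u v xi : 'M[R]_(N, d)).

Local Notation X := (stack N xs).
Local Notation J := (avg R N).

(** The auxiliary point z of Nesterov's method, read off from two consecutive iterates; by
    [lookaheadE] the evaluation point is a convex combination of x and z. *)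
Definition momentum x v := v + q^-1 *: (x - v).
Definition lookahead x v := (1 + (1 - q) / (1 + q)) *: x - ((1 - q) / (1 + q)) *: v.
Definition dasg_step x v xi :=
  W *m lookahead x v - (q ^+ 2 / mu) *: (gradF f (lookahead x v) + xi).

Definition energy x v :=
  sumf f (J *m x) - sumf f X + mu / 2 * dot (J *m momentum x v - X) (J *m momentum x v - X).
Definition disagreement x v := consensus W th (dev x) (dev v).
(** The direction [a] of [nesterov_step] for the averaged dynamics. It depends on the past only, so
    its product with the noise has mean 0. *)
Definition noise_dir x v :=
  (q ^+ 2 / mu) *: (J *m gradF f (J *m lookahead x v))
  - q *: ((1 - q) *: (J *m momentum x v - X) + q *: (J *m lookahead x v - X)).

Lemma lookaheadE x v : lookahead x v = (1 + q)^-1 *: (x + q *: momentum x v).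
Proof.
have [q0 q1] := andP q01; apply/matrixP => i j; rewrite !mxE; field.
by rewrite !gt_eqF//; lra.
Qed.

Lemma gradF_opt : J *m gradF f X = 0.
Proof.
have S0 := minimizer_grad L0 fsmooth xsmin N0.
apply/matrixP => i j; rewrite avg_mulmxE// !mxE.
have := congr1 (fun M : 'rV[R]_d => M 0 j) S0; rewrite summxE !mxE => E.
by under eq_bigr => k _ do rewrite mxE rowK; rewrite E mulr0.
Qed.

Lemma avg_subX x : J *m x - X = J *m (x - X).
Proof. by rewrite mulmxBr avg_stack. Qed.

Lemma sumf_avg_ge x : mu / 2 * dot (J *m x - X) (J *m x - X) <= sumf f (J *m x) - sumf f X.
Proof.
have := sumf_strongly_convex fcvx fsmooth (J *m x) X.
have -> : dot (gradF f X) (J *m x - X) = 0.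
  by rewrite avg_subX -dot_avg gradF_opt dot0l.
lra.
Qed.

Lemma sumf_avg_le x : sumf f (J *m x) - sumf f X <= L / 2 * dot (J *m x - X) (J *m x - X).
Proof.
have := sumf_descent L0 fsmooth (J *m x) X.
have -> : dot (gradF f X) (J *m x - X) = 0.
  by rewrite avg_subX -dot_avg gradF_opt dot0l.
lra.
Qed.

Lemma energy_ge_dist x v : mu / 2 * dot (J *m x - X) (J *m x - X) <= energy x v.
Proof.
have := sumf_avg_ge x; rewrite /energy.
have : 0 <= mu / 2 * dot (J *m momentum x v - X) (J *m momentum x v - X).
  by rewrite mulr_ge0 ?dot_ge0// divr_ge0// ltW.
lra.
Qed.

Lemma energy_ge_momentum x v :
  mu / 2 * dot (J *m momentum x v - X) (J *m momentum x v - X) <= energy x v.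
Proof.
have := sumf_avg_ge x; rewrite /energy.
have : 0 <= mu / 2 * dot (J *m x - X) (J *m x - X).
  by rewrite mulr_ge0 ?dot_ge0// divr_ge0// ltW.
lra.
Qed.

Lemma energy_ge0 x v : 0 <= energy x v.
Proof.
by rewrite (le_trans _ (energy_ge_dist x v))// mulr_ge0 ?dot_ge0// divr_ge0// ltW.
Qed.

Lemma momentum_start x : momentum x x = x.
Proof. by rewrite /momentum subrr scaler0 addr0. Qed.

Lemma energy_start x : energy x x <= (L + mu) / 2 * dot (J *m x - X) (J *m x - X).
Proof. by have := sumf_avg_le x; rewrite /energy momentum_start; lra. Qed.

(** A restart moves z to x; strong convexity bounds the new quadratic term by the excess of F
    already present. *)
Lemma energy_restart x v : energy x x <= 2 * energy x v.
Proof.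
have := sumf_avg_ge x; have := energy_ge_momentum x v.
rewrite /energy momentum_start.
have : 0 <= mu / 2 * dot (J *m momentum x v - X) (J *m momentum x v - X).
  by rewrite mulr_ge0 ?dot_ge0// divr_ge0// ltW.
lra.
Qed.

Lemma dot_convex (s : R) u v : 0 <= s <= 1 ->
  dot ((1 - s) *: u + s *: v) ((1 - s) *: u + s *: v)
  <= (1 - s) * dot u u + s * dot v v.
Proof.
move=> /andP[s0 s1]; have := dot_ge0 (u - v).
rewrite !dotE (dotC v u) => H.
have : 0 <= s * (1 - s) * (dot u u - dot u v - (dot u v - dot v v)).
  by apply: mulr_ge0; [rewrite mulr_ge0// subr_ge0|move: H; lra].
lra.
Qed.

Lemma energy_ge_lookahead x v :
  mu / 2 * dot (J *m lookahead x v - X) (J *m lookahead x v - X) <= energy x v.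
Proof.
have [q0 q1] := andP q01.
have -> : J *m lookahead x v - X = (1 - q / (1 + q)) *: (J *m x - X)
    + (q / (1 + q)) *: (J *m momentum x v - X).
  rewrite lookaheadE -!scalemxAr mulmxDr -scalemxAr.
  by apply/matrixP => i j; rewrite !mxE; field; rewrite !gt_eqF//; lra.
have s01 : 0 <= q / (1 + q) <= 1.
  by rewrite divr_ge0 ?ler_pdivrMr//=; lra.
have := dot_convex (J *m x - X) (J *m momentum x v - X) s01.
have mu2 : 0 < mu / 2 by rewrite divr_gt0.
rewrite -(ler_pM2l mu2) => /le_trans; apply.
have := energy_ge_dist x v; have := energy_ge_momentum x v.
move: s01 => /andP[]; set s := q / _; set A := dot _ _; set B := dot _ _; set En := energy _ _.
move=> s0 s1 h1 h2.
have : s * (mu / 2 * A) <= s * En by rewrite ler_wpM2l.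
have : (1 - s) * (mu / 2 * B) <= (1 - s) * En by rewrite ler_wpM2l// subr_ge0.
lra.
Qed.

Lemma dot_dev_lookahead x v :
  dot (dev (lookahead x v)) (dev (lookahead x v)) <= 4 / gap th * disagreement x v.
Proof.
have [q0 q1] := andP q01; have /andP[g0 g1] := gap_bounds th01.
pose b := (1 - q) / (1 + q).
have b01 : 0 <= b <= 1 by rewrite /b divr_ge0 ?ler_pdivrMr//=; lra.
have -> : dev (lookahead x v) = dev x + b *: (dev x - dev v).
  have -> : lookahead x v = x + b *: (x + (-1) *: v).
    by apply/matrixP => i j; rewrite !mxE -/b; ring.
  by rewrite devD devZ devD devZ scaleN1r.
apply: (le_trans (dot_sqD _ _)).
have := consensus_ge Wdir th01 (dev x) (dev v); rewrite -/(disagreement x v) => H.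
rewrite mulrAC ler_pdivlMr//; move: H; rewrite dotZl dotZr.
have u0 := dot_ge0 (dev x - dev v).
have : b * (b * dot (dev x - dev v) (dev x - dev v)) <= dot (dev x - dev v) (dev x - dev v).
  by rewrite mulrA ler_piMl//; nra.
move: u0; set A := dot (dev x - _) _; set B := dot _ _ => A0 BB.
have : gap th * (b * (b * A)) <= gap th * A by rewrite ler_wpM2l// ltW.
lra.
Qed.

Lemma avg_noise_dir x v : J *m noise_dir x v = noise_dir x v.
Proof.
rewrite /noise_dir; set a := gradF _ _; set b := momentum _ _; set c := lookahead _ _.
rewrite mulmxBr -!scalemxAr mulmxDr -!scalemxAr !mulmxBr !mulmxA avg_idem//.
by rewrite avg_stack.
Qed.

(** The condition q L <= mu turns the gradient part (q^2 / mu) L |J y - X| into q |J y - X|, of the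
    same order as the other part. *)
Lemma noise_dir_le x v : q <= mu / L ->
  dot (noise_dir x v) (noise_dir x v) <= 8 * q ^+ 2 / mu * energy x v.
Proof.
move=> qmuL; have [q0 q1] := andP q01.
have qL : q * L <= mu by rewrite -ler_pdivlMr.
rewrite /noise_dir -scaleNr; apply: (le_trans (dot_sqD _ _)).
have q01' : 0 <= q <= 1 by rewrite !ltW.
have := dot_convex (J *m momentum x v - X) (J *m lookahead x v - X) q01'.
set b := _ *: (J *m momentum x v - X) + _ => hb.
have hG : dot (J *m gradF f (J *m lookahead x v)) (J *m gradF f (J *m lookahead x v))
    <= L ^+ 2 * dot (J *m lookahead x v - X) (J *m lookahead x v - X).
  apply: le_trans (gradF_lipschitz L0 fsmooth _ _).
  apply: le_trans (avg_le N0 _).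
  by rewrite (mulmxBr _ (gradF _ _)) gradF_opt subr0.
have h1 := energy_ge_momentum x v; have h2 := energy_ge_lookahead x v.
have En0 := energy_ge0 x v.
rewrite !(dotZl, dotZr); move: hG hb h1 h2 En0.
set G := dot (J *m gradF _ _) _; set A := dot (J *m lookahead _ _ - _) _.
set B := dot (J *m momentum _ _ - _) _; set En := energy _ _; set D := dot b b.
move=> hG hb h1 h2 En0.
pose m := mu^-1; have m0 : 0 < m by rewrite invr_gt0.
have mm : m * mu = 1 by rewrite mulVf// gt_eqF.
have hA : A <= 2 * m * En.
  have : 2 * m * (mu / 2 * A) <= 2 * m * En by rewrite ler_wpM2l// mulr_ge0// ltW.
  by have -> : 2 * m * (mu / 2 * A) = m * mu * A by [field]; rewrite mm mul1r.
have hB : B <= 2 * m * En.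
  have : 2 * m * (mu / 2 * B) <= 2 * m * En by rewrite ler_wpM2l// mulr_ge0// ltW.
  by have -> : 2 * m * (mu / 2 * B) = m * mu * B by [field]; rewrite mm mul1r.
have hD : D <= 2 * m * En.
  apply: (le_trans hb).
  have : (1 - q) * B <= (1 - q) * (2 * m * En) by rewrite ler_wpM2l// subr_ge0 ltW.
  have : q * A <= q * (2 * m * En) by rewrite ler_wpM2l// ltW.
  lra.
have qLm : q * L * m <= 1 by rewrite -mm mulrC ler_pM2l.
have hG' : (q * m) ^+ 2 * G <= 2 * m * En.
  have : (q * m) ^+ 2 * G <= (q * m) ^+ 2 * (L ^+ 2 * A) by rewrite ler_wpM2l// sqr_ge0.
  have -> : (q * m) ^+ 2 * (L ^+ 2 * A) = (q * L * m) ^+ 2 * A by ring.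
  move=> /le_trans; apply; apply: le_trans hA.
  rewrite ler_piMl ?dot_ge0// expr_le1// !mulr_ge0// ltW//.
have -> : q ^+ 2 / mu * (q ^+ 2 / mu * G) = q ^+ 2 * ((q * m) ^+ 2 * G) by rewrite /m; ring.
have -> : 8 * q ^+ 2 / mu * En = q ^+ 2 * (4 * (2 * m * En)) by rewrite /m; ring.
have -> : 2 * (q ^+ 2 * ((q * m) ^+ 2 * G)) + 2 * (- q * (- q * D)) =
  q ^+ 2 * (2 * ((q * m) ^+ 2 * G) + 2 * D) by ring.
rewrite ler_pM2l ?exprn_gt0//; lra.
Qed.

(** The average performs a Nesterov step with gradient J grad F (J y). Evaluating at y instead of J
    y is an extra error [eps], Lipschitz in the deviation, which joins the noise in eta. *)
Lemma dasg_energy_step (de : R) x v xi :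
  0 < de -> q <= mu / L ->
  energy (dasg_step x v xi) x <= (1 - q + de * q) * energy x v
    + (2 / (mu * de) + 2 / mu) * L ^+ 2 * (4 / gap th) * q * disagreement x v
    + 2 * (q ^+ 2 / mu) * dot xi xi + dot xi (noise_dir x v).
Proof.
move=> de0 qmuL; have [q0 q1] := andP q01; have /andP[g0 g1] := gap_bounds th01.
set y := lookahead x v.
pose eps := gradF f y - gradF f (J *m y); pose eta := J *m eps + J *m xi.
pose G := J *m gradF f (J *m y).
have Jx' : J *m dasg_step x v xi = J *m y - (q ^+ 2 / mu) *: (G + eta).
  rewrite /dasg_step -/y mulmxBr mulmxA avg_mix// -scalemxAr /eta /G addrA.
  by rewrite -!mulmxDr /eps addrCA subrr addr0.
have Jy : J *m y = (1 + q)^-1 *: (J *m x + q *: (J *m momentum x v)).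
  by rewrite /y lookaheadE -scalemxAr mulmxDr -scalemxAr.
have hG u w : dot (J *m u) (J *m w - J *m y) = dot u (J *m w - J *m y).
  by rewrite -mulmxBr dot_avg mulmxA avg_idem.
have h1 : sumf f (J *m y) + dot G (J *m x - J *m y) <= sumf f (J *m x).
  have := sumf_strongly_convex fcvx fsmooth (J *m x) (J *m y).
  rewrite /G hG => H; apply: le_trans H; rewrite lerDl.
  by rewrite mulr_ge0 ?dot_ge0// divr_ge0// ltW.
have h2 : sumf f (J *m y) + dot G (X - J *m y) + mu / 2 * dot (X - J *m y) (X - J *m y)
    <= sumf f X.
  have := sumf_strongly_convex fcvx fsmooth X (J *m y).
  by have := hG (gradF f (J *m y)) X; rewrite avg_stack// /G => ->.
have h3 : sumf f (J *m dasg_step x v xi) <= sumf f (J *m y)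
    + dot G (J *m dasg_step x v xi - J *m y) + mu / (2 * q ^+ 2) *
    dot (J *m dasg_step x v xi - J *m y) (J *m dasg_step x v xi - J *m y).
  have := sumf_descent L0 fsmooth (J *m dasg_step x v xi) (J *m y).
  rewrite /G hG => H; apply: (le_trans H); rewrite lerD2l ler_wpM2r ?dot_ge0//.
  rewrite ler_pdivlMr ?mulr_gt0 ?exprn_gt0//.
  have : q * (q * L) <= 1 * (q * L).
    by rewrite ler_wpM2r// ?mulr_ge0// ltW.
  have : q * L <= mu by rewrite -ler_pdivlMr.
  lra.
have := @nesterov_step R N d mu q (J *m x) (J *m momentum x v) X G eta
  (sumf f (J *m x)) (sumf f (J *m y)) (sumf f X) (sumf f (J *m dasg_step x v xi)) mu0 q01.
rewrite /= -Jy -Jx' => /(_ h1 h2 h3).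
have -> : J *m x + q^-1 *: (J *m dasg_step x v xi - J *m x) =
    J *m momentum (dasg_step x v xi) x.
  by rewrite -mulmxBr scalemxAr -mulmxDr.
rewrite -/(energy _ _) -/(energy _ _) -/(noise_dir x v).
move=> /le_trans; apply.
have -> : dot eta (noise_dir x v) = dot (J *m eps) (noise_dir x v) + dot xi (noise_dir x v).
  by rewrite /eta dotDl (dot_avg xi) avg_noise_dir.
rewrite addrA lerD2r.
(* Chosen so that by [noise_dir_le] the square of the direction costs exactly de q times the energy;
   the square of [eps] then gets a factor q / de. *)
pose s := 4 * q / (mu * de).
have s0 : 0 < s by rewrite divr_gt0 ?mulr_gt0.
have := dot_young (J *m eps) (noise_dir x v) s0.
have := noise_dir_le x v qmuL; set a := noise_dir x v.
have eps1 : dot (J *m eps) (J *m eps) <= L ^+ 2 * (4 / gap th * disagreement x v).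
  apply: (le_trans (avg_le N0 _)); apply: (le_trans (gradF_lipschitz L0 fsmooth _ _)).
  by rewrite ler_wpM2l ?sqr_ge0//; exact: dot_dev_lookahead.
have := dot_sqD (J *m eps) (J *m xi); rewrite -/eta.
have := avg_le N0 xi; move: eps1.
set Y := dot (J *m eps) a; set A := dot a a; set P := dot (J *m eps) _.
set Q := dot (J *m xi) _; set T := dot eta eta; set En := energy x v.
set D := _ * disagreement x v; set Z := dot xi xi => hP hQ hT hA hY.
have -> : (2 / (mu * de) + 2 / mu) * L ^+ 2 * (4 / gap th) * q * disagreement x v =
  (2 / (mu * de) + 2 / mu) * q * (L ^+ 2 * D) by rewrite /D; ring.
have hA' : s^-1 * A <= 2 * de * q * En.
  have : s^-1 * A <= s^-1 * (8 * q ^+ 2 / mu * En) by rewrite ler_pM2l// invr_gt0.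
  have -> // : s^-1 * (8 * q ^+ 2 / mu * En) = 2 * de * q * En.
  by rewrite /s; field; rewrite !gt_eqF.
have hP' : s * P <= s * (L ^+ 2 * D) by rewrite ler_wpM2l// ltW.
have hT' : q ^+ 2 / mu * T <= q ^+ 2 / mu * (2 * (L ^+ 2 * D) + 2 * Z).
  rewrite ler_wpM2l ?divr_ge0 ?sqr_ge0// ?(ltW mu0)//; lra.
have LD : q ^+ 2 / mu * (L ^+ 2 * D) <= q / mu * (L ^+ 2 * D).
  rewrite ler_wpM2r//; first by rewrite (le_trans (dot_ge0 _) hP).
  by rewrite ler_pM2r ?invr_gt0// expr2 ler_piMr// ltW.
have E1 : s * (L ^+ 2 * D) = 2 * (2 / (mu * de) * q * (L ^+ 2 * D)) by rewrite /s; ring.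
have E2 : (2 / (mu * de) + 2 / mu) * q * (L ^+ 2 * D) =
  2 / (mu * de) * q * (L ^+ 2 * D) + 2 * (q / mu * (L ^+ 2 * D)) by ring.
rewrite E2; move: hP' hA' hY hT' LD; rewrite E1; lra.
Qed.

Definition noise_gain :=
  3 / (gap th * mu ^+ 2) * (4 + 8 * L ^+ 2 / mu + 16 * L ^+ 2 / gap th).

(** The deviation follows the consensus iteration perturbed by alpha times a gradient, whence q^4.
    Splitting that gradient at X leaves gradF X, which need not vanish because the f_i have
    different minimizers: here C_1 enters. *)
Lemma dasg_disagreement_step x v xi :
  disagreement (dasg_step x v xi) x <= (1 - gap th / 2) * disagreement x v +
    noise_gain * q ^+ 4 * (dot xi xi + dot (gradF f X) (gradF f X) + energy x v + disagreement x v).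
Proof.
have [q0 q1] := andP q01; have /andP[g0 g1] := gap_bounds th01.
set y := lookahead x v.
pose b := (1 - q) / (1 + q).
have b01 : 0 <= b <= 1 by rewrite /b divr_ge0 ?ler_pdivrMr//=; lra.
pose r := - (q ^+ 2 / mu) *: dev (gradF f y + xi).
have Ed : dev (dasg_step x v xi) = W *m (dev x + b *: (dev x - dev v)) + r.
  rewrite /dasg_step -scaleNr devD devZ dev_mix// -/y; congr (W *m _ + _).
  have -> : y = x + b *: (x + (-1) *: v).
    by apply/matrixP => i j; rewrite !mxE -/b; ring.
  by rewrite devD devZ devD devZ scaleN1r.
rewrite /disagreement Ed; apply: le_trans.
  by apply: consensus_noisy_step => //; exact: avg_dev.
rewrite -/(disagreement x v) lerD2l.
have hY := dot_dev_lookahead x v; rewrite -/y in hY.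
have hE := energy_ge_lookahead x v; rewrite -/y in hE.
have hyX : dot (y - X) (y - X) = dot (J *m y - X) (J *m y - X) + dot (dev y) (dev y).
  rewrite (dotT_dev N0) -avg_subX /dev -avg_subX; congr (_ + dot _ _);
  by rewrite opprB addrA subrK.
have hG := gradF_lipschitz L0 fsmooth y X.
have hG2 := dot_sqD (gradF f y - gradF f X) (gradF f X); rewrite subrK in hG2.
have hr : dot r r <= (q ^+ 2 / mu) ^+ 2 * (2 * dot (gradF f y) (gradF f y) + 2 * dot xi xi).
  rewrite /r dotZl dotZr mulrA mulrNN -expr2 ler_wpM2l ?sqr_ge0//.
  by apply: (le_trans (dev_le N0 _)); exact: dot_sqD.
move: hY hE hyX hG hG2 hr; rewrite /noise_gain.
set Dv := dot (dev y) _; set Dd := disagreement x v; set Av := dot (J *m y - X) _.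
set En := energy x v; set G := dot (gradF f y) _; set B := dot (gradF f X) _.
set GX := dot (gradF f y - _) _; set Z := dot xi xi; set yX := dot (y - X) _.
move=> hY hE hyX hG hG2 hr.
have Z0 : 0 <= Z := dot_ge0 _; have B0 : 0 <= B := dot_ge0 _.
have En0 : 0 <= En := energy_ge0 x v.
have Dd0 : 0 <= Dd := consensus_ge0 Wdir th01 _ _.
pose m := mu^-1; have m0 : 0 < m by rewrite invr_gt0.
pose h := (gap th)^-1; have h0 : 0 < h by rewrite invr_gt0.
have hA : Av <= 2 * m * En.
  have : 2 * m * (mu / 2 * Av) <= 2 * m * En by rewrite ler_wpM2l// mulr_ge0// ltW.
  have -> // : 2 * m * (mu / 2 * Av) = Av by rewrite /m; field; rewrite gt_eqF.
have L2 : 0 <= L ^+ 2 := sqr_ge0 L.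
have hyX' : L ^+ 2 * yX <= L ^+ 2 * (2 * m * En + 4 * h * Dd).
  by rewrite ler_wpM2l// hyX lerD.
have hr2 : dot r r <= (q ^+ 2 / mu) ^+ 2 *
    (4 * B + 2 * Z + 8 * (L ^+ 2 * m) * En + 16 * (L ^+ 2 * h) * Dd).
  apply: (le_trans hr); rewrite ler_wpM2l ?sqr_ge0//; lra.
have hr3 : 4 * B + 2 * Z + 8 * (L ^+ 2 * m) * En + 16 * (L ^+ 2 * h) * Dd <=
    (4 + 8 * (L ^+ 2 * m) + 16 * (L ^+ 2 * h)) * (Z + B + En + Dd).
  have p1 : 0 <= L ^+ 2 * m by rewrite mulr_ge0// ltW.
  have p2 : 0 <= L ^+ 2 * h by rewrite mulr_ge0// ltW.
  have := mulr_ge0 p1 Z0; have := mulr_ge0 p1 B0; have := mulr_ge0 p1 En0.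
  have := mulr_ge0 p1 Dd0; have := mulr_ge0 p2 Z0; have := mulr_ge0 p2 B0.
  have := mulr_ge0 p2 En0; have := mulr_ge0 p2 Dd0; lra.
have := le_trans hr2 (ler_wpM2l (sqr_ge0 _) hr3).
have gh : 0 <= 3 / gap th by rewrite divr_ge0// ltW.
move=> /(ler_wpM2l gh) /le_trans; apply.
rewrite le_eqVlt; apply/orP; left; apply/eqP; rewrite /m /h.
by field; rewrite !gt_eqF.
Qed.

End RefinedStep.

(** * Crude step: accelerated descent on the penalized function *)

Section CrudeStep.
Variables (R : realType) (N d : nat) (W : 'M[R]_N).
Hypotheses (N0 : (0 < N)%N) (Wsym : W^T = W).
Hypothesis Wrow : forall i, \sum_(j < N) W i j = 1.
Hypothesis Wdir : forall x : 'M[R]_(N, d), 0 <= dirichlet W x.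
Variables (lmin : R).
Hypothesis Wmin : forall x : 'M[R]_(N, d), lmin * dot x x <= dot x (W *m x).
Variables (f : 'I_N -> 'rV[R]_d -> R) (mu L : R) (xs : 'rV[R]_d).
Hypotheses (mu0 : 0 < mu) (L0 : 0 < L).
Hypothesis fcvx : forall i, strongly_convex mu (f i).
Hypothesis fsmooth : forall i, lipschitz_gradient L (f i).
Variable q : R.
Hypothesis q01 : 0 < q < 1.
Hypothesis qlmin : q ^+ 2 / mu * L <= lmin.
Implicit Types (x y u v xi : 'M[R]_(N, d)).

Local Notation X := (stack N xs).
Local Notation alpha := (q ^+ 2 / mu).

Definition penalized x := sumf f x + mu / (2 * q ^+ 2) * dirichlet W x.
Definition penalized_grad x := gradF f x + (mu / q ^+ 2) *: (x - W *m x).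
(** Measured from X, which need not minimize [penalized], so the value can be negative;
    [pen_energy_ge] bounds the defect. *)
Definition pen_energy x v := penalized x - penalized X
  + mu / 2 * dot (momentum q x v - X) (momentum q x v - X).
Definition pen_noise_dir x v :=
  alpha *: penalized_grad (lookahead q x v)
  - q *: ((1 - q) *: (momentum q x v - X) + q *: (lookahead q x v - X)).

Let q0 : 0 < q. Proof. by have [] := andP q01. Qed.
Let q1 : q < 1. Proof. by have [] := andP q01. Qed.

Lemma penalized_strongly_convex x y :
  penalized y + dot (penalized_grad y) (x - y) + mu / 2 * dot (x - y) (x - y)
  <= penalized x.
Proof.
have := sumf_strongly_convex fcvx fsmooth x y.
have [e Ee] : exists e, e = x - y by eexists.
have -> : penalized x = penalized (y + e) by rewrite Ee addrC subrK.
rewrite -Ee /penalized /penalized_grad dirichletD// dotDl dotZl.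
have -> : dot (y - W *m y) e = dot y e - dot y (W *m e) by rewrite dotDl dotNl dot_sym.
have -> : sumf f (y + e) = sumf f x by rewrite Ee addrC subrK.
have k0 : 0 < mu / (2 * q ^+ 2) by rewrite divr_gt0 ?mulr_gt0 ?exprn_gt0.
have := mulr_ge0 (ltW k0) (Wdir e).
have -> : mu / q ^+ 2 = 2 * (mu / (2 * q ^+ 2)) by field; rewrite gt_eqF.
set k := mu / (2 * q ^+ 2); lra.
Qed.

(** The penalty has curvature at most (1 - lmin) / alpha, and alpha L <= lmin leaves exactly enough
    room for F below 1 / alpha. *)
Lemma penalized_descent x y :
  penalized x <= penalized y + dot (penalized_grad y) (x - y)
    + mu / (2 * q ^+ 2) * dot (x - y) (x - y).
Proof.
have := sumf_descent L0 fsmooth x y.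
have [e Ee] : exists e, e = x - y by eexists.
have -> : penalized x = penalized (y + e) by rewrite Ee addrC subrK.
rewrite -Ee /penalized /penalized_grad dirichletD// dotDl dotZl.
have -> : dot (y - W *m y) e = dot y e - dot y (W *m e) by rewrite dotDl dotNl dot_sym.
have -> : sumf f (y + e) = sumf f x by rewrite Ee addrC subrK.
have k0 : 0 < mu / (2 * q ^+ 2) by rewrite divr_gt0 ?mulr_gt0 ?exprn_gt0.
have kL : L / 2 <= mu / (2 * q ^+ 2) * lmin.
  have := ler_wpM2l (ltW k0) qlmin.
  have -> // : mu / (2 * q ^+ 2) * (q ^+ 2 / mu * L) = L / 2.
  by field; rewrite !gt_eqF.
have := ler_wpM2l (ltW k0) (Wmin e).
have := ler_wpM2r (dot_ge0 e) kL.
have -> : mu / q ^+ 2 = 2 * (mu / (2 * q ^+ 2)) by field; rewrite gt_eqF.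
have -> : dirichlet W e = dot e e - dot e (W *m e) by [].
set k := mu / (2 * q ^+ 2); lra.
Qed.

Lemma pen_energy_step x v xi :
  pen_energy (dasg_step W f mu q x v xi) x <=
  (1 - q) * pen_energy x v + alpha * dot xi xi + dot xi (pen_noise_dir x v).
Proof.
set y := lookahead q x v.
have Ey : y = (1 + q)^-1 *: (x + q *: momentum q x v) by exact: lookaheadE.
have Ex' : dasg_step W f mu q x v xi = y - alpha *: (penalized_grad y + xi).
  rewrite /dasg_step /penalized_grad -/y.
  apply/matrixP => i j; rewrite !mxE; field; rewrite !gt_eqF//; have := q0; lra.
have h1 : penalized y + dot (penalized_grad y) (x - y) <= penalized x.
  apply: le_trans (penalized_strongly_convex x y); rewrite lerDl.
  by rewrite mulr_ge0 ?dot_ge0// divr_ge0// ltW.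
have h2 := penalized_strongly_convex X y.
have h3 := penalized_descent (dasg_step W f mu q x v xi) y.
have := @nesterov_step R N d mu q x (momentum q x v) X (penalized_grad y) xi
  (penalized x) (penalized y) (penalized X) (penalized (dasg_step W f mu q x v xi)) mu0 q01.
by rewrite /= -Ey -Ex' => /(_ h1 h2 h3).
Qed.

(** The penalty is flat on consensus, so the gradient at X is gradF X; half of the curvature absorbs
    this linear term. *)
Lemma pen_energy_ge x v :
  mu / 4 * dot (x - X) (x - X) - dot (gradF f X) (gradF f X) / mu <= pen_energy x v.
Proof.
have := penalized_strongly_convex x X.
rewrite /penalized_grad mix_stack// subrr scaler0 addr0.
have m0 : 0 < mu^-1 by rewrite invr_gt0.
have := @dot_young _ _ _ (2 / mu) (- gradF f X) (x - X).
rewrite divr_gt0// invf_div => /(_ isT); rewrite !dotNl !dotNr opprK.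
rewrite /pen_energy; have : 0 <= mu / 2 * dot (momentum q x v - X) (momentum q x v - X).
  by rewrite mulr_ge0 ?dot_ge0// divr_ge0// ltW.
lra.
Qed.

Lemma pen_energy_start x :
  pen_energy x x <= (mu + mu / (2 * q ^+ 2)) * dot (x - X) (x - X)
    + dot (gradF f X) (gradF f X) / (2 * mu).
Proof.
have := penalized_descent x X.
rewrite /penalized_grad mix_stack// subrr scaler0 addr0.
have m0 : 0 < mu^-1 by rewrite invr_gt0.
have := dot_young (gradF f X) (x - X) m0; rewrite invrK.
rewrite /pen_energy momentum_start invfM.
set A := dot _ _; set B := dot _ _; set D := dot _ _; lra.
Qed.

End CrudeStep.

(** * Measurability and independence of the noise *)

Section BorelVectors.
Variables (R : realType) (d : nat).

Lemma measurable_continuous_rV (h : 'rV[R]_d -> R) : continuous h ->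
  measurable_fun [set: borel_rV R d] (h : borel_rV R d -> R).
Proof.
move=> /continuousP ch; apply: (measurability _ (RGenOpens.measurableE R)).
move=> _ [_ [a [b ->]] <-]; rewrite setTI.
by apply: sub_sigma_algebra; apply: ch; exact: interval_open.
Qed.

Lemma measurable_coord_rV (j : 'I_d) :
  measurable_fun [set: borel_rV R d] (fun x : borel_rV R d => x 0 j).
Proof. by apply: measurable_continuous_rV => x; exact: coord_continuous. Qed.

(** An open set is a union of rational boxes. There are countably many of them, and each is cut out
    by finitely many coordinates. *)
Lemma measurable_rV dT (T : measurableType dT) (h : T -> borel_rV R d) :
  (forall j, measurable_fun setT (fun t => h t 0 j)) -> measurable_fun setT h.
Proof.
move=> mh; apply: (@measurability _ _ _ _ setT h (@open 'rV[R]_d)) => //.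
move=> _ [U oU <-]; rewrite setTI.
(* Rational centre, radius 1 / (n + 1). [F] enumerates the codes of pairs and is empty at codes of
   nothing and at boxes that leave U. *)
pose box (c : 'rV[rat]_d) (n : nat) :=
  [set v : 'rV[R]_d | forall j, ball (ratr (c 0 j) : R) n.+1%:R^-1 (v 0 j)].
pose F k := if unpickle k is Some (c, n) then
  if `[< box c n `<=` U >] then h @^-1` box c n else set0 else set0.
have -> : h @^-1` U = \bigcup_k F k.
  apply/seteqP; split => [t /= Ot|t [k _]]; last first.
    rewrite /F; case: unpickle => [[c n]|]//.
    by case: asboolP => // sub ht; exact: sub.
  have /nbhs_ballP[e /= e0 he] : nbhs (h t) U by exact: open_nbhs_nbhs.
  have [n hn] : exists n, n.+1%:R^-1 < e / 2.
    have e2 : 0 < e / 2 by rewrite divr_gt0.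
    have [n _ hn] := near_infty_natSinv_lt (PosNum e2).
    by exists n; exact: (hn n (leqnn n)).
  have n0 : 0 < n.+1%:R^-1 :> R by rewrite invr_gt0.
  have /fin_all_exists[c hc] : forall j : 'I_d, exists c : rat,
      ball (ratr c : R) n.+1%:R^-1 (h t 0 j).
    move=> j; have := @rat_in_itvoo R (h t 0 j) (h t 0 j + n.+1%:R^-1).
    rewrite ltrDl => /(_ n0)[c]; rewrite in_itv/= => /andP[c1 c2]; exists c.
    rewrite /ball/=; move: n0 c2; set s := _^-1 => n0 c2.
    by rewrite ltr_norml; apply/andP; split; lra.
  exists (pickle ((\row_j c j) : 'rV[rat]_d, n)) => //.
  rewrite /F pickleK; case: asboolP => [_ j|]; first by rewrite mxE.
  case=> v hv; apply: he; split=> // i j; rewrite ord1.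
  have := hv j; have := hc j; rewrite mxE /ball/= => hc1 hv1.
  rewrite -[h t 0 j](subrK (ratr (c j))) -addrA; apply: le_lt_trans (ler_normD _ _) _.
  by move: hc1 hv1 hn; rewrite distrC; set s := _^-1; lra.
apply: bigcupT_measurable => k; rewrite /F.
case: unpickle => [[c n]|]; last exact: measurable0.
case: asboolP => _; last exact: measurable0.
have -> : h @^-1` box c n =
    \bigcap_(j in [set: 'I_d]) (fun t => h t 0 j) @^-1` ball (ratr (c 0 j) : R) n.+1%:R^-1.
  by apply/seteqP; split => [t ht j _|t ht j]; [exact: ht|exact: (ht j I)].
apply: fin_bigcap_measurable => // j _; rewrite -[X in measurable X]setTI.
by apply: mh => //; exact: measurable_ball.
Qed.

(** The topology of row vectors comes from the sup norm, which controls [norm2] up to the square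
    root of d. *)
Lemma lipschitz_continuous_rV (h : 'rV[R]_d -> R) (K : R) :
  (forall x y, `|h x - h y| <= K * norm2 (x - y)) -> continuous h.
Proof.
move=> hK x.
have K0 : 0 <= `|K| by [].
have norm2_le (v : 'rV[R]_d) (e : R) : 0 <= e -> (forall j, `|v 0 j| <= e) ->
    norm2 v <= Num.sqrt d%:R * e.
  move=> e0 hv; rewrite -ler_sqr ?nnegrE ?mulr_ge0 ?sqrtr_ge0//.
  rewrite norm2_sqr exprMn sqr_sqrtr// /dot big_ord1 mulr_natl.
  have -> : e ^+ 2 *+ d = \sum_(j < d) e ^+ 2 by rewrite sumr_const card_ord.
  apply: ler_sum => j _.
  by rewrite -expr2 -[v _ _ ^+ 2]real_normK ?num_real// ler_sqr ?nnegrE.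
pose M := `|K| * Num.sqrt d%:R + 1.
have M0 : 0 < M by rewrite ltr_wpDl// mulr_ge0// sqrtr_ge0.
apply/cvgrPdist_le; first exact: nbhs_filter.
move=> e e0.
have eM : 0 < e / M by rewrite divr_gt0.
apply: filterS (nbhsx_ballx x (e / M) eM) => y xy.
rewrite /=; apply: (le_trans (hK _ _)).
have hb : norm2 (x - y) <= Num.sqrt d%:R * (e / M).
  apply: norm2_le => [|j]; first exact: ltW.
  by have := xy.2 0 j; rewrite /ball/= !mxE => /ltW.
apply: (@le_trans _ _ (`|K| * norm2 (x - y))).
  by rewrite ler_wpM2r ?ler_norm// sqrtr_ge0.
apply: (@le_trans _ _ (`|K| * (Num.sqrt d%:R * (e / M)))); first by rewrite ler_wpM2l.
by rewrite mulrA mulrCA ler_piMr ?(ltW e0)// ler_pdivrMr// mul1r lerDl.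
Qed.

Lemma measurable_grad (f : 'rV[R]_d -> R) (L : R) (j : 'I_d) :
  0 <= L -> lipschitz_gradient L f ->
  measurable_fun [set: borel_rV R d] (fun x : borel_rV R d => grad f x 0 j).
Proof.
move=> L0 [_ lf]; apply: measurable_continuous_rV.
apply: (@lipschitz_continuous_rV _ L) => x y; apply: le_trans (lf x y).
rewrite -ler_sqr ?nnegrE ?sqrtr_ge0// norm2_sqr real_normK ?num_real//.
by have := ler_entry_dot (grad f x - grad f y) 0 j; rewrite !mxE.
Qed.

Lemma measurable_differentiable (f : 'rV[R]_d -> R) (L : R) :
  lipschitz_gradient L f -> measurable_fun [set: borel_rV R d] (f : borel_rV R d -> R).
Proof.
move=> [df _]; apply: measurable_continuous_rV => x.
exact: differentiable_continuous (df x).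
Qed.

End BorelVectors.

Section MeasurableMatrices.
Variables (R : realType) (dT : measure_display) (T : measurableType dT).

Definition measurable_mx m n (Y : T -> 'M[R]_(m, n)) : Prop :=
  forall i j, measurable_fun setT (fun t => Y t i j).

Lemma measurable_mx_cst m n (c : 'M[R]_(m, n)) : measurable_mx (fun=> c).
Proof. by move=> i j; exact: measurable_cst. Qed.

Lemma measurable_mxD m n (Y Z : T -> 'M[R]_(m, n)) :
  measurable_mx Y -> measurable_mx Z -> measurable_mx (fun t => Y t + Z t).
Proof.
move=> mY mZ i j; under eq_fun do rewrite mxE.
exact: measurable_funD.
Qed.

Lemma measurable_mx_mul m n p (A : 'M[R]_(p, m)) (Y : T -> 'M[R]_(m, n)) :
  measurable_mx Y -> measurable_mx (fun t => A *m Y t).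
Proof.
move=> mY i j; under eq_fun do rewrite mxE.
by apply: measurable_sum => k; exact: measurable_funM.
Qed.

Lemma measurable_mxZ m n (a : R) (Y : T -> 'M[R]_(m, n)) :
  measurable_mx Y -> measurable_mx (fun t => a *: Y t).
Proof.
by move=> mY; under eq_fun do rewrite -mul_scalar_mx; exact: measurable_mx_mul.
Qed.

Lemma measurable_mxB m n (Y Z : T -> 'M[R]_(m, n)) :
  measurable_mx Y -> measurable_mx Z -> measurable_mx (fun t => Y t - Z t).
Proof.
move=> mY mZ; under eq_fun do rewrite -scaleN1r.
by apply: measurable_mxD => //; exact: measurable_mxZ.
Qed.

Lemma measurable_row m n (Y : T -> 'M[R]_(m, n)) i :
  measurable_mx Y -> measurable_fun setT (fun t => row i (Y t) : borel_rV R n).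
Proof.
move=> mY; apply: measurable_rV => j; under eq_fun do rewrite mxE.
exact: mY.
Qed.

Lemma measurable_dot m n (Y Z : T -> 'M[R]_(m, n)) :
  measurable_mx Y -> measurable_mx Z -> measurable_fun setT (fun t => dot (Y t) (Z t)).
Proof.
move=> mY mZ; apply: measurable_sum => i; apply: measurable_sum => j.
exact: measurable_funM.
Qed.

End MeasurableMatrices.

(** * Independence, Fubini and centered noise *)

Section ProductLaw.
Local Open Scope ereal_scope.
Variables (R : realType) (dO d1 d2 : measure_display) (Om : measurableType dO).
Variables (T1 : measurableType d1) (T2 : measurableType d2) (P : probability Om R).
Variables (X1 : {mfun Om >-> T1}) (X2 : {mfun Om >-> T2}).
Hypothesis indep : forall A B, measurable A -> measurable B ->
  P (X1 @^-1` A `&` X2 @^-1` B) = P (X1 @^-1` A) * P (X2 @^-1` B).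
Variable F : T1 * T2 -> R.
Hypothesis mF : measurable_fun setT F.
Hypothesis iF : P.-integrable setT (EFin \o (fun om => F (X1 om, X2 om))).

Let m1 := distribution P X1.
Let m2 := distribution P X2.
Let X12 om := (X1 om, X2 om).

Let mX12 : measurable_fun setT X12.
Proof. by apply: measurable_fun_pair; exact: measurable_funPT. Qed.

Let X12_mfun : {mfun Om >-> (T1 * T2)%type} :=
  HB.pack X12 (isMeasurableFun.Build _ _ _ _ X12 mX12).

(** By independence the joint law and the product law agree on rectangles, hence everywhere. *)
Let prodE A : measurable A -> (m1 \x m2) A = distribution P X12_mfun A.
Proof.
move=> mA; apply: (@product_measure_unique _ _ T1 T2 R m1 m2) => // B C mB mC; exact: indep.
Qed.

Let mEF : measurable_fun setT (EFin \o F).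
Proof. exact/measurable_EFinP. Qed.

Lemma product_law_integrable : (m1 \x m2).-integrable setT (EFin \o F).
Proof.
apply/integrableP; split=> //.
rewrite (eq_measure_integral (distribution P X12_mfun)); last first.
  by move=> A mA _; exact: prodE.
rewrite ge0_integral_distribution//; last exact: measurableT_comp.
by have /integrableP[] := iF.
Qed.

Lemma product_law_fubini :
  \int[P]_om (F (X1 om, X2 om))%:E = \int[m1]_x \int[m2]_y (F (x, y))%:E.
Proof.
rewrite [RHS](integral12_prod_meas1 product_law_integrable).
rewrite (eq_measure_integral (distribution P X12_mfun)); last first.
  by move=> A mA _; exact: prodE.
by rewrite integral_distribution.
Qed.

Lemma product_law_integrable_l : m1.-integrable setT (fun x => \int[m2]_y (F (x, y))%:E).
Proof. exact: (integrable_fubini_F product_law_integrable). Qed.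

Lemma product_law_ae_integrable :
  {ae m1, forall x, m2.-integrable setT (fun y => (F (x, y))%:E)}.
Proof. exact: (ae_integrable1 product_law_integrable). Qed.

End ProductLaw.

Section IndependentNoise.
Local Open Scope ereal_scope.
Variables (R : realType) (dO dY dZ : measure_display) (Om : measurableType dO).
Variables (P : probability Om R) (s : set (set Om)).
Variables (TY : measurableType dY) (Z : measurableType dZ).
Variables (w : Om -> Z) (Y : Om -> TY) (h : TY * Z -> R) (a : Om -> R).
Local Notation Om' := (g_sigma_algebraType s).
Hypothesis ssub : forall A, <<s s >> A -> measurable A.
Hypothesis mw : measurable_fun setT w.
Hypothesis indep : forall (U : set Z) A, measurable U -> <<s s >> A ->
  P (w @^-1` U `&` A) = P (w @^-1` U) * P A.
Hypothesis mY : measurable_fun [set: Om'] (Y : Om' -> TY).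
Hypothesis ma : measurable_fun [set: Om'] (a : Om' -> R).
Hypothesis mh : measurable_fun setT h.
Hypothesis ih : P.-integrable setT (fun om => (h (Y om, w om))%:E).
Hypothesis iah : P.-integrable setT (fun om => (a om * h (Y om, w om))%:E).
Hypothesis h0 : forall B, measurable B ->
  \int[P]_(om in Y @^-1` B) (h (Y om, w om))%:E = 0.

Let preimY B : measurable B -> <<s s >> (Y @^-1` B).
Proof. by move=> mB; have := mY measurableT mB; rewrite setTI. Qed.

Let mY0 : measurable_fun setT Y.
Proof. by move=> _ B mB; rewrite setTI; apply: ssub; exact: preimY. Qed.

Let mid : measurable_fun [set: Om] (id : Om -> Om').
Proof. by move=> _ B mB; rewrite setTI; exact: ssub. Qed.

Let wX : {mfun Om >-> Z} := HB.pack w (isMeasurableFun.Build _ _ _ _ w mw).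
Let YX : {mfun Om >-> TY} := HB.pack Y (isMeasurableFun.Build _ _ _ _ Y mY0).
(** The identity into the coarser space [Om'] carries the entire past as one random variable
    independent of w. *)
Let idX : {mfun Om >-> Om'} :=
  HB.pack (id : Om -> Om') (isMeasurableFun.Build _ _ _ _ (id : Om -> Om') mid).

Let indepY A B : measurable A -> measurable B ->
  P (YX @^-1` A `&` wX @^-1` B) = P (YX @^-1` A) * P (wX @^-1` B).
Proof. by move=> mA mB; rewrite setIC muleC; apply: indep => //; exact: preimY. Qed.

Let indep_id (A : set Om') B : measurable A -> measurable B ->
  P (idX @^-1` A `&` wX @^-1` B) = P (idX @^-1` A) * P (wX @^-1` B).
Proof. by move=> mA mB; rewrite setIC muleC; exact: indep. Qed.

(** By independence, Phi (Y) is the conditional mean of h (Y, w) given the past. *)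
Let Phi y := \int[distribution P wX]_z (h (y, z))%:E.

Let iPhi : (distribution P YX).-integrable setT Phi.
Proof. exact: (product_law_integrable_l indepY mh ih). Qed.

(** For each event B, Fubini identifies the integral of Phi over B with that of h (Y, w) over the
    preimage of B, which is 0 by [h0]. *)
Let Phi_ae0 : ae_eq (distribution P YX) setT Phi (cst 0).
Proof.
apply: integral_ae_eq => // B _ mB; rewrite integral0.
pose hB (p : TY * Z) : R := (\1_B p.1 * h p)%R.
have mhB : measurable_fun setT hB.
  apply: measurable_funM => //; apply: measurableT_comp; last exact: measurable_fst.
  exact: measurable_indic.
have ihB : P.-integrable setT (EFin \o (fun om => hB (YX om, wX om))).
  apply: le_integrable ih => //.
    apply/measurable_EFinP; apply: (measurableT_comp mhB).
    exact: measurable_fun_pair.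
  move=> om _; rewrite /= lee_fin /hB normrM ler_piMl// ger0_norm ?indicE//.
  by case: (_ \in _).
have := product_law_fubini indepY mhB ihB.
have -> : \int[P]_om (hB (YX om, wX om))%:E = 0.
  rewrite -[RHS](h0 mB) [RHS]integral_mkcond; apply: eq_integral => om _.
  rewrite /hB patchE indicE/=; have [yB|yB] := boolP (Y om \in B).
    by rewrite mul1r ifT// inE; move: yB; rewrite inE.
  by rewrite mul0r ifF//; apply/negbTE; move: yB; rewrite !notin_setE.
move=> E; rewrite [RHS]E integral_mkcond; apply: eq_integral => y _.
rewrite patchE /hB/=; case: ifP => yB; rewrite indicE yB.
  by apply: eq_integral => z _; rewrite mul1r.
by rewrite integral0_eq// => z _; rewrite mul0r.
Qed.

Let pull (Q : TY -> Prop) : {ae distribution P YX, forall y, Q y} ->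
  {ae distribution P idX, forall om, Q (Y om)}.
Proof.
move=> [B [mB B0 QB]]; exists (Y @^-1` B); split => //.
  exact: preimY.
by move=> om /= nQ; exact: QB.
Qed.

(** Centering given Y is strengthened to centering against any past-measurable factor a: integrate
    out w first, with the past frozen, and what remains is a times Phi (Y), which is 0 almost
    everywhere. *)
Lemma independent_noise_orthogonal :
  \int[P]_om (a om * h (Y om, w om))%:E = 0.
Proof.
pose F (p : Om' * Z) : R := (a p.1 * h (Y p.1, p.2))%R.
have mF : measurable_fun setT F.
  apply: measurable_funM; first exact: (measurableT_comp ma measurable_fst).
  apply: (measurableT_comp mh); apply: measurable_fun_pair => //.
  exact: (measurableT_comp mY measurable_fst).
have := product_law_fubini indep_id mF iah; rewrite /= => ->.
rewrite (ae_eq_integral (cst 0)) ?integral0//.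
- exact: measurable_int (product_law_integrable_l indep_id mF iah).
- have := pull Phi_ae0; have := pull (product_law_ae_integrable indepY mh ih).
  apply: filterS2; first exact: (@ae_filter_ringOfSetsType _ Om' R (distribution P idX)).
  move=> om ihom Ph _; rewrite /F /=.
  under eq_integral do rewrite EFinM.
  rewrite integralZl//.
  by have := Ph I; rewrite /Phi/= => ->; rewrite mule0.
Qed.

End IndependentNoise.

(** * Expectations of square-integrable quantities *)

Section SquareIntegrable.
Variables (R : realType) (dO : measure_display) (Om : measurableType dO).
Variable P : probability Om R.
Implicit Types X Y : Om -> R.

Definition intg X : Prop := P.-integrable setT (EFin \o X).
Definition mean X : R := \int[P]_om X om.

Lemma intg_cst (c : R) : intg (fun=> c).
Proof. exact: (finite_measure_integrable_cst P c). Qed.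

Lemma intgD X Y : intg X -> intg Y -> intg (fun om => X om + Y om).
Proof. by move=> iX iY; exact: (integrableD measurableT iX iY). Qed.

Lemma intgZ (c : R) X : intg X -> intg (fun om => c * X om).
Proof. by move=> iX; exact: (integrableZl measurableT c iX). Qed.

Lemma intg_sum I (s : seq I) (X : I -> Om -> R) :
  (forall i, intg (X i)) -> intg (fun om => \sum_(i <- s) X i om).
Proof.
move=> iX; elim: s => [|i s IH].
  by under eq_fun do rewrite big_nil; exact: intg_cst.
by under eq_fun do rewrite big_cons; exact: intgD.
Qed.

Lemma le_intg X Y : measurable_fun setT X -> (forall om, `|X om| <= Y om) ->
  intg Y -> intg X.
Proof.
move=> mX XY iY; apply: le_integrable iY => //; first exact/measurable_EFinP.
by move=> om _ /=; rewrite lee_fin (le_trans (XY om))// ler_norm.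
Qed.

Lemma meanD X Y : intg X -> intg Y -> mean (fun om => X om + Y om) = mean X + mean Y.
Proof. by move=> iX iY; exact: RintegralD. Qed.

Lemma meanZ (c : R) X : intg X -> mean (fun om => c * X om) = c * mean X.
Proof. by move=> iX; exact: RintegralZl. Qed.

Lemma mean_cst (c : R) : mean (fun=> c) = c.
Proof. by rewrite /mean Rintegral_cst// [X in fine X](@probability_setT _ _ _ P) mulr1. Qed.

Lemma mean_sum I (s : seq I) (X : I -> Om -> R) : (forall i, intg (X i)) ->
  mean (fun om => \sum_(i <- s) X i om) = \sum_(i <- s) mean (X i).
Proof.
move=> iX; elim: s => [|i s IH].
  by rewrite big_nil -[RHS](mean_cst 0); congr mean; apply/funext => om; rewrite big_nil.
rewrite big_cons -IH -meanD//; last exact: intg_sum.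
by congr mean; apply/funext => om; rewrite big_cons.
Qed.

Lemma le_mean X Y : intg X -> intg Y -> (forall om, X om <= Y om) -> mean X <= mean Y.
Proof. by move=> iX iY XY; apply: le_Rintegral. Qed.

Lemma mean_ge0 X : (forall om, 0 <= X om) -> 0 <= mean X.
Proof. by move=> X0; apply: Rintegral_ge0. Qed.

Definition sqint X : Prop := measurable_fun setT X /\ intg (fun om => X om ^+ 2).

Lemma sqint_intgM X Y : sqint X -> sqint Y -> intg (fun om => X om * Y om).
Proof.
move=> [mX iX] [mY iY]; apply: le_intg (intgD iX iY).
  exact: measurable_funM.
move=> om /=; rewrite ler_norml; apply/andP; split.
  by have := sqr_ge0 (X om + Y om); have := sqr_ge0 (X om); have := sqr_ge0 (Y om); nra.
by have := sqr_ge0 (X om - Y om); have := sqr_ge0 (X om); have := sqr_ge0 (Y om); nra.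
Qed.

Lemma sqint_cst (c : R) : sqint (fun=> c).
Proof. by split; [exact: measurable_cst|exact: intg_cst]. Qed.

Lemma sqint_intg X : sqint X -> intg X.
Proof.
move=> sX; have := sqint_intgM (sqint_cst 1) sX.
by under eq_fun do rewrite mul1r.
Qed.

Lemma sqintD X Y : sqint X -> sqint Y -> sqint (fun om => X om + Y om).
Proof.
move=> [mX iX] [mY iY]; split; first exact: measurable_funD.
apply: le_intg (intgZ 2 (intgD iX iY)).
  by apply: measurable_funX; exact: measurable_funD.
move=> om /=; rewrite ger0_norm ?sqr_ge0//.
have := sqr_ge0 (X om - Y om); lra.
Qed.

Lemma sqintZ (c : R) X : sqint X -> sqint (fun om => c * X om).
Proof.
move=> [mX iX]; split; first exact: measurable_funM.
by under eq_fun do rewrite exprMn; exact: intgZ.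
Qed.

Lemma sqint_sum I (s : seq I) (X : I -> Om -> R) :
  (forall i, sqint (X i)) -> sqint (fun om => \sum_(i <- s) X i om).
Proof.
move=> iX; elim: s => [|i s IH].
  by under eq_fun do rewrite big_nil; exact: sqint_cst.
by under eq_fun do rewrite big_cons; exact: sqintD.
Qed.

Definition sqint_mx m n (Y : Om -> 'M[R]_(m, n)) : Prop :=
  forall i j, sqint (fun om => Y om i j).

Lemma sqint_mx_meas m n (Y : Om -> 'M[R]_(m, n)) : sqint_mx Y -> measurable_mx Y.
Proof. by move=> sY i j; exact: (sY i j).1. Qed.

Lemma sqint_mx_cst m n (c : 'M[R]_(m, n)) : sqint_mx (fun=> c).
Proof. by move=> i j; exact: sqint_cst. Qed.

Lemma sqint_mxD m n (Y Z : Om -> 'M[R]_(m, n)) :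
  sqint_mx Y -> sqint_mx Z -> sqint_mx (fun om => Y om + Z om).
Proof. by move=> sY sZ i j; under eq_fun do rewrite mxE; exact: sqintD. Qed.

Lemma sqint_mx_mul m n p (A : 'M[R]_(p, m)) (Y : Om -> 'M[R]_(m, n)) :
  sqint_mx Y -> sqint_mx (fun om => A *m Y om).
Proof.
move=> sY i j; under eq_fun do rewrite mxE.
by apply: sqint_sum => k; exact: sqintZ.
Qed.

Lemma sqint_mxZ m n (a : R) (Y : Om -> 'M[R]_(m, n)) :
  sqint_mx Y -> sqint_mx (fun om => a *: Y om).
Proof. by move=> sY i j; under eq_fun do rewrite mxE; exact: sqintZ. Qed.

Lemma sqint_mxB m n (Y Z : Om -> 'M[R]_(m, n)) :
  sqint_mx Y -> sqint_mx Z -> sqint_mx (fun om => Y om - Z om).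
Proof.
move=> sY sZ; under eq_fun do rewrite -scaleN1r.
by apply: sqint_mxD => //; exact: sqint_mxZ.
Qed.

Lemma intg_dot m n (Y Z : Om -> 'M[R]_(m, n)) :
  sqint_mx Y -> sqint_mx Z -> intg (fun om => dot (Y om) (Z om)).
Proof.
by move=> sY sZ; apply: intg_sum => i; apply: intg_sum => j; exact: sqint_intgM.
Qed.

Lemma sqint_mx_dot m n (Y : Om -> 'M[R]_(m, n)) :
  measurable_mx Y -> intg (fun om => dot (Y om) (Y om)) -> sqint_mx Y.
Proof.
move=> mY iY i j; split; first exact: mY.
apply: le_intg iY; first by apply: measurable_funX; exact: mY.
by move=> om; rewrite ger0_norm ?sqr_ge0//; exact: ler_entry_dot.
Qed.

Variables (N d : nat) (f : 'I_N -> 'rV[R]_d -> R) (mu L : R).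
Hypotheses (mu0 : 0 < mu) (L0 : 0 < L).
Hypothesis fcvx : forall i, strongly_convex mu (f i).
Hypothesis fsmooth : forall i, lipschitz_gradient L (f i).

Lemma measurable_gradF dT (T : measurableType dT) (Y : T -> 'M[R]_(N, d)) :
  measurable_mx Y -> measurable_mx (fun t => gradF f (Y t)).
Proof.
move=> mY i j; under eq_fun do rewrite mxE.
apply: (measurableT_comp (measurable_grad j (ltW L0) (fsmooth i))).
exact: measurable_row.
Qed.

Lemma measurable_sumf dT (T : measurableType dT) (Y : T -> 'M[R]_(N, d)) :
  measurable_mx Y -> measurable_fun setT (fun t => sumf f (Y t)).
Proof.
move=> mY; apply: measurable_sum => i.
apply: (measurableT_comp (measurable_differentiable (fsmooth i))).
exact: measurable_row.
Qed.

Lemma sqint_gradF (Y : Om -> 'M[R]_(N, d)) :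
  sqint_mx Y -> sqint_mx (fun om => gradF f (Y om)).
Proof.
move=> sY; apply: sqint_mx_dot; first exact/measurable_gradF/sqint_mx_meas.
apply: le_intg (intgD (intgZ (2 * L ^+ 2) (intg_dot sY sY))
  (intg_cst (2 * dot (gradF f 0) (gradF f 0)))).
  by apply: measurable_dot; exact/measurable_gradF/sqint_mx_meas.
move=> om; rewrite ger0_norm ?dot_ge0//.
have := dot_sqD (gradF f (Y om) - gradF f 0) (gradF f 0); rewrite subrK.
have := gradF_lipschitz L0 fsmooth (Y om) 0; rewrite subr0; lra.
Qed.

(** Strong convexity and smoothness at 0 enclose F between two quadratic functions. *)
Lemma intg_sumf (Y : Om -> 'M[R]_(N, d)) :
  sqint_mx Y -> intg (fun om => sumf f (Y om)).
Proof.
move=> sY; apply: le_intg (intgD (intgZ (1 + L) (intg_dot sY sY))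
  (intg_cst (`|sumf f 0| + dot (gradF f 0) (gradF f 0)))).
  exact/measurable_sumf/sqint_mx_meas.
move=> om; have l1 := sumf_strongly_convex fcvx fsmooth (Y om) 0.
have := sumf_descent L0 fsmooth (Y om) 0; move: l1; rewrite !subr0.
have := dot_young (gradF f 0) (Y om) (ltr01 : 0 < 1 :> R).
have := dot_young (- gradF f 0) (Y om) (ltr01 : 0 < 1 :> R).
rewrite dotNl dotNl dotNr opprK invr1 !mul1r.
have := ler_norm (sumf f 0); have := ler_norm (- sumf f 0); rewrite normrN.
have := dot_ge0 (Y om); have := dot_ge0 (gradF f 0).
set A := dot (Y om) _; set B := dot (gradF f 0) (gradF f 0); set D := dot _ (Y om).
set S := `|sumf f 0| => B0 A0 h1 h2 h3 h4 h5 h6.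
have := mulr_ge0 (ltW mu0) A0; have := mulr_ge0 (ltW L0) A0 => LA MA.
by rewrite ler_norml; apply/andP; split; lra.
Qed.

End SquareIntegrable.

Lemma total_lenS len t : total_len len t.+1 = (total_len len t + len t.+1)%N.
Proof. by rewrite /total_len big_nat_recr. Qed.

(** * The iterates as random variables *)

Section MeasurableRun.
Variables (R : realType) (N d : nat) (W : 'M[R]_N) (mu : R).
Variables (alpha : nat -> R) (len : nat -> nat) (x0 : 'M[R]_(N, d)).
Variables (dT : measure_display) (T : measurableType dT).
Variable ng : T -> nat -> 'M[R]_(N, d) -> 'M[R]_(N, d).
Implicit Types (t m n : nat) (x : T -> 'M[R]_(N, d)).

(** Restricted to iterations before n and stated for any space T: when T carries the past of
    iteration n, the earlier noise variables are measurable on it by construction. *)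
Let good n := forall l (Y : T -> 'M[R]_(N, d)), (l < n)%N -> measurable_mx Y ->
  measurable_mx (fun s => ng s l (Y s)).

Lemma measurable_extrapolate t (z : T -> 'M[R]_(N, d) * 'M[R]_(N, d)) :
  measurable_mx (fst \o z) -> measurable_mx (snd \o z) ->
  measurable_mx (fun s => extrapolate mu alpha t (z s)).
Proof. by move=> m1 m2; apply: measurable_mxB; exact: measurable_mxZ. Qed.

Lemma measurable_stage_run t m x : measurable_mx x -> good (total_len len t.-1 + m) ->
  measurable_mx (fun s => (stage_run W mu alpha len (ng s) t (x s) m).1) /\
  measurable_mx (fun s => (stage_run W mu alpha len (ng s) t (x s) m).2).
Proof.
move=> mx; elim: m => [//|m IH] gm; have [|m1 m2] := IH.
  by move=> l Y lm; apply: gm; rewrite addnS ltnS ltnW.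
split => //=; apply: measurable_mxB.
  by apply: measurable_mx_mul; exact: measurable_extrapolate.
apply: measurable_mxZ; apply: gm; first by rewrite addnS.
exact: measurable_extrapolate.
Qed.

Lemma measurable_stage_end t : good (total_len len t) ->
  measurable_mx (fun s => stage_end W mu alpha len (ng s) x0 t).
Proof.
elim: t => [|t IH] gt /=; first exact: measurable_mx_cst.
have mt : measurable_mx (fun s => stage_end W mu alpha len (ng s) x0 t).
  by apply: IH => l Y lt; apply: gt; rewrite total_lenS ltn_addr.
apply: (measurable_stage_run (t := t.+1) mt _).1.
by move=> l Y lt; apply: gt; rewrite total_lenS.
Qed.

Lemma measurable_state t m : good (total_len len t.-1 + m) ->
  let z s := stage_run W mu alpha len (ng s) t (stage_end W mu alpha len (ng s) x0 t.-1) m in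
  measurable_mx (fun s => (z s).1) /\ measurable_mx (fun s => (z s).2).
Proof.
move=> gm; apply: measurable_stage_run => //; apply: measurable_stage_end.
by move=> l Y lt; apply: gm; rewrite ltn_addr.
Qed.

End MeasurableRun.

Section Process.
Variables (R : realType) (N d : nat) (W : 'M[R]_N) (mu L sigma : R).
Variables (alpha : nat -> R) (len : nat -> nat) (x0 : 'M[R]_(N, d)).
Variables (f : 'I_N -> 'rV[R]_d -> R).
Hypotheses (mu0 : 0 < mu) (L0 : 0 < L).
Hypothesis fcvx : forall i, strongly_convex mu (f i).
Hypothesis fsmooth : forall i, lipschitz_gradient L (f i).
Variables (dO : measure_display) (Om : measurableType dO) (P : probability Om R).
Variables (dZ : measure_display) (Z : 'I_N -> measurableType dZ).
Variables (g : forall i : 'I_N, 'rV[R]_d -> Z i -> 'rV[R]_d).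
Variables (w : nat -> forall i : 'I_N, Om -> Z i).
Hypothesis hnoise : noise_assumptions P g w W mu alpha len x0 f sigma.
Implicit Types (t m n : nat) (om : Om).

Definition state t m om := stage_run W mu alpha len (noisy_grad g w om) t
  (stage_end W mu alpha len (noisy_grad g w om) x0 t.-1) m.
Definition eval_point t m om := extrapolate mu alpha t (state t m om).
Definition noise t m om :=
  noisy_grad g w om (total_len len t.-1 + m)%N (eval_point t m om)
  - gradF f (eval_point t m om).

Lemma measurable_noisy_grad dT (T : measurableType dT) n
    (w' : forall i, T -> Z i) (Y : T -> 'M[R]_(N, d)) :
  (forall i, measurable_fun setT (w' i)) -> measurable_mx Y ->
  measurable_mx (fun s => \matrix_(i < N) g (row i (Y s)) (w' i s)).
Proof.
have [[mg _] _ _] := hnoise => mw' mY i j; under eq_fun do rewrite mxE.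
apply: (measurableT_comp (measurable_coord_rV j)).
exact: (measurableT_comp (mg i) (measurable_fun_pair (measurable_row i mY) (mw' i))).
Qed.

Lemma measurable_past_state t m i n : n = (total_len len t.-1 + m)%N ->
  let T := g_sigma_algebraType (other_noise_events w n i) in
  measurable_mx (fun om : T => (state t m om).1) /\
  measurable_mx (fun om : T => (state t m om).2).
Proof.
move=> En T; apply: (@measurable_state R N d W mu alpha len x0 _ T
  (fun om : T => noisy_grad g w om)).
move=> l Y ln mY; apply: (@measurable_noisy_grad _ T l (fun i => w l i)) => //.
move=> j _ B mB; rewrite setTI; apply: sub_sigma_algebra.
by exists l, j, B; split => //; left; rewrite En.
Qed.

Lemma measurable_global_state t m :
  measurable_mx (fun om => (state t m om).1) /\
  measurable_mx (fun om => (state t m om).2).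
Proof.
apply: (@measurable_state R N d W mu alpha len x0 _ Om (noisy_grad g w)).
move=> l Y ln mY; apply: (@measurable_noisy_grad _ Om l (fun i => w l i)) => //.
by have [[_ mw] _ _] := hnoise.
Qed.

Lemma measurable_noise t m : measurable_mx (noise t m).
Proof.
have [m1 m2] := measurable_global_state t m.
have my : measurable_mx (eval_point t m) by exact: measurable_extrapolate.
apply: measurable_mxB; last exact: (measurable_gradF L0 fsmooth).
apply: (@measurable_noisy_grad _ Om 0%N (fun i => w (total_len len t.-1 + m)%N i)) => //.
by have [[_ mw] _ _] := hnoise.
Qed.

Lemma row_noise t m om i : row i (noise t m om) =
  g (row i (eval_point t m om)) (w (total_len len t.-1 + m)%N i om)
  - grad (f i) (row i (eval_point t m om)).
Proof. by rewrite /noise linearB/= !rowK. Qed.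

(** Conditioning on the sure event turns the conditional variance bound of each node into a bound on
    its expectation. *)
Lemma noise_variance t m : (0 < t)%N -> (m < len t)%N ->
  sqint_mx P (noise t m) /\
  mean P (fun om => dot (noise t m om) (noise t m om)) <= N%:R * sigma ^+ 2.
Proof.
move=> t0 mt; have [_ _ hub] := hnoise.
have mrow i : measurable_fun setT (fun om => dot (row i (noise t m om)) (row i (noise t m om))).
  by apply: measurable_dot => k j; under eq_fun do rewrite mxE; exact: measurable_noise.
have var i : (\int[P]_om (dot (row i (noise t m om)) (row i (noise t m om)))%:E
    <= (sigma ^+ 2)%:E)%E.
  have [_ /(_ setT measurableT)] := hub t m i t0 mt.
  rewrite preimage_setT (@probability_setT _ _ _ P) mule1.
  by under eq_integral do rewrite norm2_sqr -row_noise.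
have irow i : intg P (fun om => dot (row i (noise t m om)) (row i (noise t m om))).
  apply/integrableP; split; first exact/measurable_EFinP.
  apply: le_lt_trans (ltry (sigma ^+ 2)); apply: le_trans (var i).
  by under eq_integral do rewrite gee0_abs ?lee_fin ?dot_ge0//.
have E : (fun om => dot (noise t m om) (noise t m om)) =
    (fun om => \sum_i dot (row i (noise t m om)) (row i (noise t m om))).
  by apply/funext => om; rewrite dot_rows.
split.
  apply: sqint_mx_dot; first exact: measurable_noise.
  by rewrite E; exact: intg_sum.
rewrite E mean_sum// -[X in X%:R * _](card_ord N) mulr_natl -sumr_const.
apply: ler_sum => i _; rewrite -lee_fin /mean /Rintegral fineK; first exact: var.
exact: (integrable_fin_num measurableT (irow i)).
Qed.

(** Entry by entry, [independent_noise_orthogonal] applies with Y the node's own evaluation point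
    and a an entry of the tested direction, which may depend on every node. *)
Lemma noise_orthogonal t m (a : Om -> 'M[R]_(N, d)) : (0 < t)%N -> (m < len t)%N ->
  sqint_mx P a ->
  (forall i, measurable_mx (fun om : g_sigma_algebraType
    (other_noise_events w (total_len len t.-1 + m) i) => a om)) ->
  mean P (fun om => dot (noise t m om) (a om)) = 0.
Proof.
move=> t0 mt sa pa; have [[mg mw] hind hub] := hnoise.
set n := (total_len len t.-1 + m)%N in pa.
have [sn _] := noise_variance t0 mt.
have ent i j : mean P (fun om => a om i j * noise t m om i j) = 0.
  set s := other_noise_events w n i.
  pose Y om : borel_rV R d := row i (eval_point t m om).
  pose h (p : borel_rV R d * Z i) : R := g p.1 p.2 0 j - grad (f i) p.1 0 j.
  have hE om : noise t m om i j = h (Y om, w n i om).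
    by have := congr1 (fun M : 'rV[R]_d => M 0 j) (row_noise t m om i); rewrite /h !mxE.
  have [m1 m2] := @measurable_past_state t m i n erefl.
  have mYs : measurable_fun [set: g_sigma_algebraType s]
      (Y : g_sigma_algebraType s -> borel_rV R d).
    by apply: measurable_row; exact: measurable_extrapolate.
  have ssub A : <<s s >> A -> measurable A.
    apply: smallest_sub; first exact: sigma_algebra_measurable.
    by move=> _ [l [k [U [_ mU ->]]]]; have := mw l k measurableT U mU; rewrite setTI.
  have mh : measurable_fun setT h.
    apply: measurable_funB.
      exact: (measurableT_comp (measurable_coord_rV j) (mg i)).
    exact: (measurableT_comp (measurable_grad j (ltW L0) (fsmooth i)) measurable_fst).
  have ih : P.-integrable setT (fun om => (h (Y om, w n i om))%:E).
    by have := sqint_intg (sn i j); rewrite /intg; under eq_fun do rewrite hE.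
  have iah : P.-integrable setT (fun om => (a om i j * h (Y om, w n i om))%:E).
    by have := sqint_intgM (sa i j) (sn i j); rewrite /intg; under eq_fun do rewrite hE.
  have h0 B : measurable B -> (\int[P]_(om in Y @^-1` B) (h (Y om, w n i om))%:E = 0)%E.
    move=> mB; have [/(_ j)[ig /(_ B mB) gB] _] := hub t m i t0 mt.
    (* The true gradient is the stochastic gradient minus the noise, and both are integrable. *)
    have igr : P.-integrable setT (fun om => (grad (f i) (Y om) 0 j)%:E).
      have := intgD ig (intgZ (-1) ih); rewrite /intg; apply: eq_integrable => // om _.
      by rewrite /h /= -/n -/(Y om); congr (_%:E); ring.
    have mYB : measurable (Y @^-1` B).
      by apply: ssub; have := mYs measurableT B mB; rewrite setTI.
    under eq_integral do rewrite /h EFinB.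
    rewrite integralB//=; last 2 first.
    - by apply: integrableS ig.
    - by apply: integrableS igr.
    by rewrite gB subee// integrable_fin_num//; exact: integrableS igr.
  have := @independent_noise_orthogonal _ _ _ _ _ P s (borel_rV R d) (Z i) (w n i) Y h
    (fun om => a om i j) ssub (mw n i) (hind n i) mYs (pa i i j) mh ih iah h0.
  by rewrite /mean /Rintegral; under [in X in _ -> X]eq_integral do rewrite hE; move=> ->.
rewrite /dot mean_sum; last first.
  by move=> i; apply: intg_sum => j; exact: sqint_intgM.
rewrite big1// => i _; rewrite mean_sum; last by move=> j; exact: sqint_intgM.
by rewrite big1// => j _; rewrite -[RHS](ent i j); congr mean; apply/funext => om; rewrite mulrC.
Qed.

(** Lipschitz gradients grow at most linearly and the noise has second moments, so square
    integrability passes from iterate to iterate and from stage to stage. *)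
Lemma sqint_state t m : (0 < t)%N -> (m <= len t)%N ->
  sqint_mx P (fun om => (state t m om).1) /\ sqint_mx P (fun om => (state t m om).2).
Proof.
have run t' (x : Om -> 'M[R]_(N, d)) : (0 < t')%N ->
    (x = fun om => stage_end W mu alpha len (noisy_grad g w om) x0 t'.-1) ->
    sqint_mx P x -> forall m', (m' <= len t')%N ->
    sqint_mx P (fun om => (state t' m' om).1) /\ sqint_mx P (fun om => (state t' m' om).2).
  move=> t0 xE sx; elim=> [|m' IH] mt; first by rewrite /state/= -xE.
  have [s1 s2] := IH (ltnW mt); split => //.
  have sy : sqint_mx P (eval_point t' m').
    by apply: sqint_mxB; exact: sqint_mxZ.
  have [sn _] := noise_variance t0 mt.
  have -> : (fun om => (state t' m'.+1 om).1) = (fun om => W *m eval_point t' m' om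
      - alpha t' *: (gradF f (eval_point t' m' om) + noise t' m' om)).
    by apply/funext => om; rewrite /noise [gradF _ _ + _]addrC subrK.
  apply: sqint_mxB; first exact: sqint_mx_mul.
  by apply: sqint_mxZ; apply: sqint_mxD => //; exact: (sqint_gradF L0 fsmooth).
have send t' : sqint_mx P (fun om => stage_end W mu alpha len (noisy_grad g w om) x0 t').
  elim: t' => [|t' IH]; first exact: sqint_mx_cst.
  exact: (run t'.+1 _ isT erefl IH (len t'.+1) (leqnn _)).1.
by move=> t0 mt; exact: (run t _ t0 erefl (send t.-1) m mt).
Qed.

End Process.

(** * Recursions over the stages *)

Section Recursions.
Variable R : realType.
Implicit Types (a b : nat -> R).

Lemma exists_small_power (x e : R) : 0 <= x < 1 -> 0 < e ->
  exists n, forall m, (n <= m)%N -> x ^+ m <= e.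
Proof.
move=> /andP[x0 x1] e0.
have : x ^+ n @[n --> \oo] --> (0 : R) by apply: cvg_expr; rewrite ger0_norm.
move=> /cvgrPdist_le/(_ e e0)[n _ hn]; exists n => m /hn.
by rewrite sub0r normrN ger0_norm// exprn_ge0.
Qed.

(** The inhomogeneous term is written as (1 - rho) c so that c is the fixed point. *)
Lemma affine_recursion (rho c : R) (u : nat -> R) n : 0 <= rho -> 0 <= c ->
  (forall m, (m < n)%N -> u m.+1 <= rho * u m + (1 - rho) * c) ->
  forall m, (m <= n)%N -> u m <= rho ^+ m * u 0%N + c.
Proof.
move=> rho0 c0 hu; elim=> [|m IH] mn; first by rewrite expr0 mul1r lerDl.
apply: (le_trans (hu m mn)).
have := ler_wpM2l rho0 (IH (ltnW mn)); rewrite exprS; lra.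
Qed.

Section CoupledRecursion.
Variables (c1 c2 c3 tau de : R).
Hypotheses (hc1 : 0 < c1) (hc2 : 0 < c2) (hc3 : 0 < c3).
Hypotheses (htau : 0 < tau <= 1) (hde : 0 < de <= 4^-1).

(** Makes c1 equal to weight times tau / 4: half of the decay tau / 2 of b pays for what b sends
    into a. *)
Definition weight := 4 * c1 / tau.
Definition inflow := weight * c2 + c3.

Section OneStage.
Variables (q n B : R) (len : nat) (a b : nat -> R).
Hypotheses (q0 : 0 < q) (n0 : 0 <= n) (B0 : 0 <= B).
Hypotheses (qtau : q <= tau / 8) (qc2 : c2 * q <= tau / 8) (qde : weight * c2 * q <= de).
Hypotheses (a0 : forall m, (m <= len)%N -> 0 <= a m) (b0 : forall m, (m <= len)%N -> 0 <= b m).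
Hypothesis ha : forall m, (m < len)%N ->
  a m.+1 <= (1 - q + de * q) * a m + c1 * q * b m + c3 * q ^+ 2 * n.
Hypothesis hb : forall m, (m < len)%N ->
  b m.+1 <= (1 - tau / 2) * b m + c2 * q ^+ 4 * (n + B + a m + b m).

Let Y := q ^+ 4 * B + q * n.
Let C0 := weight.
Let u m := a m + C0 * q * b m.

Let q1 : q <= 1. Proof. by move: qtau; have [t0 t1] := andP htau => qt; lra. Qed.
Let C00 : 0 < C0. Proof. by have [t0 _] := andP htau; rewrite divr_gt0// mulr_gt0. Qed.
Let C0p : 0 <= C0. Proof. exact: ltW. Qed.
Let c1p : 0 <= c1. Proof. exact: ltW. Qed.
Let c2p : 0 <= c2. Proof. exact: ltW. Qed.
Let c3p : 0 <= c3. Proof. exact: ltW. Qed.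
Let q0p : 0 <= q. Proof. exact: ltW. Qed.
Let C0tau : C0 * tau = 4 * c1.
Proof. by have [t0 _] := andP htau; rewrite divfK// gt_eqF. Qed.
Let q3 : q ^+ 3 <= 1. Proof. by rewrite exprn_ile1// ltW. Qed.
Let Y0 : 0 <= Y. Proof. by rewrite addr_ge0// mulr_ge0// ?exprn_ge0// ltW. Qed.

(** Of the loss 2 de in the rate, one de is the loss already present in the recursion of a, and the
    other pays for what a returns to b through the weight. Y is the level of the forcing relative to
    the rate q. *)
Lemma coupled_potential m : (m <= len)%N ->
  a m + C0 * q * b m <=
  (1 - (1 - 2 * de) * q) ^+ m * (a 0%N + C0 * q * b 0%N) + 2 * inflow * Y.
Proof.
have [de0 de1] := andP hde; have [t0 t1] := andP htau.
have in0 : 0 < inflow by rewrite addr_gt0// mulr_gt0.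
have in0' := ltW in0; have de0' := ltW de0.
move=> ml; apply: (@affine_recursion (1 - (1 - 2 * de) * q) _ u len) => //.
- have h : (1 - 2 * de) * q <= 1 * 1.
    by apply: ler_pM; rewrite ?(ltW q0) ?q1//; lra.
  by move: h; lra.
- by rewrite !mulr_ge0.
move=> k kl; have ak := a0 (ltnW kl); have bk := b0 (ltnW kl).
have q4q : q ^+ 4 = q ^+ 3 * q by rewrite exprSr.
have p3 : 0 <= q ^+ 3 by rewrite exprn_ge0// ltW.
have e1 : C0 * q * (c2 * q ^+ 4) * a k <= de * q * a k.
  rewrite ler_wpM2r// q4q.
  have -> : C0 * q * (c2 * (q ^+ 3 * q)) = (C0 * c2 * q) * q ^+ 3 * q by ring.
  apply: ler_wpM2r => //; apply: le_trans qde; rewrite ler_piMr//.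
  by apply: mulr_ge0 => //; exact: mulr_ge0.
have e2 : c1 * q * b k + C0 * q * ((1 - tau / 2) * b k) + C0 * q * (c2 * q ^+ 4) * b k
    <= C0 * q * ((1 - q) * b k).
  have -> : c1 = C0 * tau / 4 by rewrite C0tau; field.
  have -> : C0 * tau / 4 * q * b k + C0 * q * ((1 - tau / 2) * b k) +
    C0 * q * (c2 * q ^+ 4) * b k = C0 * q * ((1 - tau / 4 + c2 * q ^+ 4) * b k) by field.
  apply: ler_wpM2l; first exact: mulr_ge0.
  apply: ler_wpM2r => //.
  have : c2 * q ^+ 4 <= c2 * q.
    by rewrite ler_pM2l// q4q ler_piMl// ltW.
  by move: qtau qc2; lra.
have e3 : C0 * q * (c2 * q ^+ 4) * n + c3 * q ^+ 2 * n <= inflow * q * (q * n).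
  have -> : inflow * q * (q * n) = (C0 * c2 * (q * q) + c3 * q ^+ 2) * n.
    by rewrite /inflow -/C0; ring.
  rewrite -mulrDl ler_wpM2r// lerD2r q4q.
  have -> : C0 * q * (c2 * (q ^+ 3 * q)) = (C0 * c2 * (q * q)) * q ^+ 3 by ring.
  by rewrite ler_piMr//; apply: mulr_ge0; apply: mulr_ge0.
have e4 : C0 * q * (c2 * q ^+ 4) * B <= inflow * q * (q ^+ 4 * B).
  have -> : inflow * q * (q ^+ 4 * B) =
     C0 * q * (c2 * q ^+ 4) * B + c3 * q * (q ^+ 4 * B) by rewrite /inflow -/C0; ring.
  by rewrite lerDl !mulr_ge0// ?exprn_ge0.
(* As de <= 1/4, the net rate is at least q / 2, whence the factor 2 in front of [inflow]. *)
have e5 : inflow * q * Y <= (1 - 2 * de) * q * (2 * inflow * Y).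
  have -> : (1 - 2 * de) * q * (2 * inflow * Y) =
    inflow * q * Y + (1 - 4 * de) * (inflow * q * Y) by ring.
  rewrite lerDl mulr_ge0//; first lra.
  by rewrite !mulr_ge0.
have e6 : C0 * q * b k.+1 <= C0 * q * ((1 - tau / 2) * b k)
    + C0 * q * (c2 * q ^+ 4) * (n + B + a k + b k).
  have Cq : 0 <= C0 * q by exact: mulr_ge0.
  have := ler_wpM2l Cq (hb kl); lra.
have e7 : 0 <= de * q * (C0 * q * b k).
  by apply: mulr_ge0; apply: mulr_ge0 => //; exact: mulr_ge0.
have := ha kl; rewrite /u /Y in e5 *; lra.
Qed.

(** The potential controls only q b. Once a is known to be at most M, it is a mere forcing term and
    b contracts at its own rate, free of q. *)
Lemma coupled_second M m : (forall m, (m <= len)%N -> a m <= M) -> (m <= len)%N ->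
  b m <= (1 - tau / 4) ^+ m * b 0%N + 4 * c2 / tau * (Y + M).
Proof.
have [t0 t1] := andP htau => aM ml; have t0' := ltW t0.
have M0 : 0 <= M := le_trans (a0 (leq0n len)) (aM _ (leq0n len)).
apply: (@affine_recursion (1 - tau / 4) _ b len) => //.
- by lra.
- apply: mulr_ge0; last exact: addr_ge0.
  by apply: divr_ge0 => //; exact: mulr_ge0.
move=> k kl; have ak := a0 (ltnW kl); have bk := b0 (ltnW kl).
apply: (le_trans (hb kl)).
have -> : (1 - (1 - tau / 4)) * (4 * c2 / tau * (Y + M)) = c2 * (Y + M).
  by field; rewrite gt_eqF.
have p3 : 0 <= q ^+ 3 by rewrite exprn_ge0// ltW.
have q4q : q ^+ 4 <= q by rewrite exprSr ler_piMl// ltW.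
have e1 : c2 * q ^+ 4 * b k <= tau / 4 * b k.
  rewrite ler_wpM2r//; have : c2 * q ^+ 4 <= c2 * q by rewrite ler_pM2l.
  by move: qc2; lra.
have e2 : c2 * (q ^+ 4 * n) <= c2 * (q * n) by rewrite ler_pM2l// ler_wpM2r.
have e3 : c2 * (q ^+ 4 * a k) <= c2 * M.
  rewrite ler_pM2l//; apply: le_trans (aM k (ltnW kl)).
  by rewrite ler_piMl// (le_trans q4q).
rewrite /Y; lra.
Qed.

End OneStage.
End CoupledRecursion.

Section Multistage.
Variables (c1 c2 c3 tau p ell : R).
Hypotheses (hc1 : 0 < c1) (hc2 : 0 < c2) (hc3 : 0 < c3) (htau : 0 < tau <= 1).
Hypotheses (hp : 7 <= p) (hell : 0 < ell <= 1).

Definition rate : R := expR (- ((p - 2) * ln 2)).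
(* X, n and B stand for the initial error, the noise variance and C_1^2. *)
Definition error_scale (X n B : R) t : R :=
  rate ^+ t * X + (((2^-1) ^+ t) ^+ 4 * B + (2^-1) ^+ t * n).
Definition halving_step t : R := ell * (2^-1) ^+ t.

(** Since (1 - 2 de) p = p - 1, a stage contracts by 2^(-(p-1)), which is [rate] / 2; the restart
    gives back the factor 2. *)
Let de := (2 * p)^-1.

Let hde : 0 < de <= 4^-1.
Proof.
have p2 : 4 <= 2 * p by move: hp; lra.
have p0 : 0 < 2 * p by move: p2; lra.
by rewrite /de invr_gt0 p0 lef_pV2 ?posrE.
Qed.

Lemma rate_gt0 : 0 < rate. Proof. exact: expR_gt0. Qed.

Lemma rate_le : rate <= 32^-1.
Proof.
have ln20 : 0 < ln 2 :> R by rewrite ln_gt0// ltr1n.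
have -> : 32^-1 = expR (- (5 * ln 2)) :> R.
  rewrite expRN expRM_natl lnK ?posrE//; congr (_^-1); ring.
rewrite /rate ler_expR lerN2; apply: ler_wpM2r; first exact: ltW.
by move: hp; lra.
Qed.

Lemma error_scale_ge0 X n B t : 0 <= X -> 0 <= n -> 0 <= B -> 0 <= error_scale X n B t.
Proof.
move=> X0 n0 B0; have r0 := rate_gt0; rewrite /error_scale.
by rewrite !addr_ge0// mulr_ge0// ?exprn_ge0// ?ltW.
Qed.

Lemma stage_contraction len t : p * ln 2 <= len%:R * halving_step t ->
  halving_step t <= 1 ->
  (1 - (1 - 2 * de) * halving_step t) ^+ len <= rate / 2.
Proof.
move=> hlen q1; have [e0 [l0 l1]] := (andP hde, andP hell).
set q := halving_step t in hlen q1 *.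
have q0 : 0 < q by rewrite mulr_gt0// exprn_gt0// invr_gt0.
have d1 : 0 <= 1 - 2 * de by move: hde; lra.
have h : (1 - 2 * de) * q <= 1 * 1.
  by apply: ler_pM => //; [exact: ltW|move: hde; lra].
apply: (@le_trans _ _ (expR (- ((1 - 2 * de) * q)) ^+ len)).
  apply: lerXn2r; rewrite ?nnegrE ?expR_ge0//; first by lra.
  by have := expR_ge1Dx (- ((1 - 2 * de) * q)).
have -> : rate / 2 = expR (- ((1 - 2 * de) * (p * ln 2))).
  have -> : (1 - 2 * de) * (p * ln 2) = (p - 2) * ln 2 + ln 2.
    by rewrite /de; field; rewrite gt_eqF//; move: hp; lra.
  by rewrite opprD expRD (expRN (ln 2)) lnK ?posrE.
rewrite -expRM_natl ler_expR mulrN lerN2.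
have := ler_wpM2l d1 hlen; lra.
Qed.

(** T0 depends on the coefficients, p, ell and e, and K in addition on K0; both precede the
    sequences and X, n, B, which makes the final constant uniform in the data. The caller uses e to
    impose q <= mu / L. *)
Lemma multistage (e : R) : 0 < e ->
  exists2 T0, (2 <= T0)%N & (forall t, (T0 <= t)%N -> halving_step t <= e) /\
  forall K0 : R, 0 <= K0 -> exists2 K : R, 0 <= K &
  forall (len : nat -> nat) (a b : nat -> nat -> R) (X n B : R),
  0 <= X -> 0 <= n -> 0 <= B ->
  (forall t, (T0 <= t)%N ->
    p * ln 2 <= (len t)%:R * halving_step t /\ (2 ^ t <= len t)%N) ->
  (forall t m, (T0 <= t)%N -> (m <= len t)%N -> 0 <= a t m /\ 0 <= b t m) ->
  (forall t m, (T0 <= t)%N -> (m < len t)%N ->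
    a t m.+1 <= (1 - halving_step t + de * halving_step t) * a t m
      + c1 * halving_step t * b t m + c3 * halving_step t ^+ 2 * n) ->
  (forall t m, (T0 <= t)%N -> (m < len t)%N ->
    b t m.+1 <= (1 - tau / 2) * b t m
      + c2 * halving_step t ^+ 4 * (n + B + a t m + b t m)) ->
  (forall t, (T0 <= t)%N ->
    a t.+1 0%N <= 2 * a t (len t) /\ b t.+1 0%N <= b t (len t)) ->
  a T0 0%N <= K0 * error_scale X n B T0 ->
  b T0 0%N <= K0 * error_scale X n B T0 ->
  forall t m, (T0 <= t)%N -> (m <= len t)%N ->
  a t m <= K * error_scale X n B t /\ b t m <= K * error_scale X n B t.
Proof.
move=> epos; have [e0 e1] := andP hde; have [l0 l1] := andP hell; have [t0 t1] := andP htau.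
have w0 : 0 < weight c1 tau by rewrite divr_gt0// mulr_gt0.
have in0 : 0 < inflow c1 c2 c3 tau by rewrite addr_gt0// mulr_gt0.
have r0 := rate_gt0; have r1 := rate_le.
pose eps := Num.min (Num.min (tau / 8) (tau / 8 / c2)) (Num.min (de / (weight c1 tau * c2)) (Num.min ell e)).
have eps0 : 0 < eps.
  by rewrite !lt_min l0 epos !divr_gt0//= mulr_gt0.
have half01 : 0 <= (2^-1 : R) < 1 by rewrite invr_ge0 ler0n invf_lt1// ltr1n.
have [n1 hn1] := exists_small_power half01 eps0.
have tau01 : 0 <= 1 - tau / 4 < 1 by apply/andP; split; lra.
have r2 : 0 < rate / 2 by rewrite divr_gt0.
have [n2 hn2] := exists_small_power tau01 r2.
(* n1 makes q small; n2 makes every stage, of length at least 2^t, long enough for (1 - tau/4)^len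
   <= rate / 2; 2 excludes the first stage. *)
pose T0 := (n1 + n2 + 2)%N.
have small t : (T0 <= t)%N -> halving_step t <= eps.
  move=> Tt; apply: (@le_trans _ _ (1 * (2^-1) ^+ t)).
    by rewrite ler_wpM2r// exprn_ge0// invr_ge0.
  by rewrite mul1r hn1// (leq_trans _ Tt)// /T0 -addnA leq_addr.
have q0 t : 0 < halving_step t by rewrite mulr_gt0// exprn_gt0// invr_gt0.
exists T0; first by rewrite /T0 addn2.
split; first by move=> t Tt; apply: (le_trans (small t Tt)); rewrite /eps !ge_min lexx !orbT.
move=> K0 hK0.
pose I0 := inflow c1 c2 c3 tau.
(* A stage adds 2 I0 Y to the potential, doubled at the restart; the slack Y / 32 of SS' must cover
   4 I0 Y, hence 128. *)
pose A := K0 * (1 + weight c1 tau) + 128 * I0.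
pose c5 := 4 * c2 / tau * (1 + A + 2 * I0).
(* Makes c5 <= rate / 2 times A', so that the old deviation and the new forcing each use half of
   rate times A'. *)
pose A' := K0 + 2 * c5 / rate.
have wp := ltW w0; have ip : 0 <= I0 := ltW in0; have rp := ltW r0.
have A0 : 0 <= A by rewrite addr_ge0// mulr_ge0// addr_ge0.
have c2t : 0 <= 4 * c2 / tau by rewrite divr_ge0 ?(ltW t0)// mulr_ge0// ltW.
have c50 : 0 <= c5.
  apply: mulr_ge0 => //; apply: addr_ge0; first exact: addr_ge0.
  exact: mulr_ge0.
have A'0 : 0 <= A' by rewrite addr_ge0// divr_ge0// mulr_ge0.
exists (A + 2 * I0 + A' + c5).
  by do 3?[apply: addr_ge0 => //]; exact: mulr_ge0.
move=> len a b X n B X0 n0 B0 hlen ab0 ha hb restart sa sb.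
pose S t := error_scale X n B t.
pose Y t := ((2^-1) ^+ t) ^+ 4 * B + (2^-1) ^+ t * n.
have S0 t : 0 <= S t by exact: error_scale_ge0.
have h0 t : 0 < (2^-1) ^+ t :> R by rewrite exprn_gt0// invr_gt0.
have Y0 t : 0 <= Y t.
  by apply: addr_ge0; apply: mulr_ge0 => //; rewrite ?exprn_ge0// ltW.
have YS t : Y t <= S t.
  by rewrite /S /error_scale lerDr mulr_ge0// exprn_ge0.
have qY t : halving_step t ^+ 4 * B + halving_step t * n <= Y t.
  have qh : halving_step t <= (2^-1) ^+ t by rewrite ler_piMl// ltW.
  apply: lerD; apply: ler_wpM2r => //.
  by apply: lerXn2r; rewrite ?nnegrE// ltW.
have SS t : rate * S t <= S t.+1.
  rewrite /S /error_scale !exprS exprMn.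
  have h4 : 0 <= ((2^-1) ^+ t) ^+ 4 * B by rewrite mulr_ge0// exprn_ge0// ltW.
  have h1 : 0 <= (2^-1) ^+ t * n by rewrite mulr_ge0// ltW.
  have := ler_wpM2r h4 r1; have := ler_wpM2r h1 r1; lra.
have stage t : (T0 <= t)%N -> forall m, (m <= len t)%N ->
    a t m + weight c1 tau * halving_step t * b t m <=
    (1 - (1 - 2 * de) * halving_step t) ^+ m *
    (a t 0%N + weight c1 tau * halving_step t * b t 0%N) + 2 * I0 * Y t.
  move=> Tt m ml; have sm := small t Tt.
  have hs := le_trans sm _.
  apply: le_trans (@coupled_potential c1 c2 c3 tau de hc1 hc2 hc3 htau hde
    (halving_step t) n B (len t) (a t) (b t) (q0 t) n0 B0 _ _ _ _ _ _ _ m ml) _.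
  - by apply: hs; rewrite /eps !ge_min lexx.
  - by rewrite mulrC -ler_pdivlMr//; apply: hs; rewrite /eps !ge_min lexx !orbT.
  - by rewrite mulrC -ler_pdivlMr; [apply: hs; rewrite /eps !ge_min lexx !orbT|exact: mulr_gt0].
  - by move=> k kl; exact: (ab0 t k Tt kl).1.
  - by move=> k kl; exact: (ab0 t k Tt kl).2.
  - by move=> k kl; exact: ha.
  - by move=> k kl; exact: hb.
  by rewrite lerD2l ler_wpM2l// mulr_ge0.
(* The B part shrinks by 1/16 and the n part by 1/2, whereas rate <= 1/32: the surplus is at least Y
   / 32. *)
have SS' t : rate * S t + Y t / 32 <= S t.+1.
  rewrite /S /Y /error_scale !exprS exprMn.
  have h4 : 0 <= ((2^-1) ^+ t) ^+ 4 * B by rewrite mulr_ge0// exprn_ge0// ltW.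
  have h1 : 0 <= (2^-1) ^+ t * n by rewrite mulr_ge0// ltW.
  have := ler_wpM2r h4 r1; have := ler_wpM2r h1 r1; lra.
have hb0 t m : (T0 <= t)%N -> (m <= len t)%N ->
    0 <= weight c1 tau * halving_step t * b t m.
  by move=> Tt ml; rewrite mulr_ge0 ?(ab0 t m Tt ml).2// mulr_ge0// ltW.
have q1 t : (T0 <= t)%N -> halving_step t <= 1.
  by move=> Tt; apply: (le_trans (small t Tt)); rewrite !ge_min l1 !orbT.
have ustart t : (T0 <= t)%N ->
    a t 0%N + weight c1 tau * halving_step t * b t 0%N <= A * S t.
  elim: t => [|t IH]; first by rewrite leqn0 /T0 addn2.
  rewrite leq_eqVlt ltnS => /orP[/eqP <-|Tt].
    have := ler_wpM2l (mulr_ge0 wp (ltW (q0 T0))) sb.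
    have : weight c1 tau * halving_step T0 * (K0 * S T0) <= weight c1 tau * (K0 * S T0).
      by rewrite ler_wpM2r ?mulr_ge0// ler_piMr// q1.
    have := mulr_ge0 ip (S0 T0); rewrite -/(S T0) /A.
    move: sa; rewrite -/(S T0); lra.
  have [ra rb] := restart t Tt; have st := stage t Tt (len t) (leqnn _).
  have bend := hb0 t (len t) Tt (leqnn _).
  have hS : halving_step t.+1 = halving_step t / 2.
    by rewrite /halving_step exprS; ring.
  have rb' : weight c1 tau * halving_step t.+1 * b t.+1 0%N <=
      weight c1 tau * halving_step t * b t (len t).
    apply: (@le_trans _ _ (weight c1 tau * halving_step t.+1 * b t (len t))).
      by rewrite ler_wpM2l// mulr_ge0// ltW.
    by rewrite hS; move: bend; lra.
  have u0 : 0 <= a t 0%N + weight c1 tau * halving_step t * b t 0%N.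
    by rewrite addr_ge0 ?hb0//; exact: (ab0 t 0%N Tt _).1.
  have ct := ler_wpM2r u0 (stage_contraction (hlen t Tt).1 (q1 t Tt)).
  have := ler_wpM2l rp (IH Tt); have := ler_wpM2l A0 (SS' t).
  have AI : 128 * I0 * Y t <= A * Y t.
    by rewrite ler_wpM2r// /A lerDr mulr_ge0// addr_ge0.
  lra.
have amax t m : (T0 <= t)%N -> (m <= len t)%N -> a t m <= (A + 2 * I0) * S t.
  move=> Tt ml; have st := stage t Tt m ml; have bm := hb0 t m Tt ml.
  have u0 : 0 <= a t 0%N + weight c1 tau * halving_step t * b t 0%N.
    by rewrite addr_ge0 ?hb0//; exact: (ab0 t 0%N Tt _).1.
  have rho01 : (1 - (1 - 2 * de) * halving_step t) ^+ m <= 1.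
    have d1 : 0 <= 1 - 2 * de by lra.
    have h : (1 - 2 * de) * halving_step t <= 1 * 1.
      by apply: ler_pM; rewrite ?q1// ?(ltW (q0 t))//; lra.
    by apply: exprn_ile1; [lra|rewrite gerBl mulr_ge0// ltW].
  have := ler_wpM2r u0 rho01; have := ustart t Tt.
  have := ler_wpM2l ip (YS t); lra.
have bstep t m : (T0 <= t)%N -> (m <= len t)%N ->
    b t m <= (1 - tau / 4) ^+ m * b t 0%N + c5 * S t.
  move=> Tt ml; have sm := small t Tt; have hs := le_trans sm _.
  have qt : halving_step t <= tau / 8 by apply: hs; rewrite /eps !ge_min lexx.
  have qc : c2 * halving_step t <= tau / 8.
    by rewrite mulrC -ler_pdivlMr//; apply: hs; rewrite /eps !ge_min lexx !orbT.
  have := coupled_second hc2 htau (q0 t) n0 B0 qt qc (fun k kl => (ab0 t k Tt kl).1)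
    (fun k kl => (ab0 t k Tt kl).2) (fun k kl => hb t k Tt kl)
    (fun k kl => amax t k Tt kl) ml.
  move=> /le_trans; apply; rewrite lerD2l.
  have -> : c5 * S t = 4 * c2 / tau * ((1 + A + 2 * I0) * S t) by rewrite mulrA.
  apply: ler_wpM2l => //; have := qY t; have := YS t; lra.
have cle : rate / 2 * A' >= c5.
  have -> : rate / 2 * A' = rate / 2 * K0 + c5 by rewrite /A'; field; rewrite gt_eqF.
  by rewrite lerDr mulr_ge0// ltW.
have bstart t : (T0 <= t)%N -> b t 0%N <= A' * S t.
  elim: t => [|t IH]; first by rewrite leqn0 /T0 addn2.
  rewrite leq_eqVlt ltnS => /orP[/eqP <-|Tt].
    apply: (le_trans sb); rewrite ler_wpM2r ?S0// /A' lerDl divr_ge0// mulr_ge0//.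
  have [_ rb] := restart t Tt; apply: (le_trans rb).
  apply: (le_trans (bstep t (len t) Tt (leqnn _))).
  have tn : (n2 <= len t)%N.
    apply: leq_trans (hlen t Tt).2; apply: leq_trans (ltnW (ltn_expl t _)) => //.
    by rewrite (leq_trans _ Tt)// /T0 addnAC leq_addl.
  have bt0 := (ab0 t 0%N Tt (leq0n _)).2.
  have := ler_wpM2r bt0 (hn2 _ tn).
  have := ler_wpM2l (ltW r2) (IH Tt); have := ler_wpM2l A'0 (SS t).
  have := ler_wpM2r (S0 t) cle; lra.
move=> t m Tt ml; rewrite -/(S t); have St := S0 t.
have i2 : 0 <= 2 * I0 by exact: mulr_ge0.
have g1 := mulr_ge0 A0 St; have g2 := mulr_ge0 i2 St.
have g3 := mulr_ge0 A'0 St; have g4 := mulr_ge0 c50 St.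
have am := amax t m Tt ml; have bm := bstep t m Tt ml.
have b00 := (ab0 t 0%N Tt (leq0n _)).2.
have tm : (1 - tau / 4) ^+ m * b t 0%N <= A' * S t.
  apply: le_trans (bstart t Tt); rewrite ler_piMl// exprn_ile1//; lra.
by split; lra.
Qed.

End Multistage.
End Recursions.

(** * Expected decrease along D-MASG *)

Section ExpectedDecrease.
Variables (R : realType) (N d : nat) (W : 'M[R]_N).
Hypotheses (N0 : (0 < N)%N) (Wsym : W^T = W).
Hypothesis Wrow : forall i, \sum_(j < N) W i j = 1.
Variables (lmin th : R).
Hypothesis lmin0 : 0 <= lmin.
Hypothesis Wmin : forall x : 'M[R]_(N, d), lmin * dot x x <= dot x (W *m x).
Hypothesis Wdir : forall x : 'M[R]_(N, d), 0 <= dirichlet W x.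
Hypothesis th01 : 0 <= th < 1.
Hypothesis Wgap : forall x : 'M[R]_(N, d),
  avg R N *m x = 0 -> dot x (W *m x) <= th * dot x x.
Variables (f : 'I_N -> 'rV[R]_d -> R) (mu L sigma : R) (xs : 'rV[R]_d).
Hypotheses (mu0 : 0 < mu) (L0 : 0 < L).
Hypothesis fcvx : forall i, strongly_convex mu (f i).
Hypothesis fsmooth : forall i, lipschitz_gradient L (f i).
Hypothesis xsmin : minimizer (average f) xs.
Variables (alpha : nat -> R) (len : nat -> nat) (x0 : 'M[R]_(N, d)).
Variables (dO : measure_display) (Om : measurableType dO) (P : probability Om R).
Variables (dZ : measure_display) (Z : 'I_N -> measurableType dZ).
Variables (g : forall i : 'I_N, 'rV[R]_d -> Z i -> 'rV[R]_d).
Variables (w : nat -> forall i : 'I_N, Om -> Z i).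
Hypothesis hnoise : noise_assumptions P g w W mu alpha len x0 f sigma.

Local Notation X := (stack N xs).
Local Notation J := (avg R N).
Local Notation st := (state W mu alpha len x0 g w).
Local Notation xi := (noise W mu alpha len x0 f g w).
Local Notation n2 := (N%:R * sigma ^+ 2).
Local Notation B2 := (dot (gradF f X) (gradF f X)).

Let Wpsd (x : 'M[R]_(N, d)) : 0 <= dot x (W *m x).
Proof. by apply: le_trans (Wmin x); rewrite mulr_ge0// dot_ge0. Qed.

Section Measurability.
Variables (dT : measure_display) (T : measurableType dT) (q : R).
Variables (x v : T -> 'M[R]_(N, d)).
Hypotheses (mx : measurable_mx x) (mv : measurable_mx v).

Let mlook : measurable_mx (fun s => lookahead q (x s) (v s)).
Proof. by apply: measurable_mxB; exact: measurable_mxZ. Qed.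

Let mmom : measurable_mx (fun s => momentum q (x s) (v s)).
Proof. by apply: measurable_mxD => //; apply: measurable_mxZ; exact: measurable_mxB. Qed.

Lemma measurable_noise_dir : measurable_mx (fun s => noise_dir f mu xs q (x s) (v s)).
Proof.
apply: measurable_mxB; apply: measurable_mxZ.
  by apply: measurable_mx_mul; apply: (measurable_gradF L0 fsmooth); exact: measurable_mx_mul.
apply: measurable_mxD; apply: measurable_mxZ; apply: measurable_mxB.
- exact: measurable_mx_mul.
- exact: measurable_mx_cst.
- exact: measurable_mx_mul.
- exact: measurable_mx_cst.
Qed.

Lemma measurable_pen_noise_dir :
  measurable_mx (fun s => pen_noise_dir W f mu xs q (x s) (v s)).
Proof.
apply: measurable_mxB; apply: measurable_mxZ.
  apply: measurable_mxD; first exact: (measurable_gradF L0 fsmooth).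
  by apply: measurable_mxZ; apply: measurable_mxB => //; exact: measurable_mx_mul.
apply: measurable_mxD; apply: measurable_mxZ; apply: measurable_mxB => //;
exact: measurable_mx_cst.
Qed.

End Measurability.

Section Integrability.
Variables (q : R) (x v : Om -> 'M[R]_(N, d)).
Hypotheses (sx : sqint_mx P x) (sv : sqint_mx P v).

Let slook : sqint_mx P (fun om => lookahead q (x om) (v om)).
Proof. by apply: sqint_mxB; exact: sqint_mxZ. Qed.

Let smom : sqint_mx P (fun om => momentum q (x om) (v om)).
Proof. by apply: sqint_mxD => //; apply: sqint_mxZ; exact: sqint_mxB. Qed.

Lemma sqint_noise_dir : sqint_mx P (fun om => noise_dir f mu xs q (x om) (v om)).
Proof.
apply: sqint_mxB; apply: sqint_mxZ.
  by apply: sqint_mx_mul; apply: (sqint_gradF L0 fsmooth); exact: sqint_mx_mul.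
apply: sqint_mxD; apply: sqint_mxZ; apply: sqint_mxB.
- exact: sqint_mx_mul.
- exact: sqint_mx_cst.
- exact: sqint_mx_mul.
- exact: sqint_mx_cst.
Qed.

Lemma sqint_pen_noise_dir :
  sqint_mx P (fun om => pen_noise_dir W f mu xs q (x om) (v om)).
Proof.
apply: sqint_mxB; apply: sqint_mxZ.
  apply: sqint_mxD; first exact: (sqint_gradF L0 fsmooth).
  by apply: sqint_mxZ; apply: sqint_mxB => //; exact: sqint_mx_mul.
apply: sqint_mxD; apply: sqint_mxZ; apply: sqint_mxB => //;
exact: sqint_mx_cst.
Qed.

Lemma intg_dist : intg P (fun om => dot (x om - X) (x om - X)).
Proof. by apply: intg_dot; apply: sqint_mxB => //; exact: sqint_mx_cst. Qed.

Lemma intg_energy : intg P (fun om => energy f mu xs q (x om) (v om)).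
Proof.
apply: intgD.
  apply: (@intgD _ _ _ _ _ (fun=> - sumf f X)); last exact: intg_cst.
  by apply: (intg_sumf mu0 L0 fcvx fsmooth); exact: sqint_mx_mul.
by apply: intgZ; apply: intg_dot; apply: sqint_mxB;
  [exact: sqint_mx_mul|exact: sqint_mx_cst|exact: sqint_mx_mul|exact: sqint_mx_cst].
Qed.

Let sdev (y : Om -> 'M[R]_(N, d)) : sqint_mx P y -> sqint_mx P (fun om => dev (y om)).
Proof. by move=> sy; apply: sqint_mxB => //; exact: sqint_mx_mul. Qed.

Let intg_dirichlet (y : Om -> 'M[R]_(N, d)) : sqint_mx P y ->
  intg P (fun om => dirichlet W (y om)).
Proof.
move=> sy; apply: (@intgD _ _ _ _ _ (fun om => - dot (y om) (W *m y om))).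
  exact: intg_dot.
under eq_fun do rewrite -mulN1r.
by apply: intgZ; apply: intg_dot => //; exact: sqint_mx_mul.
Qed.

Lemma intg_disagreement : intg P (fun om => disagreement W th (x om) (v om)).
Proof.
have sdx := sdev sx; have sdv := sdev sv.
apply: intgD; first apply: intgD.
- by under eq_fun do rewrite mulrC; apply: intgZ; exact: intg_dirichlet.
- by apply: intgZ; exact: intg_dot.
- by apply: intgZ; apply: intg_dot; exact: sqint_mxB.
Qed.

Lemma intg_pen_energy : intg P (fun om => pen_energy W f mu xs q (x om) (v om)).
Proof.
apply: intgD.
  apply: (@intgD _ _ _ _ _ (fun=> - penalized W f mu q X)); last exact: intg_cst.
  apply: intgD; first exact: (intg_sumf mu0 L0 fcvx fsmooth).
  by apply: intgZ; exact: intg_dirichlet.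
by apply: intgZ; apply: intg_dot; apply: sqint_mxB => //; exact: sqint_mx_cst.
Qed.

End Integrability.

Lemma mean_le4 (c1 c2 c3 e : R) (Y Y1 Y2 Y3 Y4 : Om -> R) : mean P Y4 = e ->
  intg P Y -> intg P Y1 -> intg P Y2 -> intg P Y3 -> intg P Y4 ->
  (forall om, Y om <= c1 * Y1 om + c2 * Y2 om + c3 * Y3 om + Y4 om) ->
  mean P Y <= c1 * mean P Y1 + c2 * mean P Y2 + c3 * mean P Y3 + e.
Proof.
move=> <- iY i1 i2 i3 i4 H.
have j1 := intgZ c1 i1; have j2 := intgZ c2 i2; have j3 := intgZ c3 i3.
have j12 := intgD j1 j2; have j123 := intgD j12 j3.
by apply: (le_trans (le_mean iY (intgD j123 i4) H)); rewrite !meanD// !meanZ.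
Qed.

Section OneStage.
Variables (t : nat) (q : R).
Hypotheses (t0 : (0 < t)%N) (q01 : 0 < q < 1) (qalpha : q ^+ 2 / mu = alpha t).

Lemma eval_pointE m om : eval_point W mu alpha len x0 g w t m om =
  lookahead q (st t m om).1 (st t m om).2.
Proof.
have [q0 q1] := andP q01.
have qE : Num.sqrt (mu * alpha t) = q.
  rewrite -qalpha mulrC divfK ?gt_eqF// sqrtr_sqr ger0_norm// ltW//.
by rewrite /eval_point /extrapolate /beta qE.
Qed.

Lemma stateS m om : st t m.+1 om =
  (dasg_step W f mu q (st t m om).1 (st t m om).2 (xi t m om), (st t m om).1).
Proof.
rewrite /dasg_step -eval_pointE qalpha /noise [gradF _ _ + _]addrC subrK.
by [].
Qed.

Variable m : nat.
Hypothesis mt : (m < len t)%N.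

Let s1 := (sqint_state L0 fsmooth hnoise t0 (ltnW mt)).1.
Let s2 := (sqint_state L0 fsmooth hnoise t0 (ltnW mt)).2.
Let s1' := (sqint_state L0 fsmooth hnoise t0 mt).1.
Let s2' := (sqint_state L0 fsmooth hnoise t0 mt).2.

Definition mean_energy k := mean P (fun om => energy f mu xs q (st t k om).1 (st t k om).2).
Definition mean_disagreement k :=
  mean P (fun om => disagreement W th (st t k om).1 (st t k om).2).
Definition mean_pen k := mean P (fun om => pen_energy W f mu xs q (st t k om).1 (st t k om).2).

Lemma mean_energy_step de : 0 < de -> q <= mu / L ->
  mean_energy m.+1 <= (1 - q + de * q) * mean_energy m
    + (2 / (mu * de) + 2 / mu) * L ^+ 2 * (4 / gap th) * q * mean_disagreement m
    + 2 * (q ^+ 2 / mu) * n2.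
Proof.
move=> de0 qL; have [sn vn] := noise_variance L0 fsmooth hnoise t0 mt.
have orth : mean P (fun om => dot (xi t m om)
    (noise_dir f mu xs q (st t m om).1 (st t m om).2)) = 0.
  apply: (noise_orthogonal L0 fsmooth hnoise) => //; first exact: sqint_noise_dir.
  move=> i; have [m1 m2] := measurable_past_state hnoise i (erefl (total_len len t.-1 + m)%N).
  exact: measurable_noise_dir.
have path om : energy f mu xs q (st t m.+1 om).1 (st t m.+1 om).2 <=
    (1 - q + de * q) * energy f mu xs q (st t m om).1 (st t m om).2
    + (2 / (mu * de) + 2 / mu) * L ^+ 2 * (4 / gap th) * q *
      disagreement W th (st t m om).1 (st t m om).2
    + 2 * (q ^+ 2 / mu) * dot (xi t m om) (xi t m om)
    + dot (xi t m om) (noise_dir f mu xs q (st t m om).1 (st t m om).2).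
  by rewrite stateS; exact: dasg_energy_step.
have H : mean_energy m.+1 <= (1 - q + de * q) * mean_energy m
    + (2 / (mu * de) + 2 / mu) * L ^+ 2 * (4 / gap th) * q * mean_disagreement m
    + 2 * (q ^+ 2 / mu) * mean P (fun om => dot (xi t m om) (xi t m om)) + 0.
  exact: (mean_le4 orth (intg_energy q s1' s2') (intg_energy q s1 s2)
    (intg_disagreement s1 s2) (intg_dot sn sn) (intg_dot sn (sqint_noise_dir q s1 s2)) path).
rewrite addr0 in H; apply: (le_trans H).
by rewrite lerD2l ler_wpM2l// mulr_ge0// divr_ge0 ?sqr_ge0// ltW.
Qed.

Lemma mean_disagreement_step :
  mean_disagreement m.+1 <= (1 - gap th / 2) * mean_disagreement m
    + noise_gain th mu L * q ^+ 4 * (n2 + B2 + mean_energy m + mean_disagreement m).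
Proof.
have [sn vn] := noise_variance L0 fsmooth hnoise t0 mt.
have [p [pE p0]] : exists p, p = noise_gain th mu L * q ^+ 4 /\ 0 <= p.
  eexists; split; first reflexivity.
  have /andP[g0 _] := gap_bounds th01.
  have q4 : 0 <= q ^+ 4 by rewrite exprn_ge0//; have [/ltW] := andP q01.
  have k1 : 0 <= 3 / (gap th * mu ^+ 2).
    by rewrite divr_ge0// mulr_ge0 ?sqr_ge0// ltW.
  have k2 : 0 <= 8 * L ^+ 2 / mu by rewrite divr_ge0 ?(ltW mu0)// mulr_ge0// sqr_ge0.
  have k3 : 0 <= 16 * L ^+ 2 / gap th by rewrite divr_ge0 ?(ltW g0)// mulr_ge0// sqr_ge0.
  by rewrite /noise_gain mulr_ge0// mulr_ge0// !addr_ge0.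
rewrite -pE.
have path om : disagreement W th (st t m.+1 om).1 (st t m.+1 om).2 <=
    (1 - gap th / 2 + p) * disagreement W th (st t m om).1 (st t m om).2
    + p * energy f mu xs q (st t m om).1 (st t m om).2
    + p * dot (xi t m om) (xi t m om) + p * B2.
  rewrite stateS /=.
  have := dasg_disagreement_step N0 Wsym Wrow Wpsd Wdir th01 Wgap mu0 L0 fcvx fsmooth xsmin q01
    (st t m om).1 (st t m om).2 (xi t m om).
  rewrite -pE; lra.
have H : mean_disagreement m.+1 <= (1 - gap th / 2 + p) * mean_disagreement m
    + p * mean_energy m + p * mean P (fun om => dot (xi t m om) (xi t m om)) + p * B2.
  exact: (mean_le4 (mean_cst P (p * B2)) (intg_disagreement s1' s2')
    (intg_disagreement s1 s2) (intg_energy q s1 s2) (intg_dot sn sn)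
    (intg_cst P (p * B2)) path).
move: H (ler_wpM2l p0 vn).
move: (mean_disagreement m.+1) (mean_disagreement m) (mean_energy m) (mean P _) n2 B2.
move=> a b c e n B; lra.
Qed.

Lemma mean_pen_step : q ^+ 2 / mu * L <= lmin ->
  mean_pen m.+1 <= (1 - q) * mean_pen m + q ^+ 2 / mu * n2.
Proof.
move=> qlmin; have [sn vn] := noise_variance L0 fsmooth hnoise t0 mt.
have orth : mean P (fun om => dot (xi t m om)
    (pen_noise_dir W f mu xs q (st t m om).1 (st t m om).2)) = 0.
  apply: (noise_orthogonal L0 fsmooth hnoise) => //; first exact: sqint_pen_noise_dir.
  move=> i; have [m1 m2] := measurable_past_state hnoise i (erefl (total_len len t.-1 + m)%N).
  exact: measurable_pen_noise_dir.
have path om : pen_energy W f mu xs q (st t m.+1 om).1 (st t m.+1 om).2 <=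
    (1 - q) * pen_energy W f mu xs q (st t m om).1 (st t m om).2
    + q ^+ 2 / mu * dot (xi t m om) (xi t m om) + 0 * dot (xi t m om) (xi t m om)
    + dot (xi t m om) (pen_noise_dir W f mu xs q (st t m om).1 (st t m om).2).
  rewrite stateS mul0r addr0; exact: (pen_energy_step Wsym Wdir Wmin xs mu0 L0 fcvx fsmooth q01 qlmin).
have H : mean_pen m.+1 <= (1 - q) * mean_pen m
    + q ^+ 2 / mu * mean P (fun om => dot (xi t m om) (xi t m om))
    + 0 * mean P (fun om => dot (xi t m om) (xi t m om)) + 0.
  exact: (mean_le4 orth (intg_pen_energy q s1' s2') (intg_pen_energy q s1 s2)
    (intg_dot sn sn) (intg_dot sn sn) (intg_dot sn (sqint_pen_noise_dir q s1 s2)) path).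
rewrite mul0r !addr0 in H; apply: (le_trans H).
by rewrite lerD2l ler_wpM2l// divr_ge0 ?sqr_ge0// ltW.
Qed.

End OneStage.

Definition sqdist t m := mean P (fun om => dot ((st t m om).1 - X) ((st t m om).1 - X)).

Let sq1 t m (t0 : (0 < t)%N) (ml : (m <= len t)%N) :=
  (sqint_state L0 fsmooth hnoise t0 ml).1.
Let sq2 t m (t0 : (0 < t)%N) (ml : (m <= len t)%N) :=
  (sqint_state L0 fsmooth hnoise t0 ml).2.

Lemma state_restart t om : (0 < t)%N -> st t.+1 0 om = ((st t (len t) om).1, (st t (len t) om).1).
Proof. by case: t. Qed.

Lemma sqdist_restart t : (0 < t)%N -> sqdist t.+1 0 = sqdist t (len t).
Proof.
by move=> t0; congr (mean P _); apply/funext => om; rewrite state_restart.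
Qed.

Lemma mean_energy_start t q : (0 < t)%N ->
  mean_energy t q 0 <= (L + mu) / 2 * sqdist t 0.
Proof.
move=> t0; have i1 := intg_dist (sq1 t0 (leq0n _)).
rewrite -(meanZ _ i1); apply: le_mean.
- exact: intg_energy (sq1 t0 (leq0n _)) (sq2 t0 (leq0n _)).
- exact: intgZ.
move=> om; have -> : (st t 0 om).2 = (st t 0 om).1 by [].
set y := (st t 0 om).1; apply: (le_trans (energy_start N0 mu L0 fsmooth xsmin q y)).
rewrite ler_wpM2l//; first by rewrite divr_ge0// addr_ge0// ltW.
by rewrite avg_subX// avg_le.
Qed.

Lemma mean_disagreement_start t : (0 < t)%N -> mean_disagreement t 0 <= sqdist t 0.
Proof.
move=> t0; apply: le_mean.
- exact: intg_disagreement (sq1 t0 (leq0n _)) (sq2 t0 (leq0n _)).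
- exact: intg_dist (sq1 t0 (leq0n _)).
move=> om; have -> : (st t 0 om).2 = (st t 0 om).1 by [].
set y := (st t 0 om).1; apply: (le_trans (consensus_le Wpsd th01 _)).
have -> : dev y = dev (y - X) by rewrite /dev -avg_subX// opprB addrA subrK.
exact: dev_le.
Qed.

Lemma mean_energy_restart t q q' : (0 < t)%N ->
  mean_energy t.+1 q' 0 <= 2 * mean_energy t q (len t).
Proof.
move=> t0; have i1 := intg_energy q (sq1 t0 (leqnn _)) (sq2 t0 (leqnn _)).
rewrite -(meanZ _ i1); apply: le_mean.
- exact: intg_energy (sq1 (ltn0Sn t) (leq0n _)) (sq2 (ltn0Sn t) (leq0n _)).
- exact: intgZ.
move=> om; rewrite state_restart//=.
have -> : energy f mu xs q' (st t (len t) om).1 (st t (len t) om).1 =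
    energy f mu xs q (st t (len t) om).1 (st t (len t) om).1.
  by rewrite /energy !momentum_start.
exact: (energy_restart N0 mu0 L0 fcvx fsmooth xsmin).
Qed.

Lemma mean_disagreement_restart t : (0 < t)%N ->
  mean_disagreement t.+1 0 <= mean_disagreement t (len t).
Proof.
move=> t0; apply: le_mean.
- exact: intg_disagreement (sq1 (ltn0Sn t) (leq0n _)) (sq2 (ltn0Sn t) (leq0n _)).
- exact: intg_disagreement (sq1 t0 (leqnn _)) (sq2 t0 (leqnn _)).
by move=> om; rewrite state_restart//=; exact: (consensus_restart _ th01).
Qed.

Lemma mean_energy_ge0 t q m : 0 <= mean_energy t q m.
Proof. by apply: mean_ge0 => om; exact: (energy_ge0 N0 mu0 L0 fcvx fsmooth xsmin). Qed.

Lemma mean_disagreement_ge0 t m : 0 <= mean_disagreement t m.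
Proof. by apply: mean_ge0 => om; exact: (consensus_ge0 Wdir th01). Qed.

(** Pythagoras: the energy sees the average of the iterate, the disagreement its deviation. *)
Lemma sqdist_le t q m : (0 < t)%N -> (m <= len t)%N ->
  sqdist t m <= 2 / mu * mean_energy t q m + 2 / gap th * mean_disagreement t m.
Proof.
move=> t0 ml; have [s1 s2] := (sq1 t0 ml, sq2 t0 ml).
have ie := intg_energy q s1 s2; have id := intg_disagreement s1 s2.
have /andP[g0 _] := gap_bounds th01.
rewrite -(meanZ _ ie) -(meanZ _ id) -(meanD (intgZ _ ie) (intgZ _ id)); apply: le_mean.
- exact: intg_dist.
- exact: intgD (intgZ _ ie) (intgZ _ id).
move=> om /=; set x := (st t m om).1; set v := (st t m om).2.
rewrite (dotT_dev N0 (x - X)) -avg_subX//.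
have -> : dev (x - X) = dev x by rewrite /dev -avg_subX// opprB addrA subrK.
have h1 := energy_ge_dist N0 mu0 L0 fcvx fsmooth xsmin q x v.
have h2 := consensus_ge Wdir th01 (dev x) (dev v).
move: h1 h2; set A := dot (avg _ _ *m x - X) _; set D := dot (dev x) _.
set Eg := energy _ _ _ _ _ _; set C := consensus _ _ _ _ => h1 h2.
apply: lerD.
  have m2 : 0 <= 2 / mu by rewrite divr_ge0// ltW.
  have := ler_wpM2l m2 h1.
  by have -> // : 2 / mu * (mu / 2 * A) = A by field; rewrite gt_eqF.
have g2 : 0 <= 2 / gap th by rewrite divr_ge0// ltW.
apply: le_trans (ler_wpM2l g2 h2).
have -> : 2 / gap th * (gap th / 2 * (D + dot (dev x - dev v) (dev x - dev v))) =
  D + dot (dev x - dev v) (dev x - dev v) by field; rewrite gt_eqF.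
by rewrite lerDl dot_ge0.
Qed.

(** The recursion for [mean_pen], entered through [pen_energy_start] and left through
    [pen_energy_ge]; the final term B2 / mu is the price of measuring from X and does not decrease
    with m. *)
Lemma crude_stage t q m : (0 < t)%N -> 0 < q < 1 -> q ^+ 2 / mu = alpha t ->
  q ^+ 2 / mu * L <= lmin -> (m <= len t)%N ->
  sqdist t m <= 4 / mu * ((1 - q) ^+ m *
    ((mu + mu / (2 * q ^+ 2)) * sqdist t 0 + B2 / (2 * mu)) + q / mu * n2 + B2 / mu).
Proof.
move=> t0 q01 qa qL ml; have [q0 q1] := andP q01.
have [s1 s2] := (sq1 t0 ml, sq2 t0 ml).
have [s10 s20] := (sq1 t0 (leq0n (len t)), sq2 t0 (leq0n (len t))).
have n0 : 0 <= n2 by rewrite mulr_ge0 ?sqr_ge0.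
have rec k : (k <= len t)%N ->
    mean_pen t q k <= (1 - q) ^+ k * mean_pen t q 0 + q / mu * n2.
  apply: (affine_recursion (u := mean_pen t q)).
  - by rewrite subr_ge0 ltW.
  - by rewrite mulr_ge0// divr_ge0// ltW.
  move=> i il; have -> : (1 - (1 - q)) * (q / mu * n2) = q ^+ 2 / mu * n2 by ring.
  exact: mean_pen_step.
have start : mean_pen t q 0 <=
    (mu + mu / (2 * q ^+ 2)) * sqdist t 0 + B2 / (2 * mu).
  have ip := intg_pen_energy q s10 s20.
  have i1 := intgZ (mu + mu / (2 * q ^+ 2)) (intg_dist s10).
  have ic := intg_cst P (B2 / (2 * mu)).
  rewrite -[X in _ + X](mean_cst P) -(meanZ _ (intg_dist s10)) -(meanD i1 ic).
  apply: le_mean => //; first exact: intgD.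
  move=> om; have -> : (st t 0 om).2 = (st t 0 om).1 by [].
  exact: (pen_energy_start N0 Wsym Wrow Wmin xs mu0 L0 fsmooth q01 qL).
have finish : mu / 4 * sqdist t m - B2 / mu <= mean_pen t q m.
  have ip := intg_pen_energy q s1 s2.
  have i1 := intgZ (mu / 4) (intg_dist s1).
  have ic := intg_cst P (- (B2 / mu)).
  rewrite -[X in _ + X](mean_cst P) -(meanZ _ (intg_dist s1)) -(meanD i1 ic).
  apply: le_mean => //; first exact: intgD.
  move=> om; exact: (pen_energy_ge N0 Wsym Wrow Wdir xs mu0 fcvx fsmooth q01).
have q1' : 0 <= (1 - q) ^+ m by rewrite exprn_ge0// subr_ge0 ltW.
have := rec m ml; have := ler_wpM2l q1' start; move: finish.
have m4 : 0 < mu / 4 by rewrite divr_gt0.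
rewrite -[4 / mu]invf_div ler_pdivlMl//.
move: (sqdist t m) (mean_pen t q m) (mean_pen t q 0) => a b c h1 h2 h3.
by move: h1 h2 h3; lra.
Qed.

End ExpectedDecrease.

Lemma natceil_itv (R : realType) (x : R) : 0 <= x -> x <= (natceil x)%:R < x + 1.
Proof.
move=> x0; have c0 : 0 <= Num.ceil x by rewrite ceil_ge0 (lt_le_trans _ x0)// ltrN10.
have /andP[h1 h2] := ceil_itv x.
have E : (natceil x)%:R = (Num.ceil x)%:~R :> R by rewrite /natceil natr_absz ger0_norm.
by rewrite E h2 -ltrBlDr -[1]/(1%:~R) -intrB.
Qed.

(** * A bound uniform over all stages and all data *)

Section Assembly.
Variables (R : realType) (N d : nat) (E : rel 'I_N) (W : 'M[R]_N) (lam : seq R) (mu L : R).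
Hypotheses (hN : (1 < N)%N) (hE : connected_graph E) (hW : mixing_matrix E W).
Hypotheses (hlam : eigenvalues W lam) (hlamN : 0 < lam`_N.-1) (hmu : 0 < mu <= L).

Let lamN := lam`_N.-1.
Let kt := kappa_tilde mu L lamN.
Let alpha := stepsize mu L lamN.
Let ell := (Num.sqrt kt)^-1.

Let mu0 : 0 < mu. Proof. by have [] := andP hmu. Qed.
Let L0 : 0 < L. Proof. by have [a b] := andP hmu; exact: lt_le_trans a b. Qed.
Let N0 : (0 < N)%N. Proof. exact: ltnW. Qed.
Let Wsym := mixing_sym hW.
Let Wrow := mixing_row hW.

Lemma lamN_le1 : lamN <= 1.
Proof.
apply: (eigenvalue_le1 Wsym hlam hW).
by rewrite mem_nth// (size_eigenvalues Wsym hlam) prednK.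
Qed.

(** Follows from L >= mu and lamN <= 1; it puts [ell] strictly below 1. *)
Lemma kappa_tilde_ge2 : 2 <= kt.
Proof.
rewrite /kt /kappa_tilde ler_pdivlMr ?mulr_gt0//.
have := ler_wpM2l (ltW mu0) lamN_le1; have [_ +] := andP hmu; lra.
Qed.

Lemma ell_bounds : 0 < ell < 1.
Proof.
have k2 := kappa_tilde_ge2.
have s1 : 1 < Num.sqrt kt by rewrite -[1]sqrtr1 ltr_sqrt; lra.
by rewrite /ell invr_gt0 invf_lt1 ?s1 ?(lt_trans _ s1).
Qed.

Lemma ell_sqr : ell ^+ 2 = mu * lamN / (L + mu).
Proof.
have k2 := kappa_tilde_ge2.
by rewrite /ell exprVn sqr_sqrtr ?invf_div//; lra.
Qed.

(** The square root of mu alpha_t. The first stage stands apart because alpha_1 lacks the factor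
    2^(-2t) of the later step sizes. *)
Definition momentum_gap t : R := if t == 1%N then ell else halving_step ell t.

Lemma momentum_gap_bounds t : (0 < t)%N -> 0 < momentum_gap t < 1.
Proof.
have /andP[l0 l1] := ell_bounds; rewrite /momentum_gap; case: eqP => _ t0; first by rewrite l0.
have h0 : 0 < (2^-1) ^+ t :> R by rewrite exprn_gt0// invr_gt0.
rewrite /halving_step mulr_gt0//=; apply: le_lt_trans l1.
rewrite ler_piMr ?(ltW l0)// exprn_ile1// ?invr_ge0// invf_le1//; lra.
Qed.

Lemma momentum_gap_alpha t : (0 < t)%N -> momentum_gap t ^+ 2 / mu = alpha t.
Proof.
have LM : 0 < L + mu by rewrite addr_gt0.
rewrite /momentum_gap /alpha /stepsize; case: eqP => _ t0.
  by rewrite ell_sqr; field; rewrite !gt_eqF.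
rewrite /halving_step exprMn ell_sqr -exprM mulnC exprVn; field.
by rewrite !gt_eqF// exprn_gt0.
Qed.

Lemma momentum_gap_smooth t : (0 < t)%N -> momentum_gap t ^+ 2 / mu * L <= lamN.
Proof.
move=> t0; have /andP[q0 q1] := momentum_gap_bounds t0.
have le_ell : momentum_gap t <= ell.
  have /andP[l0 l1] := ell_bounds; rewrite /momentum_gap; case: eqP => // _.
  by rewrite ler_piMr ?(ltW l0)// exprn_ile1// ?invr_ge0// invf_le1//; lra.
have sq : momentum_gap t ^+ 2 <= ell ^+ 2.
  by rewrite ler_sqr ?nnegrE ?(ltW q0)//; have /andP[/ltW] := ell_bounds.
apply: (@le_trans _ _ (ell ^+ 2 / mu * L)).
  by rewrite ler_wpM2r ?(ltW L0)// ler_wpM2r ?invr_ge0 ?(ltW mu0).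
have LM : 0 < L + mu by rewrite addr_gt0.
have -> : ell ^+ 2 / mu * L = lamN * (L / (L + mu)).
  by rewrite ell_sqr; field; rewrite !gt_eqF.
rewrite ler_piMr ?(ltW hlamN)// ler_pdivrMr// mul1r lerDl; exact: ltW.
Qed.

Variable p : R.
Hypothesis hp : 7 <= p.

Let mult : nat := natceil (p * Num.sqrt kt * ln 2).

Lemma mult_ge : p * ln 2 <= mult%:R * ell /\ (0 < mult)%N.
Proof.
have /andP[l0 l1] := ell_bounds.
have ln20 : 0 < ln 2 :> R by rewrite ln_gt0// ltr1n.
have s0 : 0 < Num.sqrt kt by move: l0; rewrite /ell invr_gt0.
have p0 : 0 < p by move: hp; lra.
have x0 : 0 < p * Num.sqrt kt * ln 2 by rewrite !mulr_gt0.
have /andP[h1 _] := natceil_itv (ltW x0).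
split; last by rewrite -(ltr_nat R) (lt_le_trans x0).
rewrite /ell ler_pdivlMr//; apply: le_trans h1.
by rewrite mulrAC.
Qed.

(** A single factor for all three terms of [crude_stage]: 3 / mu covers q / mu in front of the noise
    and both multiples of |gradF X|^2. *)
Definition crude_gain (q : R) : R := 4 / mu * (mu + mu / (2 * q ^+ 2) + 3 / mu).

Lemma crude_gain_ge0 q : 0 <= crude_gain q.
Proof.
have m0 := ltW mu0.
have h1 : 0 <= mu / (2 * q ^+ 2) by rewrite divr_ge0// mulr_ge0// sqr_ge0.
have h2 : 0 <= 3 / mu by rewrite divr_ge0.
by rewrite mulr_ge0 ?divr_ge0 ?addr_ge0.
Qed.

(* [crude_const t] bounds the error at the beginning of stage t + 2. *)
Fixpoint crude_const t : R :=
  if t is t'.+1 then crude_gain (momentum_gap t'.+2) * (crude_const t' + 1)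
  else crude_gain ell.

Lemma crude_const_ge0 t : 0 <= crude_const t.
Proof.
elim: t => [|t IH] /=; first exact: crude_gain_ge0.
by apply: mulr_ge0; [exact: crude_gain_ge0|exact: addr_ge0].
Qed.

(** K must serve every f, starting point, noise and k1 at once. The first-stage factor (1 - ell)^k1
    is kept inside the initial error because the exponential rate of the second claim comes from
    it. *)
Definition dasg_const (K : R) : Prop :=
  forall (f : 'I_N -> 'rV[R]_d -> R) (xs : 'rV[R]_d) (x0 : 'M[R]_(N, d))
    (dO : measure_display) (Om : measurableType dO) (P : probability Om R)
    (dZ : measure_display) (Z : 'I_N -> measurableType dZ)
    (g : forall i : 'I_N, 'rV[R]_d -> Z i -> 'rV[R]_d)
    (w : nat -> forall i : 'I_N, Om -> Z i) (sigma : R) (k1 : nat),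
  let len := stage_length kt p k1 in
  (forall i, strongly_convex mu (f i)) ->
  (forall i, lipschitz_gradient L (f i)) ->
  minimizer (average f) xs ->
  noise_assumptions P g w W mu alpha len x0 f sigma ->
  forall t m, (1 < t)%N -> (m <= len t)%N ->
  ('E_P[fun om => (norm2 (dmasg_x W mu alpha len (noisy_grad g w om) x0 t m
       - stack N xs) ^+ 2)%R] <=
   (K * error_scale p ((1 - ell) ^+ k1 * norm2 (x0 - stack N xs) ^+ 2)
      (N%:R * sigma ^+ 2) (C1 mu L f ^+ 2) t)%:E)%E.

Lemma dasg_bound : exists2 K : R, 0 <= K & dasg_const K.
Proof.
have Wdir := @dirichlet_ge0 R N E W d hW.
have Wmin := @dot_mix_ge R N W lam Wsym hlam d.
have [th th01 Wgap] := spectral_gap d N0 hE hW.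
have /andP[g0 g1] := gap_bounds th01.
have Wpsd (x : 'M[R]_(N, d)) : 0 <= dot x (W *m x).
  by apply: le_trans (Wmin x); rewrite mulr_ge0 ?dot_ge0// ltW.
have /andP[l0 l1] := ell_bounds.
have LM : 0 < L + mu by rewrite addr_gt0.
have p0 : 0 < p by move: hp; lra.
have de0 : 0 < (2 * p)^-1 by rewrite invr_gt0 mulr_gt0.
pose c1 := (2 / (mu * (2 * p)^-1) + 2 / mu) * L ^+ 2 * (4 / gap th).
have hc1 : 0 < c1.
  have h1 : 0 < 2 / (mu * (2 * p)^-1) by rewrite divr_gt0// mulr_gt0.
  have h2 : 0 < 2 / mu by rewrite divr_gt0.
  have h3 : 0 < 4 / gap th by rewrite divr_gt0.
  by rewrite /c1; apply: mulr_gt0 => //; apply: mulr_gt0; [exact: addr_gt0|exact: exprn_gt0].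
pose c2 := noise_gain th mu L.
have hc2 : 0 < c2.
  have h1 : 0 < gap th * mu ^+ 2 by rewrite mulr_gt0// exprn_gt0.
  have h2 : 0 <= 8 * L ^+ 2 / mu by rewrite divr_ge0 ?(ltW mu0)// mulr_ge0 ?sqr_ge0.
  have h3 : 0 <= 16 * L ^+ 2 / gap th by rewrite divr_ge0 ?(ltW g0)// mulr_ge0 ?sqr_ge0.
  by rewrite /c2 /noise_gain mulr_gt0 ?divr_gt0//; move: h2 h3; lra.
have hc3 : 0 < 2 / mu by rewrite divr_gt0.
have htau : 0 < gap th <= 1 by rewrite g0 (le_trans g1)// invf_le1; lra.
have hell : 0 < ell <= 1 by rewrite l0 ltW.
have muL0 : 0 < mu / L by rewrite divr_gt0.
have [T0 T2 [qsmall multi]] := multistage hc1 hc2 hc3 htau hp hell muL0.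
pose r := rate p.
have r0 : 0 < r := rate_gt0 p; have r1 : r <= 32^-1 := rate_le hp.
(* The crude bound is a multiple of X + n + B, and each of the three coefficients in [error_scale]
   at T0 is at least r^T0; dividing by r^T0 puts the bound in the form that [multi] takes as
   input. *)
pose K0 := ((L + mu) / 2 + 1) * crude_const (T0 - 2) * (r ^+ T0)^-1.
have rT : 0 < (r ^+ T0)^-1 by rewrite invr_gt0 exprn_gt0.
have K00 : 0 <= K0.
  have h1 : 0 <= (L + mu) / 2 by rewrite divr_ge0// ltW.
  apply: mulr_ge0; last exact: ltW.
  by apply: mulr_ge0; [exact: addr_ge0|exact: crude_const_ge0].
have [K Kp hK] := multi K0 K00.
pose Ka := (\sum_(i < T0) crude_const i.+1) * (r ^+ T0)^-1.
have Ka0 : 0 <= Ka.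
  by rewrite mulr_ge0 ?(ltW rT)// sumr_ge0// => i _; exact: crude_const_ge0.
exists (Ka + (2 / mu + 2 / gap th) * K).
  apply: addr_ge0 => //; apply: mulr_ge0 => //.
  by apply: addr_ge0; [exact: ltW|rewrite divr_ge0// ltW].
move=> f xs x0 dO Om P dZ Z g w sigma k1 len fcvx fsmooth xsmin hnoise t m t1 ml.
have t0 : (0 < t)%N by exact: ltnW.
set X := (1 - ell) ^+ k1 * _; set n := N%:R * sigma ^+ 2; set B := C1 mu L f ^+ 2.
pose sq := sqdist W mu xs alpha len x0 P g w.
have X0 : 0 <= X by rewrite mulr_ge0 ?sqr_ge0// exprn_ge0// subr_ge0 ltW.
have n0 : 0 <= n by rewrite mulr_ge0// sqr_ge0.
have B0 : 0 <= B by rewrite sqr_ge0.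
have B2B : dot (gradF f (stack N xs)) (gradF f (stack N xs)) <= B.
  exact: gradF_minimizer_C1.
have m0 : 0 < mu^-1 by rewrite invr_gt0.
have sq0 t' m' : 0 <= sq t' m' by apply: mean_ge0 => om; exact: dot_ge0.
have crude t' m' : (0 < t')%N -> (m' <= len t')%N ->
    sq t' m' <= crude_gain (momentum_gap t') *
      ((1 - momentum_gap t') ^+ m' * sq t' 0%N + n + B).
  move=> t'0 m'l; have /andP[q0 q1] := momentum_gap_bounds t'0.
  have := crude_stage N0 Wsym Wrow Wmin Wdir xs mu0 L0 fcvx fsmooth hnoise t'0
    (momentum_gap_bounds t'0) (momentum_gap_alpha t'0) (momentum_gap_smooth t'0) m'l.
  move=> /le_trans; apply; rewrite /crude_gain -/(sq t' 0%N) -/n.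
  have p4 : 0 <= 4 / mu by rewrite divr_ge0// ltW.
  rewrite -[leRHS]mulrA; apply: ler_wpM2l => //.
  set q := momentum_gap t' in q0 q1 *.
  have e0 : 0 <= (1 - q) ^+ m' by rewrite exprn_ge0// subr_ge0 ltW.
  have e1 : (1 - q) ^+ m' <= 1 by rewrite exprn_ile1// ?subr_ge0 ?gerBl ltW.
  have k0 : 0 <= mu / (2 * q ^+ 2).
    by rewrite divr_ge0 ?(ltW mu0)// mulr_ge0 ?sqr_ge0.
  have es0 := mulr_ge0 e0 (sq0 t' 0%N).
  move: (sq0 t' 0%N) es0 e0 e1 k0 B2B (dot_ge0 (gradF f (stack N xs))).
  move: ((1 - q) ^+ m') (sq t' 0%N) (mu / (2 * q ^+ 2)) (dot _ _) => e s k b.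
  move=> s0 es0 e0 e1 k0 bB b0.
  have h1 : e * (b / (2 * mu)) <= B / mu.
    apply: (@le_trans _ _ (1 * (b / (2 * mu)))).
      by rewrite ler_wpM2r// divr_ge0// mulr_ge0// ltW.
    rewrite mul1r invfM; have := ler_wpM2r (ltW m0) bB.
    by have := mulr_ge0 b0 (ltW m0); lra.
  have h2 : b / mu <= B / mu by rewrite ler_wpM2r// ltW.
  have h3 : q / mu * n <= 3 / mu * n.
    by rewrite ler_wpM2r// ler_wpM2r ?ltW//; lra.
  have h4 : 0 <= mu * n by rewrite mulr_ge0// ltW.
  have h5 : 0 <= mu * B by rewrite mulr_ge0// ltW.
  have h6 := mulr_ge0 k0 n0; have h7 := mulr_ge0 k0 B0.
  have h8 : 0 <= e * s / mu by rewrite mulr_ge0// ltW.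
  have h9 : 0 <= B / mu by rewrite mulr_ge0// ltW.
  lra.
pose U := X + n + B.
have U0 : 0 <= U by rewrite !addr_ge0.
have start1 : sq 1%N 0%N = norm2 (x0 - stack N xs) ^+ 2.
  by rewrite norm2_sqr -[RHS](mean_cst P).
have stage2 i : sq i.+2 0%N <= crude_const i * U.
  elim: i => [|i IH].
    rewrite /sq sqdist_restart//; have := @crude 1%N (len 1%N) isT (leqnn _).
    by rewrite start1.
  rewrite /sq sqdist_restart//; apply: (le_trans (crude i.+2 (len i.+2) isT (leqnn _))).
  rewrite /= -[leRHS]mulrA; apply: ler_wpM2l; first exact: crude_gain_ge0.
  have /andP[q0 q1] := @momentum_gap_bounds i.+2 isT.
  have : (1 - momentum_gap i.+2) ^+ len i.+2 * sq i.+2 0%N <= sq i.+2 0%N.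
    by rewrite ler_piMl// exprn_ile1// ?subr_ge0 ?gerBl ltW.
  by rewrite mulrDl mul1r /U in IH *; move: IH X0; lra.
have any i m' : (m' <= len i.+2)%N -> sq i.+2 m' <= crude_const i.+1 * U.
  move=> m'l; apply: (le_trans (crude i.+2 m' isT m'l)).
  rewrite /= -[leRHS]mulrA; apply: ler_wpM2l; first exact: crude_gain_ge0.
  have /andP[q0 q1] := @momentum_gap_bounds i.+2 isT.
  have := stage2 i.
  have : (1 - momentum_gap i.+2) ^+ m' * sq i.+2 0%N <= sq i.+2 0%N.
    by rewrite ler_piMl// exprn_ile1// ?subr_ge0 ?gerBl ltW.
  by rewrite mulrDl mul1r /U; move: X0; lra.
pose S t' := error_scale p X n B t'.
have S0 t' : 0 <= S t' by apply: error_scale_ge0.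
have US t' : (t' <= T0)%N -> U <= (r ^+ T0)^-1 * S t'.
  move=> tT; rewrite ler_pdivlMl ?exprn_gt0// /S /error_scale /U !mulrDr -/r.
  have rr : r ^+ T0 <= r ^+ t' by apply: ler_wiXn2l => //; [exact: ltW|lra].
  have h1 : r ^+ t' <= (2^-1) ^+ t' by apply: lerXn2r; rewrite ?nnegrE ?(ltW r0)//; lra.
  have h4 : r ^+ t' <= ((2^-1) ^+ t') ^+ 4.
    rewrite -exprM mulnC exprM; apply: lerXn2r; rewrite ?nnegrE ?(ltW r0)//.
    by rewrite (le_trans r1)//; lra.
  have := ler_wpM2r X0 rr; have := ler_wpM2r n0 (le_trans rr h1).
  by have := ler_wpM2r B0 (le_trans rr h4); lra.
have -> : ('E_P[fun om => (norm2 (dmasg_x W mu alpha len (noisy_grad g w om) x0 t m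
    - stack N xs) ^+ 2)%R])%E = (sq t m)%:E.
  have hI := intg_dist xs (sqint_state L0 fsmooth hnoise t0 ml).1.
  have -> : (fun om => norm2 (dmasg_x W mu alpha len (noisy_grad g w om) x0 t m
      - stack N xs) ^+ 2) = fun om => dot ((state W mu alpha len x0 g w t m om).1 - stack N xs)
      ((state W mu alpha len x0 g w t m om).1 - stack N xs).
    by apply/funext => om; rewrite norm2_sqr.
  by rewrite unlock /sq /sqdist /mean /Rintegral fineK//; exact: integrable_fin_num.
rewrite lee_fin -/(S t) mulrDl.
have St := S0 t.
have gaps : 0 <= 2 / mu + 2 / gap th.
  by apply: addr_ge0; [exact: ltW|rewrite divr_ge0// ltW].
(* Early stages are covered by the crude bound, the others by the coupled recursion started at
   T0. *)
have [tT|Tt] := ltnP t T0.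
  apply: (@le_trans _ _ (Ka * S t)); last first.
    by rewrite lerDl mulr_ge0// mulr_ge0.
  case: t t1 tT ml t0 {St} => [|[|i]]// _ tT ml _.
  apply: (le_trans (any i m ml)).
  have iT : (i < T0)%N by exact: ltn_trans (ltnSn _) (ltn_trans (ltnSn _) tT).
  have h1 : crude_const i.+1 <= \sum_(j < T0) crude_const j.+1.
    rewrite (bigD1 (Ordinal iT))//= lerDl; apply: sumr_ge0 => j _; exact: (crude_const_ge0 j.+1).
  apply: (le_trans (ler_wpM2r U0 h1)); rewrite /Ka -mulrA; apply: ler_wpM2l.
    by rewrite sumr_ge0// => j _; exact: crude_const_ge0.
  exact/US/ltnW.
apply: (@le_trans _ _ ((2 / mu + 2 / gap th) * K * S t)); last first.
  by rewrite lerDr mulr_ge0.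
have gapE t' : (T0 <= t')%N -> momentum_gap t' = halving_step ell t'.
  by rewrite /momentum_gap => Tt'; case: eqP => // t'1; move: (leq_trans T2 Tt'); rewrite t'1.
have pos t' : (T0 <= t')%N -> (0 < t')%N by move=> Tt'; exact: leq_trans (ltnW T2) Tt'.
have q01 t' : (T0 <= t')%N -> 0 < halving_step ell t' < 1.
  by move=> Tt'; rewrite -gapE//; apply/momentum_gap_bounds/pos.
have qalpha t' : (T0 <= t')%N -> halving_step ell t' ^+ 2 / mu = alpha t'.
  by move=> Tt'; rewrite -gapE//; apply/momentum_gap_alpha/pos.
pose a t' m' := mean_energy W f mu xs alpha len x0 P g w t' (halving_step ell t') m'.
pose b t' m' := mean_disagreement W th mu alpha len x0 P g w t' m'.
have lenE t' : (T0 <= t')%N -> len t' = (2 ^ t' * mult)%N.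
  move=> Tt'; rewrite /len /stage_length; case: eqP => // t'1.
  by move: (leq_trans T2 Tt'); rewrite t'1.
have [mult1 mult2] := mult_ge.
have TE : T0 = (T0 - 2).+2 by rewrite -addn2 subnK.
have sqT : sq T0 0%N <= crude_const (T0 - 2) * U by rewrite {1}TE; exact: stage2.
have cT : 0 <= crude_const (T0 - 2) by exact: crude_const_ge0.
have kT : crude_const (T0 - 2) * U <= crude_const (T0 - 2) * (r ^+ T0)^-1 * S T0.
  by rewrite -mulrA ler_wpM2l// US.
have kT0 : 0 <= crude_const (T0 - 2) * (r ^+ T0)^-1 * S T0.
  by rewrite mulr_ge0// mulr_ge0// ltW.
have LM2 : 0 <= (L + mu) / 2 by rewrite divr_ge0// ltW.
have K0E : K0 * S T0 = (L + mu) / 2 * (crude_const (T0 - 2) * (r ^+ T0)^-1 * S T0)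
    + crude_const (T0 - 2) * (r ^+ T0)^-1 * S T0.
  by rewrite /K0; ring.
have [at_ bt_] : a t m <= K * S t /\ b t m <= K * S t.
  apply: (hK len a b X n B X0 n0 B0) => //.
  - move=> t' Tt'; rewrite lenE//; split; last by rewrite leq_pmulr.
    have -> : (2 ^ t' * mult)%:R * halving_step ell t' = mult%:R * ell :> R.
      rewrite /halving_step natrM natrX exprVn.
      by field; rewrite gt_eqF// exprn_gt0.
    exact: mult1.
  - move=> t' m' Tt' _; split.
      exact: (mean_energy_ge0 W N0 mu0 L0 fcvx fsmooth xsmin).
    exact: (mean_disagreement_ge0 Wdir th01).
  - move=> t' m' Tt' m'l.
    have := mean_energy_step N0 Wsym Wrow Wdir th01 mu0 L0 fcvx fsmooth xsmin hnoise
      (pos _ Tt') (q01 _ Tt') (qalpha _ Tt') m'l de0 (qsmall _ Tt').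
    rewrite -/(a t' m'.+1) -/(a t' m') -/(b t' m') -/n -/c1.
    by have -> : 2 * (halving_step ell t' ^+ 2 / mu) * n = 2 / mu * halving_step ell t' ^+ 2 * n by ring.
  - move=> t' m' Tt' m'l.
    have := mean_disagreement_step N0 Wsym Wrow (ltW hlamN) Wmin Wdir th01 Wgap mu0 L0 fcvx
      fsmooth xsmin hnoise (pos _ Tt') (q01 _ Tt') (qalpha _ Tt') m'l.
    rewrite -/(b t' m'.+1) -/(a t' m') -/(b t' m') -/n -/c2.
    move=> /le_trans; apply; rewrite lerD2l; apply: ler_wpM2l.
      by rewrite mulr_ge0 ?(ltW hc2)// exprn_ge0// ltW//; have /andP[] := q01 _ Tt'.
    by rewrite lerD2r lerD2r lerD2l.
  - move=> t' Tt'; split.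
      rewrite /a; exact: (mean_energy_restart N0 mu0 L0 fcvx fsmooth xsmin hnoise
        (halving_step ell t') (halving_step ell t'.+1) (pos _ Tt')).
    rewrite /b; exact: (mean_disagreement_restart th01 L0 fsmooth hnoise (pos _ Tt')).
  - apply: (le_trans (mean_energy_start N0 mu0 L0 fcvx fsmooth xsmin hnoise _ (pos _ (leqnn _)))).
    rewrite -/(S T0) K0E.
    have := ler_wpM2l LM2 (le_trans sqT kT); move: kT0; rewrite -/(sq T0 0%N); lra.
  - apply: (le_trans (mean_disagreement_start N0 (ltW hlamN) Wmin th01 xs L0 fsmooth hnoise (pos _ (leqnn _)))).
    rewrite -/(S T0) K0E -/(sq T0 0%N); apply: (le_trans (le_trans sqT kT)).
    by rewrite lerDr mulr_ge0.
apply: (le_trans (sqdist_le N0 Wdir th01 mu0 L0 fcvx fsmooth xsmin hnoise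
  (halving_step ell t) t0 ml)).
rewrite -/(a t m) -/(b t m) -[leRHS]mulrA [leRHS]mulrDl.
by apply: lerD; apply: ler_wpM2l; rewrite // divr_ge0// ltW.
Qed.

End Assembly.

(** * From the stage index to the iteration count *)

Lemma total_len_le (R : realType) (kt p : R) (k1 t : nat) :
  (total_len (stage_length kt p k1) t <= k1 + 2 ^ t.+1 * natceil (p * Num.sqrt kt * ln 2))%N.
Proof.
elim: t => [|t IH]; first by rewrite /total_len big_geq.
rewrite total_lenS /stage_length; case: eqP => [[->]|_].
  by rewrite /total_len big_geq// add0n leq_addr.
by apply: (leq_trans (leq_add IH (leqnn _))); rewrite -addnA leq_add2l -mulnDl addnn -mul2n -expnS.
Qed.

(** Since 2 k1 <= k + 2, the later stages hold all but about half of the k iterations, and their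
    total length is at most 2^(t+1) M; hence k is at most a constant times 2^t. The slack 2 allows
    for rounding k / C up to an integer. *)
Lemma late_stage (R : realType) (kt p : R) (k1 k t : nat) :
  let len := stage_length kt p k1 in
  (k1 < k)%N -> (2 * k1 <= k + 2)%N -> (total_len len t.-1 < k <= total_len len t)%N ->
  [/\ (1 < t)%N, (k - total_len len t.-1 <= len t)%N &
   (k <= (4 * natceil (p * Num.sqrt kt * ln 2) + 2) * 2 ^ t)%N].
Proof.
move=> len k1k k1k2 /andP[kl kr].
have t1 : (1 < t)%N.
  case: t kl kr => [|[|//]] kl kr; first by move: (leq_trans kl kr); rewrite ltnn.
  have := leq_trans k1k kr; rewrite total_lenS {1}/total_len big_geq// add0n.
  by rewrite /len /stage_length eqxx ltnn.
split=> //.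
  by have := total_lenS len t.-1; rewrite leq_subLR (ltn_predK t1) => <-.
have := leq_trans kr (total_len_le kt p k1 t).
set M := natceil _; rewrite expnS -mulnA => h.
have : (0 < 2 ^ t)%N by rewrite expn_gt0.
move: (2 ^ t)%N h => e h e0.
have : (k <= 4 * (e * M) + 2)%N by move: (e * M)%N h k1k2 => x; lia.
move/leq_trans; apply; rewrite mulnDl -mulnA (mulnC M) leq_add2l.
by rewrite leq_pmulr.
Qed.

Lemma rate_powR (R : realType) (p : R) (t : nat) : rate p ^+ t = ((2^-1) ^+ t) `^ (p - 2).
Proof.
have h0 : 0 < 2^-1 :> R by rewrite invr_gt0.
rewrite -[in RHS]powR_mulrn ?(ltW h0)// -powRrM mulrC powRrM powR_mulrn ?powR_ge0//.
congr (_ ^+ _); rewrite /rate /powR gt_eqF// lnV ?posrE//; congr expR; ring.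
Qed.

Lemma late_stage_power (R : realType) (kt p : R) (k1 k t : nat) :
  let len := stage_length kt p k1 in
  (k1 < k)%N -> (2 * k1 <= k + 2)%N -> (total_len len t.-1 < k <= total_len len t)%N ->
  (2^-1) ^+ t <= (4 * natceil (p * Num.sqrt kt * ln 2) + 2)%:R / k%:R :> R.
Proof.
move=> len k1k k1k2 kl; have [_ _ kle] := late_stage k1k k1k2 kl.
have k0 : 0 < k%:R :> R by rewrite ltr0n (leq_ltn_trans _ k1k).
rewrite exprVn ler_pdivlMr// mulrC ler_pdivrMr ?exprn_gt0//.
by rewrite -natrX -natrM ler_nat.
Qed.

Theorem corollary16 (R : realType) (N d : nat) (E : rel 'I_N) (W : 'M[R]_N)
    (lam : seq R) (mu L : R)
    (hN : (1 < N)%N) (hE : connected_graph E) (hW : mixing_matrix E W)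
    (hlam : eigenvalues W lam) (hlamN : 0 < lam`_N.-1) (hmu : 0 < mu <= L) :
  let kt := kappa_tilde mu L lam`_N.-1 in
  let alpha := stepsize mu L lam`_N.-1 in
  let gam := gamma N lam in
  (forall p : R, 7 <= p ->
    exists2 K : R, 0 < K &
    forall (f : 'I_N -> 'rV[R]_d -> R) (xs : 'rV[R]_d) (x0 : 'M[R]_(N, d))
      (dO : measure_display) (Om : measurableType dO) (P : probability Om R)
      (dZ : measure_display) (Z : 'I_N -> measurableType dZ)
      (g : forall i : 'I_N, 'rV[R]_d -> Z i -> 'rV[R]_d)
      (w : nat -> forall i : 'I_N, Om -> Z i) (sigma : R),
    let k1 := natceil ((p - 2) * ln (6 * p * kt) * Num.sqrt kt) in
    let len := stage_length kt p k1 in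
    (forall i, strongly_convex mu (f i)) ->
    (forall i, lipschitz_gradient L (f i)) ->
    minimizer (average f) xs ->
    noise_assumptions P g w W mu alpha len x0 f sigma ->
    forall k t : nat, (2 * k1 <= k)%N ->
    (total_len len t.-1 < k <= total_len len t)%N ->
    ('E_P[fun om =>
        (norm2 (dmasg_x W mu alpha len (noisy_grad g w om) x0 t
                  (k - total_len len t.-1) - stack N xs) ^+ 2)%R] <=
      (K * ((k%:R `^ (p - 2))^-1 * norm2 (x0 - stack N xs) ^+ 2
            + N%:R * p * sigma ^+ 2 / (mu ^+ 2 * k%:R)
            + N%:R * p ^+ 4 * C1 mu L f ^+ 2 * (1 - gam) ^- 2
              / (mu ^+ 2 * k%:R ^+ 4)))%R%:E)%E)
  /\
  (forall C : R, 2 <= C ->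
    exists2 K : R, 0 < K &
    forall (f : 'I_N -> 'rV[R]_d -> R) (xs : 'rV[R]_d) (x0 : 'M[R]_(N, d))
      (dO : measure_display) (Om : measurableType dO) (P : probability Om R)
      (dZ : measure_display) (Z : 'I_N -> measurableType dZ)
      (g : forall i : 'I_N, 'rV[R]_d -> Z i -> 'rV[R]_d)
      (w : nat -> forall i : 'I_N, Om -> Z i) (sigma : R)
      (k : nat),
    let k1 := natceil (k%:R / C) in
    let len := stage_length kt 7 k1 in
    (forall i, strongly_convex mu (f i)) ->
    (forall i, lipschitz_gradient L (f i)) ->
    minimizer (average f) xs ->
    noise_assumptions P g w W mu alpha len x0 f sigma ->
    2 * Num.sqrt kt <= k%:R ->
    forall t : nat, (total_len len t.-1 < k <= total_len len t)%N ->
    ('E_P[fun om =>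
        (norm2 (dmasg_x W mu alpha len (noisy_grad g w om) x0 t
                  (k - total_len len t.-1) - stack N xs) ^+ 2)%R] <=
      (K * (expR (- (k%:R / (C * Num.sqrt kt))) * norm2 (x0 - stack N xs) ^+ 2
            + N%:R * sigma ^+ 2 / (mu ^+ 2 * k%:R)
            + N%:R * C1 mu L f ^+ 2 * (1 - gam) ^- 2
              / (mu ^+ 2 * k%:R ^+ 4)))%R%:E)%E).
Proof.
move=> kt alpha gam.
have mu0 : 0 < mu by have [] := andP hmu.
have N0 : 0 < N%:R :> R by rewrite ltr0n ltnW.
have /andP[l0 l1] := ell_bounds hN hW hlam hlamN hmu.
rewrite -/kt in l0 l1.
have s0 : 0 < Num.sqrt kt by rewrite -invr_gt0.
have s1 : 1 < Num.sqrt kt by rewrite -invf_lt1.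
(* For a given W this factor is a positive constant, so the constant K may be divided by it. *)
have gm0 : 0 < (1 - gam) ^- 2.
  rewrite invr_gt0 exprn_even_gt0//= subr_eq0 eq_sym.
  exact (gamma_neq1 (mixing_sym hW) hlam hE hW hN hlamN).
have mu20 : 0 < mu ^+ 2 by rewrite exprn_gt0.
split=> [p p7|C C2].
- have p0 : 0 < p by lra.
  have p2 : 0 <= p - 2 by lra.
  have [K K0 hK] := dasg_bound d hN hE hW hlam hlamN hmu p7.
  pose c : R := (4 * natceil (p * Num.sqrt kt * ln 2) + 2)%:R.
  have c0 : 0 < c by rewrite ltr0n addn2.
  (* With 2^(-t) <= c / k, the numbers c1, c2 and c4 are the ratios between the terms of
     [error_scale] and those of the claim. *)
  pose c1 := c `^ (p - 2).
  pose c4 := c ^+ 4 * mu ^+ 2 / (N%:R * p ^+ 4 * (1 - gam) ^- 2).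
  pose c2 := c * mu ^+ 2 / p.
  have c10 : 0 <= c1 by exact: powR_ge0.
  have d40 : 0 < N%:R * p ^+ 4 * (1 - gam) ^- 2.
    by apply: mulr_gt0 => //; apply: mulr_gt0 => //; exact: exprn_gt0.
  have c40 : 0 <= c4.
    by rewrite divr_ge0 ?(ltW d40)// mulr_ge0// ?exprn_ge0 ?(ltW mu20)// ltW.
  have c20 : 0 <= c2 by rewrite divr_ge0 ?(ltW p0)// mulr_ge0// ltW.
  have cs0 : 0 <= c1 + c4 + c2 by rewrite !addr_ge0.
  exists (K * (c1 + c4 + c2) + 1).
    by apply: ltr_wpDl => //; exact: mulr_ge0.
  move=> f xs x0 dO Om P dZ Z g w sigma k1 len fcvx fsmooth xsmin hnoise k t k1k kl.
  have k0 : (0 < k)%N by have /andP[h _] := kl; exact: leq_ltn_trans h.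
  have k1k' : (k1 < k)%N.
    by rewrite -(ltn_pmul2l (isT : 0 < 2)%N) (leq_ltn_trans k1k)// ltn_Pmull.
  have k1k2 : (2 * k1 <= k + 2)%N by exact: leq_trans k1k (leq_addr _ _).
  have [t1 ml _] := late_stage k1k' k1k2 kl.
  have hk := late_stage_power k1k' k1k2 kl; rewrite -/c in hk.
  have k0' : 0 < k%:R :> R by rewrite ltr0n.
  apply: (le_trans (hK _ _ _ _ _ _ _ _ _ _ _ k1 fcvx fsmooth xsmin hnoise _ _ t1 ml)).
  rewrite lee_fin -/kt.
  set x := norm2 _ ^+ 2; set B := C1 mu L f ^+ 2; set n := N%:R * sigma ^+ 2.
  have x0' : 0 <= x by exact: sqr_ge0.
  have B0 : 0 <= B by exact: sqr_ge0.
  have n0 : 0 <= n by rewrite mulr_ge0 ?sqr_ge0// ltW.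
  have hh : 0 <= (2^-1) ^+ t :> R by rewrite exprn_ge0// invr_ge0.
  have ck0 : 0 <= c / k%:R by rewrite divr_ge0// ltW.
  pose T1 := (k%:R `^ (p - 2))^-1 * x.
  pose T2 := N%:R * p * sigma ^+ 2 / (mu ^+ 2 * k%:R).
  pose T3 := N%:R * p ^+ 4 * B * (1 - gam) ^- 2 / (mu ^+ 2 * k%:R ^+ 4).
  have T10 : 0 <= T1 by rewrite mulr_ge0// invr_ge0 powR_ge0.
  have E3 : (c / k%:R) ^+ 4 * B = c4 * T3.
    rewrite /c4 /T3; move: ((1 - gam) ^- 2) gm0 => gm gm0.
    by field; rewrite !gt_eqF.
  have E2 : c / k%:R * n = c2 * T2 by rewrite /c2 /T2 /n; field; rewrite !gt_eqF.
  have T20 : 0 <= T2.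
    rewrite /T2; apply: divr_ge0; last by apply: mulr_ge0; exact: ltW.
    by apply: mulr_ge0; [apply: mulr_ge0; exact: ltW|exact: sqr_ge0].
  have T30 : 0 <= T3.
    rewrite /T3; apply: divr_ge0; last by apply: mulr_ge0; [exact: ltW|exact: exprn_ge0].
    apply: mulr_ge0; last exact: (ltW gm0).
    by apply: mulr_ge0 => //; apply: mulr_ge0; [exact: ltW|by rewrite exprn_ge0// ltW].
  (* The first stage is only bounded by 1 here: the power of k comes from rate^t, that is, 2^(-t) to
     the power p - 2. *)
  have i1 : rate p ^+ t * ((1 - (Num.sqrt kt)^-1) ^+ k1 * x) <= c1 * T1.
    apply: (@le_trans _ _ (rate p ^+ t * x)).
      apply: ler_wpM2l; first by rewrite exprn_ge0// ltW// rate_gt0.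
      by rewrite ler_piMl// exprn_ile1// ?subr_ge0 ?gerBl ltW.
    rewrite /c1 /T1 [leRHS]mulrA; apply: ler_wpM2r => //.
    rewrite rate_powR.
    have -> : (k%:R `^ (p - 2))^-1 = (k%:R^-1) `^ (p - 2).
      by rewrite -powRN -powR_inv1 ?(ltW k0')// -powRrM mulN1r.
    rewrite -powRM ?invr_ge0 ?(ltW k0') ?(ltW c0)//.
    by apply: ge0_ler_powR => //; rewrite nnegrE.
  have i2 : (2^-1) ^+ t * n <= c2 * T2 by rewrite -E2; exact: ler_wpM2r.
  have i3 : ((2^-1) ^+ t) ^+ 4 * B <= c4 * T3.
    by rewrite -E3; apply: ler_wpM2r => //; exact: lerXn2r.
  rewrite /error_scale.
  have j1 : c1 * T1 <= (c1 + c4 + c2) * T1.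
    by apply: ler_wpM2r => //; lra.
  have j2 : c2 * T2 <= (c1 + c4 + c2) * T2.
    by apply: ler_wpM2r => //; lra.
  have j3 : c4 * T3 <= (c1 + c4 + c2) * T3.
    by apply: ler_wpM2r => //; lra.
  apply: (@le_trans _ _ (K * ((c1 + c4 + c2) * (T1 + T2 + T3)))).
    by apply: ler_wpM2l => //; lra.
  rewrite mulrA; apply: ler_wpM2r; last by rewrite lerDl.
  by rewrite !addr_ge0.
- have [K K0 hK] := dasg_bound d hN hE hW hlam hlamN hmu (lexx 7).
  pose c : R := (4 * natceil (7 * Num.sqrt kt * ln 2) + 2)%:R.
  have c0 : 0 < c by rewrite ltr0n addn2.
  have C0 : 0 < C by lra.
  pose c4 := c ^+ 4 * mu ^+ 2 / (N%:R * (1 - gam) ^- 2).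
  pose c2 := c * mu ^+ 2.
  have d40 : 0 < N%:R * (1 - gam) ^- 2 by exact: mulr_gt0.
  have c40 : 0 <= c4.
    by rewrite divr_ge0 ?(ltW d40)// mulr_ge0// ?exprn_ge0 ?(ltW mu20)// ltW.
  have c20 : 0 <= c2 by rewrite mulr_ge0// ltW.
  have cs0 : 0 <= 1 + c4 + c2 by rewrite !addr_ge0.
  exists (K * (1 + c4 + c2) + 1).
    by apply: ltr_wpDl => //; exact: mulr_ge0.
  move=> f xs x0 dO Om P dZ Z g w sigma k k1 len fcvx fsmooth xsmin hnoise ks t kl.
  have k2 : 2 < k%:R :> R by lra.
  have k0' : 0 < k%:R :> R by lra.
  have /andP[kC k1C] := natceil_itv (divr_ge0 (ler0n R k) (ltW C0)).
  rewrite -/k1 in kC k1C.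
  have kC2 : k%:R / C <= k%:R / 2.
    by rewrite ler_wpM2l// lef_pV2// posrE.
  (* As k1 < k / 2 + 1 and k > 2, the iterate lies beyond the first stage. *)
  have k1k' : (k1 < k)%N by rewrite -(ltr_nat R); lra.
  have k1k2 : (2 * k1 <= k + 2)%N by rewrite -(ler_nat R) natrM natrD; lra.
  have [t1 ml _] := late_stage k1k' k1k2 kl.
  have hk := late_stage_power k1k' k1k2 kl; rewrite -/c in hk.
  apply: (le_trans (hK _ _ _ _ _ _ _ _ _ _ _ k1 fcvx fsmooth xsmin hnoise _ _ t1 ml)).
  rewrite lee_fin -/kt.
  set x := norm2 _ ^+ 2; set B := C1 mu L f ^+ 2; set n := N%:R * sigma ^+ 2.
  have x0' : 0 <= x by exact: sqr_ge0.
  have B0 : 0 <= B by exact: sqr_ge0.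
  have n0 : 0 <= n by rewrite mulr_ge0 ?sqr_ge0// ltW.
  have hh : 0 <= (2^-1) ^+ t :> R by rewrite exprn_ge0// invr_ge0.
  have ck0 : 0 <= c / k%:R by rewrite divr_ge0// ltW.
  pose T1 := expR (- (k%:R / (C * Num.sqrt kt))) * x.
  pose T2 := n / (mu ^+ 2 * k%:R).
  pose T3 := N%:R * B * (1 - gam) ^- 2 / (mu ^+ 2 * k%:R ^+ 4).
  have T10 : 0 <= T1 by rewrite mulr_ge0// expR_ge0.
  have E3 : (c / k%:R) ^+ 4 * B = c4 * T3.
    rewrite /c4 /T3; move: ((1 - gam) ^- 2) gm0 => gm gm0.
    by field; rewrite !gt_eqF.
  have E2 : c / k%:R * n = c2 * T2 by rewrite /c2 /T2; field; rewrite !gt_eqF.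
  have T20 : 0 <= T2.
    by rewrite /T2; apply: divr_ge0 => //; apply: mulr_ge0; exact: ltW.
  have T30 : 0 <= T3.
    rewrite /T3; apply: divr_ge0; last by apply: mulr_ge0; [exact: ltW|exact: exprn_ge0].
    by apply: mulr_ge0; [apply: mulr_ge0 => //; exact: ltW|exact: (ltW gm0)].
  (* Here the roles are exchanged: rate^t is bounded by 1, and 1 - s <= exp(- s) with k1 >= k / C
     gives the exponential. *)
  have i1 : rate 7 ^+ t * ((1 - (Num.sqrt kt)^-1) ^+ k1 * x) <= T1.
    have q0 : 0 <= 1 - (Num.sqrt kt)^-1 by rewrite subr_ge0 ltW.
    apply: (@le_trans _ _ ((1 - (Num.sqrt kt)^-1) ^+ k1 * x)).
      apply: ler_piMl; first by rewrite mulr_ge0// exprn_ge0.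
      apply: exprn_ile1; first exact: (ltW (rate_gt0 7)).
      by rewrite (le_trans (rate_le (lexx 7)))//; lra.
    apply: ler_wpM2r => //.
    apply: (@le_trans _ _ (expR (- (Num.sqrt kt)^-1) ^+ k1)).
      by apply: lerXn2r; rewrite ?nnegrE ?expR_ge0//; exact: expR_ge1Dx.
    rewrite -expRM_natl ler_expR mulrN lerN2 invfM mulrA.
    by apply: ler_wpM2r => //; exact: ltW.
  have i2 : (2^-1) ^+ t * n <= c2 * T2 by rewrite -E2; exact: ler_wpM2r.
  have i3 : ((2^-1) ^+ t) ^+ 4 * B <= c4 * T3.
    by rewrite -E3; apply: ler_wpM2r => //; exact: lerXn2r.
  rewrite /error_scale.
  have j1 : 1 * T1 <= (1 + c4 + c2) * T1.
    by apply: ler_wpM2r => //; lra.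
  have j2 : c2 * T2 <= (1 + c4 + c2) * T2.
    by apply: ler_wpM2r => //; lra.
  have j3 : c4 * T3 <= (1 + c4 + c2) * T3.
    by apply: ler_wpM2r => //; lra.
  apply: (@le_trans _ _ (K * ((1 + c4 + c2) * (T1 + T2 + T3)))).
    by apply: ler_wpM2l => //; lra.
  rewrite mulrA; apply: ler_wpM2r; last by rewrite lerDl.
  by rewrite !addr_ge0.
Qed.
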